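(* Let $b>0$. Let $f\in C(\mathbb{R})$ be strictly increasing with $f(0)=0$ and $f(s)\to\pm\infty$ as $s\to\pm\infty$. Let $g\in C(\mathbb{R})$ be positive and such that $|s|^{\alpha}g(s)\to C_\pm$ as $s\to\pm\infty$ for some exponent $\alpha>2$ and constants $C_\pm>0$. Let $u_0\in C([-b,b])$. Then there exists a unique viscosity solution $u\in C([-b,b]\times[0,\infty))$ of the singular Neumann problem $$u_t-f(g(u_x)u_{xx})=0\ \text{ in } (-b,b)\times(0,\infty),\qquad u_x(b,t)=\infty,\ u_x(-b,t)=-\infty\ \text{ for all } t>0,\qquad u(\cdot,0)=u_0\ \text{ in } [-b,b].$$
   Context: Notation: $Q=(-b,b)\times(0,\infty)$, $\overline{Q}=[-b,b]\times[0,\infty)$. The equation $u_t-f(g(u_x)u_{xx})=0$ in $Q$ with the boundary condition $u_x(\pm b,t)=\pm\infty$ for $t>0$ is understood in the following viscosity sense. Subsolution: an upper semicontinuous function $u$ on $\overline{Q}$ such that whenever $\phi\in C^2(\overline{Q})$ and $u-\phi$ attains a local maximum at $(x_0,t_0)\in Q$, one has $\phi_t(x_0,t_0)-f\big(g(\phi_x(x_0,t_0))\phi_{xx}(x_0,t_0)\big)\le 0$ (no condition is imposed at $x=\pm b$). Supersolution: a lower semicontinuous function $u$ on $\overline{Q}$ such that (i) whenever $\phi\in C^2(\overline{Q})$ and $u-\phi$ attains a local minimum at $(x_0,t_0)\in Q$, one has $\phi_t(x_0,t_0)-f\big(g(\phi_x(x_0,t_0))\phi_{xx}(x_0,t_0)\big)\ge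 0$; and (ii) for every $t>0$ and every $\phi\in C^2(\overline{Q})$, $u-\phi$ does not attain a local minimum (relative to $\overline{Q}$) at $(b,t)$ or at $(-b,t)$. Solution: a continuous function on $\overline{Q}$ that is both a subsolution and a supersolution. It is a solution of the initial-boundary value problem with initial value $u_0$ if moreover $u(\cdot,0)=u_0$ on $[-b,b]$. *)

(* Defs.v *)
From HB Require Import structures.
From mathcomp Require Import all_boot all_order all_algebra.
From mathcomp Require Import all_classical all_reals all_analysis.

Set Implicit Arguments.
Unset Strict Implicit.
Unset Printing Implicit Defensive.

Import Order.TTheory GRing.Theory Num.Theory.
Import numFieldNormedType.Exports.

Local Open Scope classical_set_scope.
Local Open Scope ring_scope.

(* A point of the plane is a pair (x, t). A function on the closed half-strip
   is a total function on R * R of which only the values there matter. *)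

Definition halfstrip (R : realType) (b : R) : set (R * R) :=
  `]- b, b[%classic `*` `]0, +oo[%classic.

Definition chalfstrip (R : realType) (b : R) : set (R * R) :=
  `[- b, b]%classic `*` `[0, +oo[%classic.

Definition dir_x (R : realType) : R * R := (1, 0).
Definition dir_t (R : realType) : R * R := (0, 1).
Arguments dir_x {R}.
Arguments dir_t {R}.

Definition extends_continuously (R : realType) (A B : set (R * R))
    (F : R * R -> R) : Prop :=
  exists2 h : R * R -> R,
    {within B, continuous h} & forall p, A p -> h p = F p.

(* phi is continuous on the closed half-strip, and its partial derivatives of
   order 1 and 2 exist in the open half-strip and extend continuously to the
   closed one. *)
Definition C2_chalfstrip (R : realType) (b : R) (phi : R * R -> R) : Prop :=
  {within chalfstrip b, continuous phi} /\
  forall v, v = dir_x \/ v = dir_t ->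
    [/\ forall p, halfstrip b p -> derivable phi p v,
        extends_continuously (halfstrip b) (chalfstrip b) ('D_v phi) &
        forall w, w = dir_x \/ w = dir_t ->
          (forall p, halfstrip b p -> derivable ('D_v phi) p w) /\
          extends_continuously (halfstrip b) (chalfstrip b)
            ('D_w ('D_v phi))].

Definition local_max_on (R : realType) (A : set (R * R)) (h : R * R -> R)
    (p : R * R) : Prop :=
  \forall q \near within A (nbhs p), h q <= h p.

Definition local_min_on (R : realType) (A : set (R * R)) (h : R * R -> R)
    (p : R * R) : Prop :=
  \forall q \near within A (nbhs p), h p <= h q.

(* Every point outside A is isolated in [subspace A], so these only constrain
   the restriction of u to A. *)
Definition lsc_on (R : realType) (A : set (R * R)) (u : R * R -> R) : Prop :=
  lower_semicontinuous ((fun p => (u p)%:E) : subspace A -> \bar R).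

Definition usc_on (R : realType) (A : set (R * R)) (u : R * R -> R) : Prop :=
  lsc_on A (fun p => - u p).

Definition pde_operator (R : realType) (f g : R -> R) (phi : R * R -> R)
    (p : R * R) : R :=
  'D_dir_t phi p - f (g ('D_dir_x phi p) * 'D_dir_x ('D_dir_x phi) p).

Definition viscosity_subsolution (R : realType) (b : R) (f g : R -> R)
    (u : R * R -> R) : Prop :=
  usc_on (chalfstrip b) u /\
  forall (phi : R * R -> R) (p : R * R),
    C2_chalfstrip b phi -> halfstrip b p ->
    local_max_on (chalfstrip b) (fun q => u q - phi q) p ->
    pde_operator f g phi p <= 0.

Definition viscosity_supersolution (R : realType) (b : R) (f g : R -> R)
    (u : R * R -> R) : Prop :=
  [/\ lsc_on (chalfstrip b) u,
      forall (phi : R * R -> R) (p : R * R),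
        C2_chalfstrip b phi -> halfstrip b p ->
        local_min_on (chalfstrip b) (fun q => u q - phi q) p ->
        0 <= pde_operator f g phi p &
      forall (phi : R * R -> R) (t : R),
        C2_chalfstrip b phi -> 0 < t ->
        ~ local_min_on (chalfstrip b) (fun q => u q - phi q) (b, t) /\
        ~ local_min_on (chalfstrip b) (fun q => u q - phi q) (- b, t)].

Definition viscosity_solution (R : realType) (b : R) (f g : R -> R)
    (u : R * R -> R) : Prop :=
  [/\ {within chalfstrip b, continuous u},
      viscosity_subsolution b f g u &
      viscosity_supersolution b f g u].

Definition ibvp_solution (R : realType) (b : R) (f g u0 : R -> R)
    (u : R * R -> R) : Prop :=
  viscosity_solution b f g u /\ forall x, x \in `[- b, b] -> u (x, 0) = u0 x.

(* Main.v *)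
Require Import Defs.
From HB Require Import structures.
From mathcomp Require Import all_boot all_order all_algebra.
From mathcomp Require Import all_classical all_reals all_analysis.
From mathcomp Require Import ring lra zify.

Set Implicit Arguments.
Unset Strict Implicit.
Unset Printing Implicit Defensive.

Import Order.TTheory GRing.Theory Num.Theory.
Import numFieldNormedType.Exports.

Local Open Scope classical_set_scope.
Local Open Scope ring_scope.

(** Existence and uniqueness both rest on implicit Euler schemes in time,
      f (g (p_(i+1)) m_(i+1)) = (w_(i+1) - w_i) / tau,  p_i = w_i', m_i = w_i'',
    with slopes - N and N at the ends of the interval ([scheme]).

    Comparison of a subsolution v1 with a supersolution v2 passes through one
    scheme that starts near v1 (., 0). Because each of v1 and v2 is compared with
    the smooth profiles w_i, whose Taylor polynomials serve as test functions, only
    the time is doubled, into a continuous time t and a level i. The penalty on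
    t - i tau is a [gauge] Y_i t whose t-derivative is its own backward difference
    quotient in i. At a positive maximum of w_i x - v2 (x, t) - Y_i t - th t the
    viscosity inequality and the equation of the scheme therefore contradict each
    other, and this maximum is not at an end, where v2 admits no touching from below
    ([scheme_below]). The subsolution v1 is unconstrained at the ends, so it is
    compared with w_i (x / lam) for some lam < 1: then x stays inside, and the
    argument of w_i does so because N exceeds the slope of the penalty
    ([scheme_above]). The dilated profile solves the equation up to a small error
    because |s|^alpha g s has limits at infinity: mu^2 g (mu s) / g s tends to 1 as
    mu tends to 1, uniformly in s ([operator_ratio]).

    A step of the scheme is an ordinary differential equation with prescribed
    slopes at both ends, solved by shooting with Euler polygons ([resolvent]). To let
    tau tend to 0 and N to infinity one needs moduli of continuity that do not
    depend on them. In time, the maximum principle bounds the speed by its initial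
    value ([scheme_bound]). In space, let G be a primitive of g. The bound
    G (p x) <= G N - c (b - x) passes from one step to the next, since the derivative
    of G (p) increases with w_(i+1) - w_i ([barrier_upper], [slope_upper]). By the decay
    of g it implies p x = O ((b - x)^(-1/(alpha-1))), and this is integrable up to b
    exactly when alpha > 2 ([slope_modulus]). Hence limits of schemes exist
    ([scheme_limit]).

    Such limits are viscosity solutions. A touching test function in the interior,
    made strict by a quadratic term, yields a minimum of a discrete profile minus
    the test function, where the equation of the scheme applies ([discrete_min],
    [touching_from_below]). At the end b the test function phi is first replaced by
    phi - (b - x) + B (b - x)^2 with B large: a discrete minimum is then excluded
    inside by the large second derivative and at b by the slope N
    ([no_min_at_steep_end]).

    A scheme starts within any given error of u0, since its first profile needs a
    finite speed. The solutions obtained for errors 1 / (n + 1) form a uniform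
    Cauchy sequence by comparison, and their limit has the initial value u0. *)

(** * Calculus on a closed interval *)

Section OneVariable.
Variable R : realType.
Implicit Types (a b c d x y e : R) (F D P M G g : R -> R).

(** Continuity and differentiability relative to [a, b], at the end points too,
    where they are one-sided: the schemes below prescribe slopes there. *)
Definition contw a b F := forall x, a <= x <= b -> forall e, 0 < e ->
  exists2 d, 0 < d & forall y, a <= y <= b -> `|y - x| <= d -> `|F y - F x| <= e.

Definition derw a b F D := forall x, a <= x <= b -> forall e, 0 < e ->
  exists2 d, 0 < d & forall y, a <= y <= b -> `|y - x| <= d ->
    `|F y - F x - D x * (y - x)| <= e * `|y - x|.

Lemma contw_within a b F : contw a b F <-> {within `[a, b], continuous F}.
Proof.
split=> [cF|/subspace_continuousP cF x xab e e0].
  apply/subspace_continuousP => x; rewrite /= in_itv/= => xab.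
  apply/cvgrPdist_le => e e0; have [d d0 H] := cF x xab e e0.
  rewrite near_withinE; apply/nbhs_ballP; exists d => //= y.
  rewrite /ball/= => xy; rewrite in_itv/= => yab.
  by rewrite distrC; apply: H => //; rewrite distrC ltW.
have /(_ _)/cvgrPdist_le := cF x; rewrite /= in_itv/= => /(_ xab e e0).
rewrite near_withinE => /nbhs_ballP[d /= d0 H]; exists (d / 2); first lra.
move=> y yab yx; rewrite distrC; apply: H; rewrite /= ?in_itv//= /ball/=.
rewrite distrC; lra.
Qed.

Lemma derw_contw a b F D : derw a b F D -> contw a b F.
Proof.
move=> dF x xab e e0; have [d d0 H] := dF x xab 1 ltr01.
have k0 : 0 < `|D x| + 1 by rewrite ltr_wpDl.
exists (Num.min d (e / (`|D x| + 1))); first by rewrite lt_min d0 divr_gt0.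
move=> y yab; rewrite le_min => /andP[h1 h2]; have := H y yab h1.
rewrite mul1r => h3; move: h2; rewrite ler_pdivlMr// => h2.
have -> : F y - F x = (F y - F x - D x * (y - x)) + D x * (y - x) by ring.
apply: le_trans (ler_normD _ _) _; rewrite normrM; lra.
Qed.

Lemma contw_sub a b c d F : a <= c -> d <= b -> contw a b F -> contw c d F.
Proof.
move=> ac db H x xcd e e0; have [|r r0 K] := H x _ e e0; first by lra.
by exists r => // y ycd; apply: K; lra.
Qed.

Lemma derw_sub a b c d F D : a <= c -> d <= b -> derw a b F D -> derw c d F D.
Proof.
move=> ac db H x xcd e e0; have [|r r0 K] := H x _ e e0; first by lra.
by exists r => // y ycd; apply: K; lra.
Qed.

Lemma contw_max a b F : a <= b -> contw a b F ->
  exists2 x, a <= x <= b & forall y, a <= y <= b -> F y <= F x.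
Proof.
move=> ab /contw_within /(EVT_max ab)[x]; rewrite in_itv/= => xab H.
by exists x => // y yab; apply: H; rewrite in_itv.
Qed.

Lemma contwN a b F : contw a b F -> contw a b (fun x => - F x).
Proof.
move=> H x xab e e0; have [d d0 K] := H x xab e e0; exists d => // y yab yx.
by rewrite -opprD normrN; exact: K.
Qed.

Lemma contwD a b F G : contw a b F -> contw a b G -> contw a b (fun x => F x + G x).
Proof.
move=> H H' x xab e e0; have e2 : 0 < e / 2 by lra.
have [d d0 K] := H x xab _ e2; have [d' d'0 K'] := H' x xab _ e2.
exists (Num.min d d'); first by rewrite lt_min d0.
move=> y yab; rewrite le_min => /andP[h1 h2].
have -> : F y + G y - (F x + G x) = (F y - F x) + (G y - G x) by ring.
apply: le_trans (ler_normD _ _) _; have := K _ yab h1; have := K' _ yab h2; lra.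
Qed.

Lemma derwD a b F D G g : derw a b F D -> derw a b G g ->
  derw a b (fun x => F x + G x) (fun x => D x + g x).
Proof.
move=> H H' x xab e e0; have e2 : 0 < e / 2 by lra.
have [d d0 K] := H x xab _ e2; have [d' d'0 K'] := H' x xab _ e2.
exists (Num.min d d'); first by rewrite lt_min d0.
move=> y yab; rewrite le_min => /andP[h1 h2].
set A := (X in `|X|); have -> : A = (F y - F x - D x * (y - x)) +
  (G y - G x - g x * (y - x)) by rewrite /A; ring.
apply: le_trans (ler_normD _ _) _; have := K _ yab h1; have := K' _ yab h2; lra.
Qed.

Lemma derwN a b F D : derw a b F D -> derw a b (fun x => - F x) (fun x => - D x).
Proof.
move=> H x xab e e0; have [d d0 K] := H x xab e e0; exists d => // y yab yx.
have -> : - F y - - F x - - D x * (y - x) = - (F y - F x - D x * (y - x)) by ring.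
by rewrite normrN; exact: K.
Qed.

Lemma derwB a b F D G g : derw a b F D -> derw a b G g ->
  derw a b (fun x => F x - G x) (fun x => D x - g x).
Proof. by move=> H /derwN; exact: derwD. Qed.

Lemma derw_affine a b (k c : R) : derw a b (fun x => k * x + c) (fun=> k).
Proof.
move=> x _ e e0; exists 1 => // y _ _.
have -> : k * y + c - (k * x + c) - k * (y - x) = 0 by ring.
by rewrite normr0 mulr_ge0// ltW.
Qed.

Lemma derw_reflect a c F D : derw a c F D ->
  derw (- c) (- a) (fun x => F (- x)) (fun x => - D (- x)).
Proof.
move=> H x xab e e0; have [|d d0 K] := H (- x) _ e e0; first by clear -xab; lra.
exists d => // y yab yx.
have E : - y - - x = - (y - x) by ring.
by have := K (- y); rewrite E normrN mulrN mulNr; apply => //; clear -yab; lra.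
Qed.

Lemma derw_reflect_sym b F D : derw (- b) b F D ->
  derw (- b) b (fun x => F (- x)) (fun x => - D (- x)).
Proof. by move=> /derw_reflect; rewrite opprK. Qed.

Lemma derw_ext a b F D F' D' : (forall x, a <= x <= b -> F x = F' x) ->
  (forall x, a <= x <= b -> D x = D' x) -> derw a b F D -> derw a b F' D'.
Proof.
move=> hF hD H x xab e e0; have [d d0 K] := H x xab e e0; exists d => // y yab yx.
by rewrite -!hF// -hD//; exact: K.
Qed.

(** First order conditions at a maximum come in one-sided versions because a
    maximum over [a, b] may sit at an end point. *)
Lemma derw_max_le0 a b F D x r : derw a b F D -> a <= x < b -> 0 < r ->
  (forall y, x <= y <= b -> y <= x + r -> F y <= F x) -> D x <= 0.
Proof.
move=> dF xab r0 H; rewrite leNgt; apply/negP => D0.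
have e0 : 0 < D x / 2 by lra.
have xab' : a <= x <= b by lra.
have [d d0 K] := dF x xab' _ e0.
pose y := x + Num.min d (Num.min r (b - x)).
have m0 : 0 < Num.min d (Num.min r (b - x)) by rewrite !lt_min d0 r0; lra.
have [m1 m2 m3] : [/\ y - x <= d, y - x <= r & y - x <= b - x].
  by rewrite /y addrAC subrr add0r; split; rewrite !ge_min lexx ?orbT.
have yx : 0 < y - x by rewrite /y addrAC subrr add0r.
have := K y; rewrite (gtr0_norm yx) => /(_ _ m1) Ky.
have {Ky} : `|F y - F x - D x * (y - x)| <= D x / 2 * (y - x) by apply: Ky; lra.
have : F y <= F x by apply: H; clear -m3 yx m2; lra.
rewrite ler_norml; nra.
Qed.

Lemma derw_max_ge0 a b F D x r : derw a b F D -> a < x <= b -> 0 < r ->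
  (forall y, a <= y <= x -> x - r <= y -> F y <= F x) -> 0 <= D x.
Proof.
move=> dF xab r0 H; rewrite leNgt; apply/negP => D0.
have e0 : 0 < - D x / 2 by lra.
have xab' : a <= x <= b by lra.
have [d d0 K] := dF x xab' _ e0.
pose y := x - Num.min d (Num.min r (x - a)).
have m0 : 0 < Num.min d (Num.min r (x - a)) by rewrite !lt_min d0 r0; lra.
have [m1 m2 m3] : [/\ x - y <= d, x - y <= r & x - y <= x - a].
  by rewrite /y opprB addrCA subrr addr0; split; rewrite !ge_min lexx ?orbT.
have yx : 0 < x - y by rewrite /y opprB addrCA subrr addr0.
have := K y; rewrite distrC (gtr0_norm yx) => /(_ _ m1) Ky.
have {Ky} : `|F y - F x - D x * (y - x)| <= - D x / 2 * (x - y) by apply: Ky; lra.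
have : F y <= F x by apply: H; clear -m3 yx m2; lra.
rewrite ler_norml; nra.
Qed.

Lemma derw_max_eq0 a b F D x r : derw a b F D -> a < x < b -> 0 < r ->
  (forall y, a <= y <= b -> `|y - x| <= r -> F y <= F x) -> D x = 0.
Proof.
move=> dF xab r0 H; apply/eqP; rewrite eq_le; apply/andP; split.
  apply: (derw_max_le0 dF _ r0); first lra.
  by move=> y y1 y2; apply: H; [lra|rewrite ger0_norm; lra].
apply: (derw_max_ge0 dF _ r0); first lra.
by move=> y y1 y2; apply: H; [lra|rewrite ler0_norm; lra].
Qed.

Lemma derw_mvt a b F D x y : derw a b F D -> a <= x -> x < y -> y <= b ->
  exists2 c, x < c < y & F y - F x = D c * (y - x).
Proof.
move=> dF ax xy yb.
pose s := (F y - F x) / (y - x).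
have yx0 : y - x != 0 by lra.
have dH : derw x y (fun z => F z - (s * z + 0)) (fun z => D z - s).
  by apply: derwB; [exact: derw_sub dF | exact: derw_affine].
have Es : s * (y - x) = F y - F x by rewrite /s divfK.
have HE : F y - (s * y + 0) = F x - (s * x + 0) by lra.
suff [c cxy c0] : exists2 c, x < c < y & D c - s = 0.
  by exists c => //; rewrite -Es; congr (_ * _); lra.
have [u uxy uM] := contw_max (ltW xy) (derw_contw dH).
have [uin|] := boolP (x < u < y).
  by exists u => //; apply: (derw_max_eq0 dH uin ltr01) => z zxy _; exact: uM.
move=> unin.
have [v vxy vM] := contw_max (ltW xy) (contwN (derw_contw dH)).
have [vin|] := boolP (x < v < y).
  exists v => //; apply/eqP; rewrite -oppr_eq0; apply/eqP.
  by apply: (derw_max_eq0 (derwN dH) vin ltr01) => z zxy _; exact: vM.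
move=> vnin.
have endp z : x <= z <= y -> ~~ (x < z < y) -> F z - (s * z + 0) = F x - (s * x + 0).
  move=> zxy zn; have [->//|zx] := eqVneq z x; have [->//|zy] := eqVneq z y.
  by move: zn; rewrite !lt_neqAle zy eq_sym zx; lra.
exists ((x + y) / 2); first lra.
have mid : x < (x + y) / 2 < y by lra.
apply: (derw_max_eq0 dH mid ltr01) => z zxy _.
have mid' : x <= (x + y) / 2 <= y by lra.
have := vM _ mid'; have := uM _ zxy; rewrite (endp _ uxy unin) (endp _ vxy vnin); lra.
Qed.

Lemma derw_incr a b F D x y : derw a b F D -> a <= x -> x <= y -> y <= b ->
  (forall z, x < z < y -> 0 <= D z) -> F x <= F y.
Proof.
move=> dF ax + yb H; rewrite le_eqVlt => /predU1P[->//|xy].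
have [c /H Dc E] := derw_mvt dF ax xy yb.
have : 0 <= F y - F x by rewrite E mulr_ge0//; lra.
lra.
Qed.

Lemma derw_incr_lt a b F D x y : derw a b F D -> a <= x -> x < y -> y <= b ->
  (forall z, x < z < y -> 0 < D z) -> F x < F y.
Proof.
move=> dF ax xy yb H.
have [c /H Dc E] := derw_mvt dF ax xy yb.
have : 0 < F y - F x by rewrite E mulr_gt0//; lra.
lra.
Qed.

Lemma derw_taylor2 a b F P M x e : derw a b F P -> derw a b P M ->
  a <= x <= b -> 0 < e ->
  exists2 d, 0 < d & forall y, a <= y <= b -> `|y - x| <= d ->
   `|F y - F x - P x * (y - x) - M x / 2 * (y - x) ^+ 2| <= e * (y - x) ^+ 2.
Proof.
move=> dF dP xab e0; have [d d0 K] := dP x xab e e0; exists d => // y yab yx.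
pose H z := F z - (P x * z + (- P x * x)) - M x / 2 * (z - x) ^+ 2.
have sq : derw a b (fun z => M x / 2 * (z - x) ^+ 2) (fun z => M x * (z - x)).
  move=> u uab r r0; exists (r / (`|M x| + 1)).
    by rewrite divr_gt0// ltr_wpDl.
  move=> v vab; rewrite ler_pdivlMr ?ltr_wpDl// => uv.
  have -> : M x / 2 * (v - x) ^+ 2 - M x / 2 * (u - x) ^+ 2 - M x * (u - x) * (v - u) =
    M x / 2 * (v - u) * (v - u) by field.
  rewrite normrM ler_wpM2r// !normrM (@ger0_norm _ (2^-1)) ?invr_ge0//.
  have := normr_ge0 (M x); have := normr_ge0 (v - u); nra.
have dH : derw a b H (fun z => P z - P x - M x * (z - x)).
  by apply: derwB => //; apply: derwB => //; exact: derw_affine.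
have HE : F y - F x - P x * (y - x) - M x / 2 * (y - x) ^+ 2 = H y - H x.
  by rewrite /H; ring.
rewrite HE.
have [xy|xy|<-] := ltgtP x y; last by rewrite !subrr normr0 expr0n/= mulr0.
  have [c cxy ->] : exists2 c, x < c < y & H y - H x = (P c - P x - M x * (c - x)) * (y - x).
    by apply: (derw_mvt dH) => //; clear -xab yab; lra.
  have yx0 : 0 < y - x by lra.
  rewrite normrM (gtr0_norm yx0) expr2 mulrA ler_pM2r//.
  apply: le_trans (K c _ _) _; [clear -xab yab cxy; lra| |]; move: yx; rewrite !gtr0_norm; try (clear -cxy yx0; lra).
  by move=> _; rewrite ler_pM2l//; lra.
have [c cxy E] : exists2 c, y < c < x & H x - H y = (P c - P x - M x * (c - x)) * (x - y).
  by apply: (derw_mvt dH) => //; lra.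
have yx0 : 0 < x - y by lra.
rewrite distrC E normrM (gtr0_norm yx0) -sqrrN opprB expr2 mulrA ler_pM2r//.
apply: le_trans (K c _ _) _; [clear -xab yab cxy; lra| |]; move: yx; rewrite !ltr0_norm; try (clear -cxy yx0; lra).
by move=> _; rewrite ler_pM2l//; lra.
Qed.

(** The hypothesis P x = 0 takes the place of interiority: it makes the second
    order Taylor polynomial decide the sign also at an end point. *)
Lemma derw_max_second a b F P M x r : a < b -> derw a b F P -> derw a b P M ->
  a <= x <= b -> P x = 0 -> 0 < r ->
  (forall y, a <= y <= b -> `|y - x| <= r -> F y <= F x) -> M x <= 0.
Proof.
move=> ab dF dP xab P0 r0 H; rewrite leNgt; apply/negP => M0.
have e0 : 0 < M x / 4 by lra.
have [d d0 K] := derw_taylor2 dF dP xab e0.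
suff [y yab [yx yd yr]] : exists2 y, a <= y <= b & [/\ y - x != 0, `|y - x| <= d & `|y - x| <= r].
  have := K y yab yd; have := H y yab yr; rewrite P0 mul0r subr0 ler_norml.
  have : 0 < (y - x) ^+ 2 by rewrite exprn_even_gt0.
  nra.
pose s := Num.min d (Num.min r ((b - a) / 2)).
have s0 : 0 < s by rewrite !lt_min d0 r0; lra.
have [m1 m2 m3] : [/\ s <= d, s <= r & s <= (b - a) / 2].
  by split; rewrite !ge_min lexx ?orbT.
have [xl|xg] := leP x ((a + b) / 2).
  by exists (x + s); [lra|rewrite addrAC subrr add0r gtr0_norm// gt_eqF].
exists (x - s); first lra.
by rewrite addrAC subrr add0r normrN oppr_eq0 gtr0_norm// gt_eqF.
Qed.

Lemma derw_comp a b p m G g : derw a b p m -> (forall c d, derw c d G g) ->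
  derw a b (fun x => G (p x)) (fun x => g (p x) * m x).
Proof.
move=> dp dG x xab e e0.
pose K := `|m x| + 1; have K0 : 0 < K by rewrite ltr_wpDl.
pose L := `|g (p x)| + 1; have L0 : 0 < L by rewrite ltr_wpDl.
have e1 : 0 < e / 2 / K by rewrite !divr_gt0.
have [d1 d10 H1] := dG (p x - 1) (p x + 1) (p x) ltac:(lra) _ e1.
have e2 : 0 < Num.min 1 (e / 2 / L) by rewrite lt_min ltr01 !divr_gt0.
have [d2 d20 H2] := dp x xab _ e2.
have e3 : 0 < Num.min 1 d1 by rewrite lt_min ltr01.
have [d3 d30 H3] := derw_contw dp xab e3.
exists (Num.min d2 d3); first by rewrite lt_min d20.
move=> y yab; rewrite le_min => /andP[/(H2 y yab) h2 /(H3 y yab)].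
rewrite le_min => /andP[h3 h4].
have h2a : `|p y - p x - m x * (y - x)| <= `|y - x|.
  by apply: le_trans h2 _; rewrite ler_piMl// ge_min lexx.
have h2b : `|p y - p x - m x * (y - x)| <= e / 2 / L * `|y - x|.
  by apply: le_trans h2 _; rewrite ler_wpM2r// ge_min lexx orbT.
have h5 : `|p y - p x| <= K * `|y - x|.
  rewrite -[p y - p x](subrK (m x * (y - x))).
  apply: le_trans (ler_normD _ _) _; rewrite normrM /K mulrDl mul1r; clear -h2a; lra.
have h1 : `|G (p y) - G (p x) - g (p x) * (p y - p x)| <= e / 2 / K * `|p y - p x|.
  by apply: H1 => //; move: h3; rewrite ler_norml; clear; lra.
set A := (X in `|X|); have -> : A = (G (p y) - G (p x) - g (p x) * (p y - p x)) +
  g (p x) * (p y - p x - m x * (y - x)) by rewrite /A; ring.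
apply: le_trans (ler_normD _ _) _.
have : e / 2 / K * `|p y - p x| <= e / 2 * `|y - x|.
  rewrite -[e / 2 / K * _]mulrA ler_pM2l; last (clear -e0; lra).
  by rewrite ler_pdivrMl.
have : `|g (p x) * (p y - p x - m x * (y - x))| <= e / 2 * `|y - x|.
  rewrite normrM.
  apply: le_trans (_ : L * (e / 2 / L * `|y - x|) <= _).
    by apply: ler_pM => //; rewrite /L lerDl.
  by rewrite mulrA mulrCA mulfV ?gt_eqF// mulr1.
clear -h1; lra.
Qed.

Lemma continuous_contw a b F : continuous F -> contw a b F.
Proof. by move=> cF; apply/contw_within; exact: continuous_subspaceT. Qed.

End OneVariable.

(** * Limits of Euler polygons *)

Section Ultralimit.
Variable R : realType.

(** Limits along a free ultrafilter stand in for the extraction of convergent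
    subsequences: every bounded real sequence has one, simultaneously. *)
Lemma ultralimit : exists2 U : set_system nat, ProperFilter U &
  (forall k, U [set n | (k <= n)%N]) /\
  forall (s : nat -> R) (B : R), (forall n, `|s n| <= B) ->
    exists l : R, forall e : R, 0 < e -> U [set n | `|s n - l| <= e].
Proof.
have [U [UU sU]] := ultraFilterLemma (eventually_filter : ProperFilter \oo).
exists U; first exact: ultra_proper.
have PU : ProperFilter U by exact: ultra_proper.
split=> [k|s B sB]; first by apply: sU; exists k.
have [|l [_ lc]] := @segment_compact R (- B) B (s @ U) (fmap_proper_filter s PU).
  rewrite /fmap/=; apply: (@filterS _ U _ setT); last exact: filterT.
  by move=> n _ /=; rewrite in_itv/= -ler_norml; exact: sB.
exists l => e e0; have [//|nE] := in_ultra_setVsetC [set n | `|s n - l| <= e] UU.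
have := lc (s @` (~` [set n | `|s n - l| <= e])) (ball l e).
case.
- by apply: (@filterS _ U _ (~` [set n | `|s n - l| <= e])) nE => n nn; exists n.
- exact: nbhsx_ballx.
move=> z [[n /= nn <-]]; rewrite /ball/= distrC => h; exfalso; apply: nn; exact: ltW.
Qed.

Lemma le_addgt0 (x y C : R) : 0 < C -> (forall e, 0 < e -> x <= y + e * C) -> x <= y.
Proof.
move=> C0 H; apply/ler_addgt0Pr => e e0; have := H (e / C).
by rewrite divfK ?gt_eqF// divr_gt0// => /(_ isT).
Qed.

End Ultralimit.

Section EulerLimit.
Variables (R : realType) (b : R).
Hypothesis b_gt0 : 0 < b.
Variable U : set_system nat.
Hypothesis PU : ProperFilter U.
Hypothesis Uinfty : forall k, U [set n | (k <= n)%N].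

Definition mesh (n : nat) : R := 2 * b / n.+1%:R.
Definition node (n j : nat) : R := - b + j%:R * mesh n.
Definition cell (n : nat) (x : R) : nat := Num.truncn ((x + b) / mesh n).

Lemma mesh_gt0 n : 0 < mesh n.
Proof. by rewrite divr_gt0// mulr_gt0. Qed.

Lemma mesh_small e : 0 < e -> U [set n | mesh n <= e].
Proof.
move=> e0; apply: filterS (Uinfty (Num.truncn (2 * b / e))) => n /= h.
rewrite /mesh ler_pdivrMr//; have := truncnS_gt (2 * b / e).
rewrite ltr_pdivrMr// => /ltW h1; apply: le_trans h1 _.
by rewrite mulrC ler_pM2l// ler_nat.
Qed.

Lemma cell_le n x : - b <= x <= b -> node n (cell n x) <= x <= node n (cell n x) + mesh n.
Proof.
move=> xb; have m0 := mesh_gt0 n.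
have h0 : 0 <= (x + b) / mesh n by rewrite divr_ge0 ?(ltW m0)//; lra.
have := truncn_itv h0; rewrite -/(cell n x) ler_pdivlMr// ltr_pdivrMr//.
rewrite -natr1 mulrDl mul1r /node; lra.
Qed.

Lemma node_last n : node n n.+1 = b.
Proof. by rewrite /node /mesh mulrC divfK ?pnatr_eq0//; lra. Qed.

Lemma cell_last n : cell n b = n.+1.
Proof.
rewrite /cell /mesh.
have -> : (b + b) / (2 * b / n.+1%:R) = n.+1%:R :> R.
  field; rewrite ?pnatr_eq0//= ?gt_eqF//.
by rewrite natrK.
Qed.

Lemma cell_first n : cell n (- b) = 0%N.
Proof. by rewrite /cell addNr mul0r; exact: (natrK 0). Qed.

Lemma cell_bound n x : - b <= x <= b -> (cell n x <= n.+1)%N.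
Proof.
move=> xb; have := cell_le n xb; rewrite -(ler_nat R) -(ler_pM2r (mesh_gt0 n)).
have := node_last n; rewrite /node; lra.
Qed.

Lemma node_in n j : (j <= n.+1)%N -> - b <= node n j <= b.
Proof.
move=> jn; have m0 := mesh_gt0 n.
have h1 : node n j <= node n n.+1 by rewrite /node lerD2l ler_pM2r// ler_nat.
by move: h1; rewrite node_last => ->; rewrite andbT /node lerDl mulr_ge0// ltW.
Qed.

Lemma telescope_le (s c : nat -> R) (D c0 e : R) (i j : nat) : 0 <= D -> (i <= j)%N ->
  (forall k, (i <= k < j)%N -> s k.+1 = s k + D * c k /\ `|c k - c0| <= e) ->
  `|s j - s i - (j%:R - i%:R) * D * c0| <= (j%:R - i%:R) * D * e.
Proof.
move=> D0 ij; rewrite -(subnK ij); elim: (j - i)%N => [|m IH] H.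
  by rewrite add0n !subrr !mul0r subr0 normr0.
rewrite addSn.
have [|-> c1] := H (m + i)%N; first by lia.
have {}IH : `|s (m + i)%N - s i - ((m + i)%:R - i%:R) * D * c0| <= ((m + i)%:R - i%:R) * D * e.
  by apply: IH => k kk; apply: H; lia.
rewrite -natr1.
set A := (X in `|X|); have -> : A = (s (m + i)%N - s i - ((m + i)%:R - i%:R) * D * c0)
  + D * (c (m + i)%N - c0) by rewrite /A; ring.
apply: le_trans (ler_normD _ _) _; rewrite normrM (ger0_norm D0).
have : D * `|c (m + i)%N - c0| <= D * e by rewrite ler_wpM2l.
lra.
Qed.

Section OneComponent.
Variables (s c : nat -> nat -> R) (C : R) (S : R -> R).
Hypothesis s_rec : forall n j, (j <= n)%N -> s n j.+1 = s n j + mesh n * c n j.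
Hypothesis c_bnd : forall n j, (j <= n)%N -> `|c n j| <= C.
Hypothesis s_lim : forall x, - b <= x <= b -> forall e, 0 < e ->
  U [set n | `|s n (cell n x) - S x| <= e].

Lemma step_lip n i j : (i <= n.+1)%N -> (j <= n.+1)%N ->
  `|s n j - s n i| <= C * `|node n j - node n i|.
Proof.
have E : forall i j, node n j - node n i = (j%:R - i%:R) * mesh n.
  by move=> i' j'; rewrite /node; ring.
wlog ij : i j / (i <= j)%N.
  move=> H hi hj; have [ij|/ltnW ji] := leqP i j; first exact: H.
  by rewrite distrC (distrC (node _ _)); apply: H.
move=> hi hj.
have := @telescope_le (s n) (c n) (mesh n) 0 C i j (ltW (mesh_gt0 n)) ij.
rewrite mulr0 subr0 E => H.
rewrite (@ger0_norm _ (_ * mesh n)); last by rewrite mulr_ge0 ?(ltW (mesh_gt0 n))// subr_ge0 ler_nat.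
rewrite mulrC; apply: H => k kk; rewrite subr0 s_rec; last lia.
by split => //; apply: c_bnd; lia.
Qed.

(** Polygons with bounded slopes are equi-Lipschitz, so their pointwise limit
    controls the values at all nodes near x. *)
Lemma node_near x e : - b <= x <= b -> 0 < e -> exists2 d, 0 < d &
  U [set n | forall j, (j <= n.+1)%N -> `|node n j - x| <= d -> `|s n j - S x| <= e].
Proof.
move=> xb e0.
have C0 : 0 <= C by apply: le_trans (normr_ge0 _) (c_bnd (leqnn 0)).
have C1 : 0 < C + 1 by lra.
exists (e / 4 / (C + 1)); first by rewrite !divr_gt0.
have e4 : 0 < e / 4 / (C + 1) by rewrite !divr_gt0.
have e2 : 0 < e / 2 by lra.
apply: filterS (filterI (mesh_small e4) (s_lim xb e2)) => n /= [h1 h2] j jn h3.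
have h4 := cell_le n xb.
have h5 := step_lip (cell_bound n xb) jn.
have h6 : `|node n j - node n (cell n x)| <= e / 2 / (C + 1).
  rewrite (_ : _ / _ / _ = e / 4 / (C + 1) + e / 4 / (C + 1)); last by field; lra.
  have -> : node n j - node n (cell n x) = (node n j - x) + (x - node n (cell n x)) by ring.
  by apply: le_trans (ler_normD _ _) _; rewrite lerD// ger0_norm; lra.
have -> : s n j - S x = (s n j - s n (cell n x)) + (s n (cell n x) - S x) by ring.
apply: le_trans (ler_normD _ _) _.
have : C * `|node n j - node n (cell n x)| <= (C + 1) * (e / 2 / (C + 1)).
  by apply: ler_pM => //; lra.
rewrite mulrCA divff ?gt_eqF// mulr1; lra.
Qed.

(** Summing the recursion between the cells of x and y gives
    S y - S x = c0 x * (y - x) up to e * `|y - x|, because all the slopes used in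
    between belong to nodes near x. *)
Lemma euler_limit (c0 : R -> R) :
  (forall x, - b <= x <= b -> forall e, 0 < e -> exists2 d, 0 < d &
    U [set n | forall j, (j <= n)%N -> `|node n j - x| <= d -> `|c n j - c0 x| <= e]) ->
  derw (- b) b S c0.
Proof.
move=> Hc x xb e e0; have [d d0 Ud] := Hc x xb e e0.
exists (d / 2); first lra.
move=> y yb yx.
have K0 : 0 < 2 + e + `|c0 x| by have := normr_ge0 (c0 x); lra.
apply: (le_addgt0 K0) => r r0.
have m0 : 0 < Num.min r (d / 2) by rewrite lt_min r0; lra.
have [n /= [[h1 h2] [h3 h4]]] := filter_ex (filterI (filterI Ud (mesh_small m0))
   (filterI (s_lim xb r0) (s_lim yb r0))).
have {}h2 : mesh n <= r /\ mesh n <= d / 2 by move: h2; rewrite le_min => /andP.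
have mp := mesh_gt0 n.
have incr u v : - b <= u <= b -> - b <= v <= b -> u <= v -> `|u - x| <= d / 2 -> `|v - x| <= d / 2 ->
    `|s n (cell n v) - s n (cell n u) - c0 x * (v - u)| <= e * (v - u) + r * (e + `|c0 x|).
  move=> ub vb uv ux vx; have hu := cell_le n ub; have hv := cell_le n vb.
  have cuv : (cell n u <= cell n v)%N.
    by apply: le_truncn; rewrite ler_pM2r ?invr_gt0// lerD2r.
  pose N := ((cell n v)%:R - (cell n u)%:R) * mesh n.
  have H : `|s n (cell n v) - s n (cell n u) - N * c0 x| <= N * e.
    apply: (telescope_le (c := c n) (ltW mp) cuv) => k /andP[k1 k2].
    have kn : (k <= n)%N by rewrite -ltnS; exact: leq_trans k2 (cell_bound n vb).
    split; first exact: s_rec.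
    apply: h1 => //.
    have ku : node n (cell n u) <= node n k by rewrite /node lerD2l ler_pM2r// ler_nat.
    have kv : node n k + mesh n <= node n (cell n v).
      by rewrite /node -addrA -{2}[mesh n]mul1r -mulrDl natr1 lerD2l ler_pM2r// ler_nat.
    move: ux vx; rewrite !ler_norml; lra.
  have EN : N = node n (cell n v) - node n (cell n u) by rewrite /N /node; ring.
  have hN : `|N - (v - u)| <= r by rewrite EN ler_norml; lra.
  set A := (X in `|X|); have -> : A = (s n (cell n v) - s n (cell n u) - N * c0 x)
    + c0 x * (N - (v - u)) by rewrite /A; ring.
  apply: le_trans (ler_normD _ _) _; rewrite normrM.
  have a1 : `|c0 x| * `|N - (v - u)| <= `|c0 x| * r by apply: ler_pM.
  have a2 : N * e <= (v - u + r) * e.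
    by rewrite ler_pM2r//; move: hN; rewrite ler_norml; lra.
  lra.
have key : `|s n (cell n y) - s n (cell n x) - c0 x * (y - x)| <=
    e * `|y - x| + r * (e + `|c0 x|).
  have x0 : `|x - x| <= d / 2 by rewrite subrr normr0; lra.
  have [xy|/ltW yltx] := leP x y.
    by rewrite (ger0_norm (x := y - x)) ?subr_ge0//; exact: incr.
  rewrite (distrC y) (ger0_norm (x := x - y)) ?subr_ge0//.
  rewrite (_ : _ - c0 x * _ = - (s n (cell n x) - s n (cell n y) - c0 x * (x - y))); last by ring.
  by rewrite normrN; exact: incr.
set A := (X in `|X|); have -> : A = (s n (cell n y) - s n (cell n x) - c0 x * (y - x))
  + ((s n (cell n x) - S x) - (s n (cell n y) - S y)) by rewrite /A; ring.
apply: le_trans (ler_normD _ _) _.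
have := ler_normB (s n (cell n x) - S x) (s n (cell n y) - S y).
lra.
Qed.

End OneComponent.
End EulerLimit.

(** * A two-point slope problem *)

Section Shooting.
Variables (R : realType) (b : R).
Hypothesis b_gt0 : 0 < b.
Variables (K h ga : R -> R) (B g0 g1 H Q s0 Nm Np : R).
Hypothesis K_cont : continuous K.
Hypothesis h_cont : continuous h.
Hypothesis ga_cont : continuous ga.
Hypothesis K_bnd : forall s, `|K s| <= B.
Hypothesis g0_gt0 : 0 < g0.
Hypothesis ga_bnd : forall s, g0 <= ga s <= g1.
Hypothesis h_bnd : forall x, `|h x| <= H.
Hypothesis s0_ge0 : 0 <= s0.
Hypothesis K_large : forall s, Q <= s -> s0 <= K s.
Hypothesis K_small : forall s, s <= - Q -> K s <= - s0.
Hypothesis slopes : `|Np - Nm| <= 2 * b * (s0 * g0).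

(** Explicit Euler polygon with left slope Nm for p' = K (w - h) * ga p,
    w' = p; the shooting parameter is the left value a. *)
Fixpoint euler (n : nat) (a : R) (j : nat) : R * R :=
  if j is i.+1 then
    let z := euler n a i in
    (z.1 + mesh b n * z.2, z.2 + mesh b n * (K (z.1 - h (node b n i)) * ga z.2))
  else (a, Nm).

Lemma euler_continuous n j :
  continuous (fun a => (euler n a j).1) /\ continuous (fun a => (euler n a j).2).
Proof.
elim: j => [|j [IH1 IH2]] /=; first by split=> a; [exact: cvg_id|exact: cvg_cst].
split=> a; first by apply: cvgD; [exact: IH1|apply: cvgMr; exact: IH2].
apply: cvgD; first exact: IH2.
apply: cvgMr; apply: cvgM.
  by apply: continuous_comp; [apply: cvgB; [exact: IH1|exact: cvg_cst]|exact: K_cont].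
by apply: continuous_comp; [exact: IH2|exact: ga_cont].
Qed.

Let M := `|Nm| + 2 * b * (B * g1).

Lemma force_bnd w p x : `|K (w - h x) * ga p| <= B * g1.
Proof.
have g0p := g0_gt0; have /andP[h1 h2] := ga_bnd p; rewrite normrM; apply: ler_pM => //.
by rewrite ger0_norm; lra.
Qed.

Lemma force_ge0 : 0 <= B * g1.
Proof. exact: le_trans (normr_ge0 _) (force_bnd 0 0 0). Qed.

Lemma node_le n j : (j <= n.+1)%N -> j%:R * mesh b n <= 2 * b.
Proof. by move=> /(node_in b_gt0); rewrite /node; lra. Qed.

Lemma euler_slope n a j : (j <= n.+1)%N -> `|(euler n a j).2| <= M.
Proof.
move=> jn; have bp := b_gt0; have g0p := g0_gt0; have s0p := s0_ge0; have m0 := mesh_gt0 bp n.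
have : `|(euler n a j).2| <= `|Nm| + j%:R * mesh b n * (B * g1).
  elim: j {jn} => [|j IH] /=; first by rewrite !mul0r addr0.
  apply: le_trans (ler_normD _ _) _; rewrite normrM (gtr0_norm m0).
  have : mesh b n * `|K ((euler n a j).1 - h (node b n j)) * ga (euler n a j).2| <= mesh b n * (B * g1).
    by rewrite ler_pM2l// force_bnd.
  rewrite -natr1; lra.
have := node_le jn; have := force_ge0; rewrite /M.
set u := j%:R * _; set v := B * g1; move=> *; nra.
Qed.

Lemma euler_value n a j : (j <= n.+1)%N -> `|(euler n a j).1| <= `|a| + 2 * b * M.
Proof.
move=> jn; have bp := b_gt0; have g0p := g0_gt0; have s0p := s0_ge0; have m0 := mesh_gt0 bp n.
have M0 : 0 <= M by apply: le_trans (normr_ge0 _) (euler_slope (n := 0) 0 (leq0n _)).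
have : `|(euler n a j).1| <= `|a| + j%:R * mesh b n * M.
  elim: j jn => [|j IH] jn /=; first by rewrite !mul0r addr0.
  apply: le_trans (ler_normD _ _) _; rewrite normrM (gtr0_norm m0).
  have : mesh b n * `|(euler n a j).2| <= mesh b n * M.
    by rewrite ler_pM2l// euler_slope// ltnW.
  have := IH (ltnW jn); rewrite -natr1; lra.
have := node_le jn; set u := j%:R * _; move=> *; nra.
Qed.

(** A polygon that starts at height A, or - A, stays where K has reached s0, or - s0,
    and this changes the slope by at least 2 b s0 g0 over the interval. *)
Let A := `|Q| + H + 2 * b * `|Nm|.

Lemma euler_high n j : (j <= n.+1)%N ->
  Nm + j%:R * mesh b n * (s0 * g0) <= (euler n A j).2 /\
  A - j%:R * mesh b n * `|Nm| <= (euler n A j).1.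
Proof.
have bp := b_gt0; have g0p := g0_gt0; have s0p := s0_ge0; have m0 := mesh_gt0 bp n.
elim: j => [|j IH] jn /=; first by rewrite !mul0r; split; lra.
have [h1 h2] := IH (ltnW jn).
have jm : 0 <= j%:R * mesh b n by rewrite mulr_ge0// ltW.
have sg : 0 <= s0 * g0 by rewrite mulr_ge0// ltW.
have nm : - `|Nm| <= Nm by rewrite lerNl ler_normr lexx orbT.
have jmsg := mulr_ge0 jm sg.
split.
  have hh := h_bnd (node b n j); move: hh; rewrite ler_norml => hh.
  have := node_le (ltnW jn) => jb.
  have K1 : s0 <= K ((euler n A j).1 - h (node b n j)).
    apply: K_large; have := ler_norm Q; have := normr_ge0 Nm.
    by move: h2; rewrite /A => *; nra.
  have : s0 * g0 <= K ((euler n A j).1 - h (node b n j)) * ga (euler n A j).2.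
    by apply: ler_pM => //; [exact: ltW|have := ga_bnd (euler n A j).2; lra].
  set F := _ * ga _ => F0; rewrite -natr1.
  have : mesh b n * (s0 * g0) <= mesh b n * F by rewrite ler_pM2l.
  lra.
have : mesh b n * - `|Nm| <= mesh b n * (euler n A j).2 by rewrite ler_pM2l//; lra.
rewrite -natr1; lra.
Qed.

Lemma euler_low n j : (j <= n.+1)%N ->
  (euler n (- A) j).2 <= Nm - j%:R * mesh b n * (s0 * g0) /\
  (euler n (- A) j).1 <= - A + j%:R * mesh b n * `|Nm|.
Proof.
have bp := b_gt0; have g0p := g0_gt0; have s0p := s0_ge0; have m0 := mesh_gt0 bp n.
elim: j => [|j IH] jn /=; first by rewrite !mul0r; split; lra.
have [h1 h2] := IH (ltnW jn).
have jm : 0 <= j%:R * mesh b n by rewrite mulr_ge0// ltW.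
have sg : 0 <= s0 * g0 by rewrite mulr_ge0// ltW.
have nm := ler_norm Nm.
have jmsg := mulr_ge0 jm sg.
split.
  have hh := h_bnd (node b n j); move: hh; rewrite ler_norml => hh.
  have := node_le (ltnW jn) => jb.
  have K1 : K ((euler n (- A) j).1 - h (node b n j)) <= - s0.
    apply: K_small; have := ler_norm Q; have := normr_ge0 Nm.
    by move: h2; rewrite /A => *; nra.
  have : s0 * g0 <= - K ((euler n (- A) j).1 - h (node b n j)) * ga (euler n (- A) j).2.
    apply: ler_pM => //; [exact: ltW|lra|have := ga_bnd (euler n (- A) j).2; lra].
  set F := (X in _ <= X) => F0; rewrite -natr1.
  have : mesh b n * (s0 * g0) <= mesh b n * F by rewrite ler_pM2l.
  rewrite /F mulNr mulrN; lra.
have : mesh b n * (euler n (- A) j).2 <= mesh b n * `|Nm| by rewrite ler_pM2l//; lra.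
rewrite -natr1; lra.
Qed.

(** The right slope depends continuously on a, and the two extreme choices of a
    overshoot Np on either side. *)
Lemma shoot n : exists2 a, `|a| <= A & (euler n a n.+1).2 = Np.
Proof.
have bp := b_gt0; have H0 : 0 <= H by apply: le_trans (normr_ge0 _) (h_bnd 0).
have A0 : 0 <= A.
  by rewrite /A; have := mulr_ge0 (ltW b_gt0) (normr_ge0 Nm); have := normr_ge0 Q; lra.
have [h1 _] := euler_high (leqnn n.+1); have [h2 _] := euler_low (leqnn n.+1).
have E : n.+1%:R * mesh b n = 2 * b by have := node_last b n; rewrite /node; lra.
move: h1 h2; rewrite E => h1 h2.
have AA : - A <= A by lra.
have [] := @IVT R (fun a => (euler n a n.+1).2) (- A) A Np AA.
- by apply: continuous_subspaceT; exact: (euler_continuous n n.+1).2.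
- move: slopes; rewrite ler_norml ge_min le_max => sl.
  by apply/andP; split; apply/orP; [left|right]; lra.
move=> a; rewrite in_itv/= => aA aE; exists a => //.
by rewrite ler_norml.
Qed.

(** Shooting is carried out for the polygons, whose end slope is continuous in a
    although the solution of the differential equation may be non-unique; the
    limit of the polygons then has the right slopes at both ends. *)
Theorem two_point_problem : exists w p : R -> R, [/\ derw (- b) b w p,
  derw (- b) b p (fun x => K (w x - h x) * ga (p x)), p (- b) = Nm & p b = Np].
Proof.
have [U PU [Uinfty Ulim]] := ultralimit R.
have bp := b_gt0; pose al n := sval (cid2 (shoot n)).
have al_bnd n : `|al n| <= A by rewrite /al; case: cid2.
have al_shoot n : (euler n (al n) n.+1).2 = Np by rewrite /al; case: cid2.
pose sw n j := (euler n (al n) j).1; pose sp n j := (euler n (al n) j).2.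
pose cellm n x := minn (cell b n x) n.+1.
have bnd_w n x : `|sw n (cellm n x)| <= A + 2 * b * M.
  by apply: le_trans (euler_value _ (geq_minr _ _)) _; rewrite lerD2r.
have bnd_p n x : `|sp n (cellm n x)| <= M by apply: euler_slope; exact: geq_minr.
pose w x := sval (cid (Ulim _ _ (bnd_w ^~ x))).
pose p x := sval (cid (Ulim _ _ (bnd_p ^~ x))).
have cellE n x : - b <= x <= b -> cellm n x = cell b n x.
  by move=> xb; apply/minn_idPl; exact: cell_bound.
have w_lim x : - b <= x <= b -> forall e, 0 < e -> U [set n | `|sw n (cell b n x) - w x| <= e].
  move=> xb e e0; rewrite /w; case: cid => l /= /(_ e e0).
  by apply: filterS => n /=; rewrite cellE.
have p_lim x : - b <= x <= b -> forall e, 0 < e -> U [set n | `|sp n (cell b n x) - p x| <= e].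
  move=> xb e e0; rewrite /p; case: cid => l /= /(_ e e0).
  by apply: filterS => n /=; rewrite cellE.
have recw n j : (j <= n)%N -> sw n j.+1 = sw n j + mesh b n * sp n j by [].
pose F n j := K (sw n j - h (node b n j)) * ga (sp n j).
have recp n j : (j <= n)%N -> sp n j.+1 = sp n j + mesh b n * F n j by [].
have bw n j : (j <= n)%N -> `|sp n j| <= M by move=> jn; apply: euler_slope; exact: leqW.
have bF n j : (j <= n)%N -> `|F n j| <= B * g1 by move=> _; exact: force_bnd.
have nearw := node_near b_gt0 PU Uinfty recw bw w_lim.
have nearp := node_near b_gt0 PU Uinfty recp bF p_lim.
exists w, p; split.
- apply: (euler_limit b_gt0 PU Uinfty recw w_lim) => x xb e e0.
  have [d d0 Ud] := nearp x e xb e0; exists d => //.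
  by apply: filterS Ud => n /= h0 j jn; apply: h0; exact: leqW.
- apply: (euler_limit b_gt0 PU Uinfty recp p_lim) => x xb e e0.
  pose G (z : R * R * R) := K (z.1.1 - h z.2) * ga z.1.2.
  have G_cont : continuous G.
    move=> z; apply: cvgM.
      apply: continuous_comp; last exact: K_cont.
      apply: cvgB; first by apply: continuous_comp; exact: cvg_fst.
      by apply: continuous_comp; [exact: cvg_snd|exact: h_cont].
    apply: continuous_comp; last exact: ga_cont.
    by apply: continuous_comp; [exact: cvg_fst|exact: cvg_snd].
  have /cvgrPdist_le/(_ e e0)/nbhs_ballP[r /= r0 Gr] := G_cont (w x, p x, x).
  have r2 : 0 < r / 2 by lra.
  have [d1 d10 U1] := nearw x _ xb r2; have [d2 d20 U2] := nearp x _ xb r2.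
  exists (Num.min (r / 2) (Num.min d1 d2)); first by rewrite !lt_min r2 d10.
  apply: filterS (filterI U1 U2) => n /= [h1 h2] j jn; rewrite !le_min => /and3P[h3 h4 h5].
  have := Gr (sw n j, sp n j, node b n j); rewrite /G/= distrC; apply.
  have {}h1 := h1 j (leqW jn) h4; have {}h2 := h2 j (leqW jn) h5.
  by split; [split|]; rewrite /ball/= distrC; lra.
- have mb : - b <= - b <= b by lra.
  apply/eqP; rewrite eq_sym -subr_eq0 -normr_eq0 eq_le normr_ge0 andbT.
  apply/ler_addgt0Pr => e e0; rewrite add0r.
  have [n /=] := filter_ex (p_lim (- b) mb e e0); by rewrite cell_first.
- have mb : - b <= b <= b by lra.
  apply/eqP; rewrite eq_sym -subr_eq0 -normr_eq0 eq_le normr_ge0 andbT.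
  apply/ler_addgt0Pr => e e0; rewrite add0r.
  have [n /=] := filter_ex (p_lim b mb e e0); by rewrite cell_last// /sp al_shoot.
Qed.

End Shooting.

(** * Primitives *)

Section Primitive.
Variable R : realType.

Lemma is_derive_derw (c d : R) (F D : R -> R) :
  (forall x, c <= x <= d -> is_derive x (1 : R) F (D x)) -> derw c d F D.
Proof.
move=> H x xcd e e0; have dx := H x xcd.
have := @ex_derive _ _ _ _ _ _ _ dx; rewrite /derivable => /cvg_ex[l Hl].
have lD : l = D x.
  have <- := @derive_val _ _ _ _ _ _ _ dx; rewrite /derive; apply/esym/cvg_lim => //.
move: Hl; rewrite lD => /cvgrPdist_le/(_ e e0)/nbhs_ballP[r /= r0 Hr].
exists (r / 2); first lra.
move=> y ycd yx; have [->|yx0] := eqVneq y x.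
  by rewrite !subrr mulr0 subr0 normr0 mulr0.
have yx1 : y - x != 0 by rewrite subr_eq0.
have hb : `|y - x| < r by lra.
have := Hr (y - x); rewrite /ball/= sub0r normrN => /(_ hb yx1).
have -> : (y - x) *: (1 : R) + x = y by rewrite /GRing.scale/= mulr1 subrK.
rewrite -(@ler_pM2r _ `|y - x|) ?normr_gt0// -normrM mulrBl.
by rewrite /GRing.scale/= mulrAC mulVf// mul1r distrC.
Qed.

Lemma derw_unique_zero (c d : R) (F G D : R -> R) x y : derw c d F D -> derw c d G D ->
  c <= x <= d -> c <= y <= d -> F x - G x = F y - G y.
Proof.
move=> dF dG; wlog xy : x y / x <= y.
  move=> H xcd ycd; have [xy|/ltW yx] := leP x y; first exact: H.
  by rewrite (H y x).
move=> xcd ycd; move: xy; rewrite le_eqVlt => /predU1P[->//|xy].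
have dFG := derwB dF dG.
have [|||z _] := derw_mvt (x := x) (y := y) dFG; [lra|lra|lra|].
rewrite subrr mul0r; lra.
Qed.

(** The integral from - n - 1 gives a primitive on [- n, n]; normalised to vanish
    at 0, primitives on different intervals agree and glue. *)
Lemma primitive (phi : R -> R) : continuous phi ->
  exists Phi, forall c d, derw c d Phi phi.
Proof.
move=> cphi.
have loc (n : R) : exists2 F, F 0 = 0 & forall d, derw (- n) d F phi.
  pose I x := (\int[@lebesgue_measure R]_(t in [set` `[- n - 1, x]%R]) phi t)%R.
  exists (fun x => I x - I 0); first by rewrite subrr.
  move=> d; have dI : derw (- n) d I phi.
    apply: is_derive_derw => x xd.
    have [||||dx Ex] := @continuous_FTC1_closed R phi (- n - 1) x (x + 1).
    - lra.
    - apply: continuous_compact_integrable; first exact: segment_compact.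
      exact: continuous_subspaceT.
    - lra.
    - exact: cphi.
    exact: (DeriveDef dx (etrans (esym (derive1E _ _)) Ex)).
  have := derwB dI (@derw_affine R (- n) d 0 (I 0)); apply: derw_ext.
    by move=> x _; rewrite mul0r add0r.
  by move=> x _; rewrite subr0.
pose F n := sval (cid2 (loc n)).
have F0 n : F n 0 = 0 by rewrite /F; case: cid2.
have dF n d : derw (- n) d (F n) phi by rewrite /F; case: cid2.
have FE n m x : 0 <= n -> n <= m -> - n <= x -> F n x = F m x.
  move=> n0 nm nx; pose d := Num.max x 0.
  have dx : x <= d by rewrite le_max lexx.
  have d0 : 0 <= d by rewrite le_max lexx orbT.
  have dm : derw (- n) d (F m) phi by apply: derw_sub (dF m d); lra.
  have := derw_unique_zero (x := x) (y := 0) (dF n d) dm.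
  rewrite !F0 => H; have {}H : F n x - F m x = 0 - 0 by apply: H; lra.
  lra.
exists (fun x => F (`|x|) x) => c d x xcd e e0.
pose n := `|c| + `|d|.
have nn : 0 <= n by rewrite addr_ge0.
have cd y : c <= y <= d -> `|y| <= n.
  by move=> ycd; rewrite /n ler_norml; have := ler_norm d; have := ler_norm (- c); rewrite normrN; have := normr_ge0 c; have := normr_ge0 d; lra.
have FnE y : c <= y <= d -> F (`|y|) y = F n y.
  by move=> ycd; apply: FE => //; [exact: cd|have := ler_norm (- y); rewrite normrN; lra].
have [|r r0 H] := dF n n x _ e e0; first by have := cd x xcd; rewrite ler_norml.
exists r => // y ycd yx; rewrite !FnE//; apply: H => //.
by have := cd y ycd; rewrite ler_norml.
Qed.

End Primitive.

(** * Inverses, truncations and a barrier principle *)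

Section Inverse.
Variable R : realType.

Lemma continuous_epsP (F : R -> R) : continuous F <-> forall x e : R, 0 < e ->
  exists2 d, 0 < d & forall y, `|y - x| <= d -> `|F y - F x| <= e.
Proof.
split=> [cF x e e0|H x].
  have /cvgrPdist_le/(_ e e0)/nbhs_ballP[r /= r0 Hr] := cF x.
  exists (r / 2); first lra.
  move=> y yx; rewrite distrC; apply: Hr; rewrite /ball/= distrC; lra.
apply/cvgrPdist_le => e e0; have [d d0 Hd] := H x e e0.
apply/nbhs_ballP; exists d => //= y; rewrite /ball/= => xy.
by rewrite distrC; apply: Hd; rewrite distrC ltW.
Qed.

Lemma increasing_inverse (f : R -> R) : continuous f -> {homo f : x y / x < y} ->
  f s @[s --> +oo] --> +oo -> f s @[s --> -oo] --> -oo ->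
  exists k : R -> R, [/\ continuous k, cancel k f, cancel f k & {homo k : x y / x < y}].
Proof.
move=> cf fi fp fn.
have surj y : exists x, f x = y.
  have [M1 [_ H1]] : \forall s \near +oo, y <= f s by move/cvgryPge : fp => /(_ y).
  have [M2 [_ H2]] : \forall s \near -oo, f s <= y by move/cvgrNyPle : fn => /(_ y).
  have h1 := H1 (Num.max (M1 + 1) (M2 + 1)).
  have h2 := H2 (M2 - 1).
  have ab : M2 - 1 <= Num.max (M1 + 1) (M2 + 1) by rewrite le_max; apply/orP; right; lra.
  have [] := @IVT R f _ _ y ab (continuous_subspaceT cf).
    apply/andP; split; [rewrite ge_min|rewrite le_max]; apply/orP; [left; apply: h2|right; apply: h1].
      lra.
    by rewrite lt_max ltrDl ltr01.
  by move=> x _ <-; exists x.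
pose k y := sval (cid (surj y)).
have kf : cancel k f by move=> y; rewrite /k; case: cid.
have fk : cancel f k.
  move=> x; have := kf (f x); have [/fi|/fi|//] := ltgtP (k (f x)) x; lra.
have ki : {homo k : x y / x < y}.
  move=> x y xy; rewrite ltNge le_eqVlt; apply/negP => /predU1P[E|/fi].
    by move: xy; rewrite -(kf x) -(kf y) E ltxx.
  by rewrite !kf; lra.
exists k; split => //; apply/continuous_epsP => y e e0.
have h1 : f (k y - e) < y by rewrite -{2}(kf y); apply: fi; lra.
have h2 : y < f (k y + e) by rewrite -{1}(kf y); apply: fi; lra.
exists (Num.min (y - f (k y - e)) (f (k y + e) - y) / 2).
  by rewrite divr_gt0// lt_min; apply/andP; split; lra.
move=> z.
rewrite ler_pdivlMr// le_min => /andP[].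
have [->|zy] := eqVneq z y; first by move=> _ _; rewrite subrr normr0 ltW.
have zp : 0 < `|z - y| by rewrite normr_gt0 subr_eq0.
move=> h3 h4.
have zl : f (k y - e) < z by have := ler_norm (- (z - y)); rewrite normrN; lra.
have zr : z < f (k y + e) by have := ler_norm (z - y); lra.
by move/ki: zl; move/ki : zr; rewrite !fk ler_norml; lra.
Qed.

Definition clamp (B s : R) := Num.max (- B) (Num.min B s).

Lemma clampP B s : 0 <= B -> - B <= clamp B s <= B.
Proof.
move=> B0; rewrite /clamp le_max lexx/= ge_max ge_min lexx/= andbT; lra.
Qed.

Lemma clamp_id B s : - B <= s <= B -> clamp B s = s.
Proof. by move=> /andP[h1 h2]; rewrite /clamp min_r// max_r. Qed.

Lemma clamp_ge B s : 0 <= B -> B <= s -> clamp B s = B.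
Proof. by move=> B0 h; rewrite /clamp min_l// max_r//; lra. Qed.

Lemma clamp_le B s : 0 <= B -> s <= - B -> clamp B s = - B.
Proof.
by move=> B0 h; rewrite /clamp max_l// ge_min h orbT.
Qed.

Lemma clamp_lip B s t : `|clamp B s - clamp B t| <= `|s - t|.
Proof.
wlog st : s t / s <= t.
  by move=> H; have [/H//|/ltW /H] := leP s t; rewrite distrC (distrC t).
rewrite (@ler0_norm _ (s - t)); last lra.
rewrite /clamp ler_norml.
have [h1|h1] := leP (- B) (Num.min B s); have [h2|h2] := leP (- B) (Num.min B t);
  move: h1 h2; have [h3|h3] := leP B s; have [h4|h4] := leP B t; clear -st h3 h4; lra.
Qed.

Lemma clamp_continuous B : continuous (clamp B).
Proof.
apply/continuous_epsP => x e e0; exists e => // y yx; exact: le_trans (clamp_lip _ _ _) yx.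
Qed.

Lemma contw_clamp b (h : R -> R) : 0 <= b -> contw (- b) b h ->
  continuous (fun x => h (clamp b x)).
Proof.
move=> b0 ch; apply/continuous_epsP => x e e0.
have [d d0 H] := ch _ (clampP x b0) e e0; exists d => // y yx.
by apply: H; [exact: clampP|exact: le_trans (clamp_lip _ _ _) yx].
Qed.

Lemma contw_bounded a b (h : R -> R) : contw a b h ->
  exists2 B, 0 <= B & forall x, a <= x <= b -> `|h x| <= B.
Proof.
move=> ch; have [ab|ba] := leP a b; last by exists 0 => // x; lra.
have [x1 _ H1] := contw_max ab ch; have [x2 _ H2] := contw_max ab (contwN ch).
exists (`|h x1| + `|h x2|); first by rewrite addr_ge0.
move=> x xab; have := H1 x xab; have := H2 x xab; rewrite ler_norml.
have := ler_norm (h x1); have := ler_norm (- h x2); rewrite normrN.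
by have := normr_ge0 (h x1); have := normr_ge0 (h x2); lra.
Qed.

End Inverse.

Section Barrier.
Variable R : realType.

(** At an interior positive maximum x0 of q - (c x + l) the slope D x0 equals c
    and u increases to the right of x0; since D exceeds c as soon as u exceeds
    u x0, q - (c x + l) would increase past its maximum. *)
Lemma barrier_upper (b c l : R) (q D u du : R -> R) : 0 < b ->
  derw (- b) b q D -> derw (- b) b u du -> contw (- b) b du ->
  (forall x y, - b <= x <= b -> - b <= y <= b -> D x = c -> u x < u y -> c < D y) ->
  q (- b) <= c * (- b) + l -> q b <= c * b + l ->
  (forall x, - b < x < b -> c * x + l < q x -> 0 < du x) ->
  forall x, - b <= x <= b -> q x <= c * x + l.
Proof.
move=> b0 dq du_ cdu Dinc qm qp Hdu.
have bb : - b <= b by lra.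
have dF := derwB dq (@derw_affine _ (- b) b c l).
have [x0 x0b x0max] := contw_max bb (derw_contw dF).
move=> x xb; rewrite leNgt; apply/negP => qx.
have Fx0 : 0 < q x0 - (c * x0 + l) by have := x0max x xb; lra.
have x0in : - b < x0 < b.
  have [E|n1] := eqVneq x0 b; first by move: Fx0; rewrite E; lra.
  have [E|n2] := eqVneq x0 (- b); first by move: Fx0; rewrite E; lra.
  by rewrite !lt_neqAle n1 eq_sym n2; lra.
have D0 : D x0 - c = 0.
  by apply: (derw_max_eq0 dF x0in ltr01) => y yb _; exact: x0max.
have du0 : 0 < du x0 by apply: Hdu => //; lra.
have d2 : 0 < du x0 / 2 by lra.
have [d d0 Hd] := cdu x0 x0b _ d2.
pose y := x0 + Num.min d (b - x0).
have m0 : 0 < Num.min d (b - x0) by rewrite lt_min d0; lra.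
have [m1 m2] : y - x0 <= d /\ y - x0 <= b - x0.
  by rewrite /y addrAC subrr add0r; split; rewrite ge_min lexx ?orbT.
have yx : x0 < y by rewrite /y; clear -m0; lra.
have uinc z : x0 < z <= y -> u x0 < u z.
  move=> zy; apply: (derw_incr_lt du_); [clear -x0in; lra|clear -zy; lra|clear -m2 zy; lra|] => t tz.
  have := Hd t ltac:(clear -x0in m2 zy tz; lra); rewrite ger0_norm; last (clear -tz; lra).
  by move=> /(_ ltac:(clear -m1 zy tz; lra)); rewrite ler_norml; clear -d2; lra.
suff : q x0 - (c * x0 + l) < q y - (c * y + l) by have := x0max y; clear -x0in m2 yx; lra.
apply: (derw_incr_lt dF); [clear -x0in; lra|clear -yx; lra|clear -m2; lra|] => t ty.
rewrite subr_gt0; apply: (Dinc x0) => //; [clear -x0in m2 ty; lra|clear -D0; lra|apply: uinc; clear -ty; lra].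
Qed.

Lemma barrier_lower (b c l : R) (q D u du : R -> R) : 0 < b ->
  derw (- b) b q D -> derw (- b) b u du -> contw (- b) b du ->
  (forall x y, - b <= x <= b -> - b <= y <= b -> D x = c -> u x < u y -> c < D y) ->
  c * (- b) - l <= q (- b) -> c * b - l <= q b ->
  (forall x, - b < x < b -> q x < c * x - l -> du x < 0) ->
  forall x, - b <= x <= b -> c * x - l <= q x.
Proof.
move=> b0 dq du_ cdu Dinc qm qp Hdu x xb.
have dq' : derw (- b) b (fun x => - q (- x)) (fun x => D (- x)).
  have := derwN (derw_reflect_sym dq); apply: derw_ext => // z _; by rewrite opprK.
have cdu' : contw (- b) b (fun x => - du (- x)).
  move=> z zb e e0; have [|d d0 H] := cdu (- z) _ e e0; first lra.
  exists d => // y yb yz; have E : - y - - z = - (y - z) by ring.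
  rewrite -opprD normrN; apply: H; first lra.
  by rewrite E normrN.
have := @barrier_upper b c l _ _ _ _ b0 dq' (derw_reflect_sym du_) cdu'.
move=> H; suff : - q (- - x) <= c * - x + l by rewrite opprK; lra.
apply: H; rewrite ?opprK; try lra.
- by move=> y z yb zb; apply: Dinc; lra.
- by move=> y yb qy; rewrite oppr_gt0; apply: Hdu; lra.
Qed.

End Barrier.

(** * One implicit Euler step *)

Section Resolvent.
Variables (R : realType).

(** The equation reads p' = k ((w - h) / tau) / g p with k inverse to f. The
    arguments of k and g are first truncated, which makes the right-hand side
    bounded; the bounds on h' then carry over to p by the barrier principle with
    c = 0, and w - h is bounded because it is so at a point where p' is the mean
    slope N / b. Hence both truncations are inactive. *)
Lemma resolvent (b tau N : R) (f k g h h' : R -> R) :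
  0 < b -> 0 < tau -> 0 < N -> continuous k -> cancel k f -> cancel f k ->
  {homo k : x y / x < y} -> k 0 = 0 -> continuous g -> (forall s, 0 < g s) ->
  derw (- b) b h h' -> contw (- b) b h' ->
  (forall x, - b <= x <= b -> - N <= h' x <= N) ->
  exists w p m, [/\ derw (- b) b w p, derw (- b) b p m, p (- b) = - N /\ p b = N,
    (forall x, - b <= x <= b -> - N <= p x <= N) &
    (forall x, - b <= x <= b -> f (g (p x) * m x) = (w x - h x) / tau)].
Proof.
move=> b0 t0 N0 ck kf fk ki k0 cg g0 dh ch' hN.
have kle : {homo k : x y / x <= y}.
  by move=> x y; rewrite le_eqVlt => /predU1P[->//|/ki/ltW].
have NN : - N <= N by lra.
have [x1 _ gM] := contw_max NN (continuous_contw (a := - N) (b := N) cg).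
have [x2 _ gm] := contw_max NN (contwN (continuous_contw (a := - N) (b := N) cg)).
have G1 := g0 x1; have G2 := g0 x2.
set M1 := g x1 in gM G1; set M2 := g x2 in gm G2.
pose ga s := (g (clamp N s))^-1.
have gc s : M2 <= g (clamp N s) <= M1.
  have cN := clampP s (ltW N0).
  by have := gM _ cN; have := gm _ cN; lra.
have ga_bnd s : M1^-1 <= ga s <= M2^-1.
  have /andP[h1 h2] := gc s; have g3 := g0 (clamp N s).
  by rewrite /ga !lef_pV2 ?posrE// h1 h2.
have ga_cont : continuous ga.
  move=> s; apply: cvgV; first by rewrite gt_eqF.
  by apply: continuous_comp; [exact: clamp_continuous|exact: cg].
have ga_gt0 s : 0 < ga s by rewrite invr_gt0.
(* s0 / M1 exceeds the mean N / b of p', so that shooting can reach the slope N. *)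
pose s0 := (N + 1) * M1 / b.
have s00 : 0 < s0 by rewrite divr_gt0// mulr_gt0//; lra.
pose Q0 := `|f s0| + `|f (- s0)|.
have Q00 : 0 <= Q0 by rewrite addr_ge0.
have kQ0 : s0 <= k Q0.
  rewrite -(fk s0); apply: kle; rewrite /Q0.
  by have := ler_norm (f s0); have := normr_ge0 (f (- s0)); lra.
have kQ0n : k (- Q0) <= - s0.
  rewrite -(fk (- s0)); apply: kle; rewrite /Q0.
  by have := ler_norm (- f (- s0)); rewrite normrN; have := normr_ge0 (f s0); lra.
(* Q0 bounds (w - h) / tau at one point, and 4 b N the oscillation of w - h. *)
pose Q := Q0 + 4 * b * N / tau.
have bN : 0 < b * N by rewrite mulr_gt0.
have QQ : Q0 < Q by rewrite ltrDl divr_gt0//; lra.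
pose K s := k (clamp Q (s / tau)).
have Q0' : 0 <= Q by lra.
have K_cont : continuous K.
  move=> s; apply: continuous_comp; last exact: ck.
  apply: continuous_comp; last exact: clamp_continuous.
  by apply: cvgM; [exact: cvg_id|exact: cvg_cst].
have K_bnd s : `|K s| <= k Q - k (- Q).
  have /andP[/kle h1 /kle h2] := clampP (s / tau) Q0'.
  have kQp : 0 <= k Q by rewrite -k0; apply: kle.
  have kQn : k (- Q) <= 0 by rewrite -k0; apply: kle; clear -Q0'; lra.
  by rewrite ler_norml /K; clear -h1 h2 kQp kQn; lra.
have K_gt0 s : 0 < s -> 0 < K s.
  move=> s_gt0; rewrite -k0; apply: ki; rewrite /clamp lt_max lt_min.
  by apply/orP; right; rewrite divr_gt0// andbT; clear -Q00 QQ; lra.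
have K_lt0 s : s < 0 -> K s < 0.
  move=> s_lt0; rewrite -k0; apply: ki; rewrite /clamp gt_max gt_min.
  by rewrite ltr_pdivrMr// mul0r s_lt0 orbT andbT; clear -Q00 QQ; lra.
have K_eq0 s : K s = 0 -> s = 0.
  by have [/K_lt0|/K_gt0|//] := ltgtP s 0; clear; lra.
have [Hb Hb0 Hbnd] := contw_bounded (derw_contw dh).
pose hc x := h (clamp b x).
have hc_cont : continuous hc by apply: contw_clamp; [exact: ltW|exact: derw_contw dh].
have hc_bnd x : `|hc x| <= Hb by apply: Hbnd; exact: clampP (ltW b0).
have hcE x : - b <= x <= b -> hc x = h x by move=> xb; rewrite /hc clamp_id.
have K_large s : tau * Q <= s -> k Q <= K s.
  by move=> hs; rewrite /K clamp_ge// ler_pdivlMr// mulrC.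
have K_large' s : tau * Q <= s -> s0 <= K s.
  by move/K_large; have := kle _ _ (ltW QQ); clear -kQ0; lra.
have K_small s : s <= - (tau * Q) -> K s <= - s0.
  move=> hs; rewrite /K clamp_le//; last by rewrite ler_pdivrMr// mulNr mulrC.
  have : k (- Q) <= k (- Q0) by apply: kle; clear -QQ; lra.
  clear -kQ0n; lra.
have slopes : `|N - - N| <= 2 * b * (s0 * M1^-1).
  rewrite opprK ger0_norm; last (clear -NN; lra).
  have -> : 2 * b * (s0 * M1^-1) = 2 * (N + 1) by rewrite /s0; field; clear -b0 G1; lra.
  clear; lra.
have gaM1 : 0 < M1^-1 by rewrite invr_gt0.
have [w [p [dw dp pm pp]]] := two_point_problem b0 K_cont hc_cont ga_cont K_bnd gaM1 ga_bnd hc_bnd (ltW s00) K_large' K_small slopes.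
pose u x := w x - h x; pose du x := p x - h' x.
have du_ : derw (- b) b u du by apply: derwB.
have cdu : contw (- b) b du by apply: contwD; [exact: derw_contw dp|exact: contwN].
pose m x := K (u x) * ga (p x).
have dm : derw (- b) b p m.
  by move: dp; apply: derw_ext => // x xb; rewrite hcE.
have Dinc x y : - b <= x <= b -> - b <= y <= b -> m x = 0 -> u x < u y -> 0 < m y.
  move=> _ _ /eqP; rewrite mulf_eq0 (gt_eqF (ga_gt0 _)) orbF => /eqP/K_eq0 -> uy.
  by rewrite mulr_gt0// K_gt0.
have pN x : - b <= x <= b -> - N <= p x <= N.
  move=> xb; apply/andP; split.
    have := @barrier_lower R b 0 N p m u du b0 dm du_ cdu Dinc.
    rewrite pm pp !mul0r sub0r => H.
    have : 0 * x - N <= p x; last by rewrite mul0r sub0r.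
    apply: H => //; try lra.
    move=> y yb; rewrite mul0r sub0r /du => py; have := hN y; clear -yb py; lra.
  have := @barrier_upper R b 0 N p m u du b0 dm du_ cdu Dinc.
  rewrite pm pp !mul0r add0r => H.
  have : p x <= 0 * x + N; last by rewrite mul0r add0r.
  apply: H => //; try lra.
  move=> y yb; rewrite mul0r add0r /du => py; have := hN y; clear -yb py; lra.
have [c cb cE] := derw_mvt dm (lexx (- b)) (y := b) ltac:(clear -b0; lra) (lexx b).
have cb' : - b <= c <= b by clear -cb; lra.
have mc : m c = N / b.
  have bn0 : b != 0 by rewrite gt_eqF.
  move: cE; rewrite pm pp opprK => E; apply: (mulIf bn0); rewrite divfK//; clear -E; lra.
have uc : 0 <= u c <= tau * Q0.
  have mc0 : 0 < m c by rewrite mc divr_gt0.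
  apply/andP; split; rewrite leNgt; apply/negP => ucl.
    by have := K_lt0 _ ucl; move: mc0; rewrite /m pmulr_lgt0//; clear; lra.
  have : s0 <= K (u c).
    apply: le_trans kQ0 _; apply: kle; rewrite /clamp le_max le_min.
    by apply/orP; right; rewrite (ltW QQ) ler_pdivlMr// mulrC ltW.
  have /andP[h1 _] := ga_bnd (p c).
  move=> sK; have : s0 * M1^-1 <= m c by apply: ler_pM => //; exact: ltW.
  rewrite mc /s0.
  have -> : (N + 1) * M1 / b * M1^-1 = N / b + b^-1 by field; clear -G1 cb; lra.
  have : 0 < b^-1 by rewrite invr_gt0.
  clear; lra.
have ub x : - b <= x <= b -> `|u x| <= tau * Q.
  move=> xb.
  have lip : `|u x - u c| <= 2 * N * (2 * b).
    have H y z : - b <= y -> y < z -> z <= b -> `|u z - u y| <= 2 * N * (2 * b).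
      move=> yb yz zb; have [d dyz ->] := derw_mvt du_ yb yz zb.
      rewrite normrM; apply: ler_pM => //.
        by have := pN d; have := hN d; rewrite ler_norml /du; clear -yb zb dyz; lra.
      by rewrite ger0_norm; clear -yb zb dyz; lra.
    have [xc|cx|->] := ltgtP x c.
    - by rewrite distrC; apply: H; clear -xb xc cb'; lra.
    - by apply: H; clear -cb' cx xb; lra.
    - by rewrite subrr normr0; clear -bN; lra.
  have -> : tau * Q = tau * Q0 + 4 * b * N by rewrite /Q mulrDr mulrC (mulrC tau (_ / _)) divfK ?gt_eqF//; ring.
  have := ler_norm (u x - u c); have := ler_norm (- (u x - u c)); rewrite normrN.
  by rewrite ler_norml; clear -uc lip; lra.
exists w, p, m; split => // x xb.
have -> : g (p x) * m x = K (u x).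
  by rewrite /m /ga clamp_id ?pN// mulrCA divff ?mulr1// gt_eqF.
rewrite /K clamp_id ?kf//.
have := ub x xb; rewrite ler_norml => /andP[h1 h2].
by rewrite ler_pdivlMr// ler_pdivrMr// mulNr (mulrC Q) h1 h2.
Qed.

End Resolvent.

(** * Propagation of slope bounds *)

Section SlopeBounds.
Variable R : realType.

Lemma homo_lt_le (f : R -> R) : {homo f : x y / x < y} -> {homo f : x y / x <= y}.
Proof. by move=> fi x y; rewrite le_eqVlt => /predU1P[->//|/fi/ltW]. Qed.

Lemma homo_lt_inv (f : R -> R) x y : {homo f : x y / x < y} -> f x < f y -> x < y.
Proof. by move=> fi; rewrite !ltNge; apply: contra; exact: homo_lt_le. Qed.

Lemma primitive_incr (G g : R -> R) : (forall c d, derw c d G g) -> (forall s, 0 < g s) ->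
  {homo G : x y / x < y}.
Proof. by move=> dG g0 x y xy; apply: (derw_incr_lt (dG x y)) => // z _; exact: g0. Qed.

Section Resolvent_slopes.
Variables (b tau N c : R) (f g G w p m h h' : R -> R).
Hypotheses (b0 : 0 < b) (t0 : 0 < tau) (fi : {homo f : x y / x < y})
  (dG : forall c d, derw c d G g) (g0 : forall s, 0 < g s)
  (dw : derw (- b) b w p) (dp : derw (- b) b p m) (dh : derw (- b) b h h')
  (ch' : contw (- b) b h') (pm : p (- b) = - N) (pp : p b = N)
  (eqn : forall x, - b <= x <= b -> f (g (p x) * m x) = (w x - h x) / tau).

Let dq : derw (- b) b (fun x => G (p x)) (fun x => g (p x) * m x).
Proof. exact: derw_comp. Qed.

Let du : derw (- b) b (fun x => w x - h x) (fun x => p x - h' x).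
Proof. exact: derwB. Qed.

Let cdu : contw (- b) b (fun x => p x - h' x).
Proof. by apply: contwD; [exact: derw_contw dp|exact: contwN]. Qed.

Let Dinc x y : - b <= x <= b -> - b <= y <= b -> g (p x) * m x = c ->
  w x - h x < w y - h y -> c < g (p y) * m y.
Proof.
move=> xb yb <- uu; apply: (homo_lt_inv fi); rewrite !eqn//.
by rewrite ltr_pM2r// invr_gt0.
Qed.

Let Ginv x y : G x < G y -> x < y.
Proof. by apply: homo_lt_inv; exact: primitive_incr. Qed.

(** With G a primitive of g, G (p) has derivative g (p) m, an increasing function of
    w - h by the equation. The linear barrier c x + l for G (h') is therefore
    inherited by G (p). *)
Lemma slope_upper : G (- N) <= G N - c * (2 * b) ->
  (forall x, - b <= x <= b -> G (h' x) <= G N - c * (b - x)) ->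
  forall x, - b <= x <= b -> G (p x) <= G N - c * (b - x).
Proof.
move=> GN hh x xb.
have := barrier_upper (l := G N - c * b) b0 dq du cdu Dinc.
rewrite pm pp => H.
suff : G (p x) <= c * x + (G N - c * b) by lra.
apply: H => //; try lra.
move=> y yb qy; suff : h' y < p y by lra.
apply: Ginv; have := hh y; lra.
Qed.

Lemma slope_lower : G (- N) <= G N - c * (2 * b) ->
  (forall x, - b <= x <= b -> G (- N) + c * (b + x) <= G (h' x)) ->
  forall x, - b <= x <= b -> G (- N) + c * (b + x) <= G (p x).
Proof.
move=> GN hh x xb.
have := barrier_lower (l := - (G (- N) + c * b)) b0 dq du cdu Dinc.
rewrite pm pp => H.
suff : c * x - - (G (- N) + c * b) <= G (p x) by lra.
apply: H => //; try lra.
move=> y yb qy; suff : p y < h' y by lra.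
apply: Ginv; have := hh y; lra.
Qed.

End Resolvent_slopes.

Lemma derw_powR (a c d : R) : 0 < c -> derw c d (fun s => s `^ a) (fun s => a * s `^ (a - 1)).
Proof.
move=> c0; apply: is_derive_derw => x xcd; apply: is_derive1_powR; lra.
Qed.

Lemma derwZ a b (l : R) (F D : R -> R) : derw a b F D -> derw a b (fun x => l * F x) (fun x => l * D x).
Proof.
move=> H x xab e e0.
have e1 : 0 < e / (`|l| + 1) by rewrite divr_gt0// ltr_wpDl.
have [d d0 K] := H x xab _ e1; exists d => // y yab yx.
have -> : l * F y - l * F x - l * D x * (y - x) = l * (F y - F x - D x * (y - x)) by ring.
rewrite normrM; apply: le_trans (_ : (`|l| + 1) * (e / (`|l| + 1) * `|y - x|) <= _).
  by apply: ler_pM => //; [rewrite lerDl|exact: K].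
by rewrite mulrA mulrCA divff ?mulr1// gt_eqF// ltr_wpDl.
Qed.

(** Integration of the decay of g from s to N. *)
Lemma tail_bound (alpha A s1 N s : R) (G g : R -> R) : 1 < alpha -> 0 < s1 -> (forall s, 0 < g s) ->
  (forall c d, derw c d G g) -> (forall s, s1 <= s -> g s <= A * s `^ (- alpha)) ->
  s1 <= s -> s <= N -> G N - G s <= A / (alpha - 1) * s `^ (1 - alpha).
Proof.
move=> a1 s10 g0 dG gA s1s sN; have s0 : 0 < s by lra.
have d1 := derwN (derwZ (A / (alpha - 1)) (@derw_powR (1 - alpha) s N s0)).
have d2 := derwB d1 (dG s N).
have := derw_incr d2 (lexx s) sN (lexx N).
have -> : 1 - alpha - 1 = - alpha by ring.
move=> H.
have {}H : - (A / (alpha - 1) * s `^ (1 - alpha)) - G s <= - (A / (alpha - 1) * N `^ (1 - alpha)) - G N.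
  apply: H => z zs; have -> : A / (alpha - 1) * ((1 - alpha) * z `^ (- alpha)) = - (A * z `^ (- alpha)).
    field; lra.
  have := gA z; lra.
have A0 : 0 <= A.
  have := gA s s1s; have := g0 s; have := powR_gt0 (- alpha) s0; nra.
have : 0 <= A / (alpha - 1) * N `^ (1 - alpha).
  by rewrite mulr_ge0 ?powR_ge0// divr_ge0//; lra.
lra.
Qed.

End SlopeBounds.

(** * Uniform continuity on rectangles *)

Section Uniform.
Variable R : realType.

Definition contw2 (a b T : R) (v : R * R -> R) := forall x t, a <= x <= b -> 0 <= t <= T ->
  forall e, 0 < e -> exists2 d, 0 < d & forall y s, a <= y <= b -> 0 <= s <= T ->
    `|y - x| <= d -> `|s - t| <= d -> `|v (y, s) - v (x, t)| <= e.

Lemma contw2_unif a b T v : contw2 a b T v -> forall e, 0 < e -> exists2 d, 0 < d &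
  forall x t y s, a <= x <= b -> 0 <= t <= T -> a <= y <= b -> 0 <= s <= T ->
    `|y - x| <= d -> `|s - t| <= d -> `|v (y, s) - v (x, t)| <= e.
Proof.
move=> cv e e0; apply: contrapT => nex.
have bad n : exists z : (R * R) * (R * R), [/\ a <= z.1.1 <= b, 0 <= z.1.2 <= T,
    a <= z.2.1 <= b, 0 <= z.2.2 <= T &
    [/\ `|z.2.1 - z.1.1| <= n.+1%:R^-1, `|z.2.2 - z.1.2| <= n.+1%:R^-1 &
        e < `|v z.2 - v z.1|]].
  apply: contrapT => nz; apply: nex; exists n.+1%:R^-1; first by rewrite invr_gt0.
  move=> x t y s xb tT yb sT yx st; rewrite leNgt; apply/negP => ev.
  by apply: nz; exists ((x, t), (y, s)).
pose z n := sval (cid (bad n)).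
have zP n : [/\ a <= (z n).1.1 <= b, 0 <= (z n).1.2 <= T,
    a <= (z n).2.1 <= b, 0 <= (z n).2.2 <= T &
    [/\ `|(z n).2.1 - (z n).1.1| <= n.+1%:R^-1, `|(z n).2.2 - (z n).1.2| <= n.+1%:R^-1 &
        e < `|v (z n).2 - v (z n).1|]] by rewrite /z; case: cid.
have [U PU [Uinfty Ulim]] := ultralimit R.
have [l Hl] : exists l, forall e, 0 < e -> U [set n | `|(z n).1.1 - l| <= e].
  apply: (Ulim _ (`|a| + `|b|)) => n; have [h _ _ _ _] := zP n; rewrite ler_norml.
  have := ler_norm (- a); have := ler_norm b; rewrite normrN.
  by have := normr_ge0 b; have := normr_ge0 a; clear -bad h; lra.
have [r Hr] : exists l, forall e, 0 < e -> U [set n | `|(z n).1.2 - l| <= e].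
  apply: (Ulim _ T) => n; have [_ h _ _ _] := zP n; rewrite ler_norml; lra.
have lab : a <= l <= b.
  apply/andP; split; apply/ler_addgt0Pr => d d0; have [n /=] := filter_ex (Hl d d0);
  rewrite ler_norml; have [h _ _ _ _] := zP n; clear -bad h; lra.
have rT : 0 <= r <= T.
  apply/andP; split; apply/ler_addgt0Pr => d d0; have [n /=] := filter_ex (Hr d d0);
  rewrite ler_norml; have [_ h _ _ _] := zP n; clear -bad h; lra.
have e3 : 0 < e / 2 by lra.
have [d d0 Hd] := cv l r lab rT _ e3.
have d2 : 0 < d / 2 by clear -bad d0; lra.
have [n /= [h1 [h2 h3]]] := filter_ex (filterI (Hl _ d2) (filterI (Hr _ d2)
  (Uinfty (Num.truncn (2 / d))))).
have nd : n.+1%:R^-1 <= d / 2.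
  rewrite -[d / 2]invrK lef_pV2 ?posrE ?invr_gt0// invfM invrK mulrC.
  by apply: le_trans (ltW (truncnS_gt _)) _; rewrite ler_nat ltnS.
have [i1 i2 i3 i4 [/le_trans/(_ nd) h4 /le_trans/(_ nd) h5]] := zP n; apply/negP; rewrite -leNgt.
have := Hd _ _ i1 i2; have := Hd _ _ i3 i4; rewrite -!surjective_pairing.
have -> : (z n).2.1 - l = ((z n).2.1 - (z n).1.1) + ((z n).1.1 - l) by ring.
have -> : (z n).2.2 - r = ((z n).2.2 - (z n).1.2) + ((z n).1.2 - r) by ring.
move=> /(_ _ _)H1 H2.
have {}H1 : `|v (z n).2 - v (l, r)| <= e / 2.
  by apply: H1; apply: le_trans (ler_normD _ _) _; clear -bad h1 h4 h2 h5; lra.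
have {}H2 : `|v (z n).1 - v (l, r)| <= e / 2 by apply: H2; clear -bad d0 h1 h2; lra.
have -> : v (z n).2 - v (z n).1 = (v (z n).2 - v (l, r)) - (v (z n).1 - v (l, r)) by ring.
apply: le_trans (ler_normB _ _) _; clear -bad H1 H2; lra.
Qed.

Lemma contw_unif (a b : R) (F : R -> R) : contw a b F -> forall e, 0 < e -> exists2 d, 0 < d &
  forall x y, a <= x <= b -> a <= y <= b -> `|y - x| <= d -> `|F y - F x| <= e.
Proof.
move=> cF e e0.
have cv : contw2 a b 0 (fun z => F z.1).
  move=> x t xb _ r r0; have [d d0 H] := cF x xb r r0; exists d => // y s yb _ yx _.
  exact: H.
have [d d0 H] := contw2_unif cv e0; exists d => // x y xb yb yx.
by apply: (H x 0 y 0) => //; rewrite ?lexx// subrr normr0 ltW.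
Qed.

Lemma contw2_sections a b T v t : contw2 a b T v -> 0 <= t <= T ->
  contw a b (fun x => v (x, t)).
Proof.
move=> cv tT x xb e e0; have [d d0 H] := cv x t xb tT e e0; exists d => // y yb yx.
by apply: H => //; rewrite subrr normr0 ltW.
Qed.

Lemma contw2_bounded a b T v : contw2 a b T v -> exists2 V, 0 <= V &
  forall x t, a <= x <= b -> 0 <= t <= T -> `|v (x, t)| <= V.
Proof.
move=> cv; have [d d0 H] := contw2_unif cv ltr01.
have [ab|ba] := leP a b; last by exists 0 => // x t; lra.
have [T0|T0] := leP 0 T; last by exists 0 => // x t; lra.
have c0 : contw a b (fun x => v (x, 0)) by apply: contw2_sections cv _; rewrite lexx.
have [V V0 HV] := contw_bounded c0.
pose n := (Num.truncn (T / d)).+1.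
have nd : T <= n%:R * d.
  by rewrite -ler_pdivrMr//; apply: ltW; exact: truncnS_gt.
exists (V + n%:R); first by rewrite addr_ge0.
have key k : forall x t, a <= x <= b -> 0 <= t <= T -> t <= k%:R * d -> `|v (x, t)| <= V + k%:R.
  elim: k => [|k IH] x t xb tT; rewrite ?mul0r ?addr0.
    move=> t0; have -> : t = 0 by lra.
    exact: HV.
  rewrite -natr1 => tk.
  have [td|td] := leP t d.
    have := H x 0 x t xb _ xb tT; rewrite subrr normr0 subr0 => /(_ ltac:(clear -tT; lra) ltac:(clear -tT td; lra)).
    rewrite ger0_norm; last lra.
    move=> /(_ td) h; have := HV x xb.
    have := ler_normD (v (x, t) - v (x, 0)) (v (x, 0)); rewrite subrK.
    have : 0 <= k%:R :> R by [].
    lra.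
  have h := H x (t - d) x t xb ltac:(lra) xb tT.
  have E : t - (t - d) = d by ring.
  move: h; rewrite subrr normr0 E (gtr0_norm d0) => /(_ ltac:(clear -d0; lra) ltac:(clear; lra)) h.
  have := IH x (t - d) xb ltac:(clear -d0 tT td; lra) ltac:(clear -tk; lra).
  have := ler_normD (v (x, t) - v (x, t - d)) (v (x, t - d)); rewrite subrK; clear -h; lra.
by move=> x t xb tT; apply: key => //; lra.
Qed.

(** A modulus of the form e + C r^2 can be absorbed by quadratic penalties. *)
Lemma contw2_quadratic a b T v : contw2 a b T v -> forall e, 0 < e -> exists2 C, 0 <= C &
  forall x t y s, a <= x <= b -> 0 <= t <= T -> a <= y <= b -> 0 <= s <= T ->
    `|v (y, s) - v (x, t)| <= e + C * ((y - x) ^+ 2 + (s - t) ^+ 2).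
Proof.
move=> cv e e0; have [d d0 H] := contw2_unif cv e0; have [V V0 HV] := contw2_bounded cv.
exists (2 * V / d ^+ 2); first by rewrite divr_ge0 ?mulr_ge0 ?exprn_ge0// ltW.
move=> x t y s xb tT yb sT.
have sq r : d < `|r| -> d ^+ 2 <= r ^+ 2.
  by move=> dr; rewrite -[r ^+ 2]real_normK ?num_real// ler_sqr ?nnegrE; clear -dr d0; lra.
have dd : 0 < d ^+ 2 by rewrite exprn_gt0.
have s1 : 0 <= (y - x) ^+ 2 by exact: sqr_ge0.
have s2 : 0 <= (s - t) ^+ 2 by exact: sqr_ge0.
have Q0 : 0 <= 2 * V / d ^+ 2 by rewrite divr_ge0// ?mulr_ge0// ltW.
have big : d ^+ 2 <= (y - x) ^+ 2 + (s - t) ^+ 2 ->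
    `|v (y, s) - v (x, t)| <= e + 2 * V / d ^+ 2 * ((y - x) ^+ 2 + (s - t) ^+ 2).
  move=> h; have : 2 * V / d ^+ 2 * d ^+ 2 <= 2 * V / d ^+ 2 * ((y - x) ^+ 2 + (s - t) ^+ 2).
    by rewrite ler_wpM2l.
  rewrite divfK ?gt_eqF//; have := ler_normB (v (y, s)) (v (x, t)).
  by have := HV _ _ xb tT; have := HV _ _ yb sT; clear -e0; lra.
have [yx|/sq yx] := leP (`|y - x|) d; last by apply: big; clear -s2 yx; lra.
have [st|/sq st] := leP (`|s - t|) d; last by apply: big; clear -s1 st; lra.
apply: le_trans (H x t y s xb tT yb sT yx st) _.
by rewrite lerDl mulr_ge0// addr_ge0.
Qed.

End Uniform.

(** * Integrable slopes near the ends *)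

Section Modulus.
Variable R : realType.

Lemma powR_contw0 (r : R) (c : R) : 0 < r -> contw 0 c (fun y => y `^ r).
Proof.
move=> r0 y yc e e0; have [->|y0] := eqVneq y 0.
  exists (e `^ r^-1); first exact: powR_gt0.
  move=> z zc; rewrite subr0 (powR0 (lt0r_neq0 r0)) subr0 ger0_norm; last lra.
  move=> ze; rewrite ger0_norm ?powR_ge0//.
  have -> : e = (e `^ r^-1) `^ r by rewrite -powRrM mulVf ?gt_eqF// powRr1// ltW.
  by apply: ge0_ler_powR => //; rewrite ?nnegrE ?powR_ge0//; lra.
have yp : 0 < y by rewrite lt_neqAle eq_sym y0; lra.
have y2 : 0 < y / 2 by lra.
have [|d d0 H] := derw_contw (@derw_powR R r (y / 2) (Num.max c y) y2) (x := y) _ e0.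
  by rewrite le_max lexx orbT; lra.
exists (Num.min d (y / 2)); first by rewrite lt_min d0.
move=> z zc; rewrite le_min => /andP[h1 h2]; apply: H => //.
by rewrite le_max; move: h2; rewrite ler_norml => h2; apply/andP; split; [lra|apply/orP; left; lra].
Qed.

(** With the decay of g, the bound G (p x) <= G N - c (b - x) forces
    p x = O ((b - x)^(-1/(alpha-1))). Because alpha > 2 this is integrable up to b,
    and Th is its primitive, the same for all N. *)
Lemma slope_modulus (b c alpha A s1 : R) : 0 < b -> 0 < c -> 2 < alpha -> 0 < s1 -> 0 < A ->
  exists2 Th : R -> R, contw (- b) b Th & forall (G g w p : R -> R) (N : R),
    (forall c d, derw c d G g) -> (forall s, 0 < g s) ->
    (forall s, s1 <= s -> g s <= A * s `^ (- alpha)) ->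
    derw (- b) b w p -> (forall x, - b <= x <= b -> p x <= N) ->
    (forall x, - b <= x <= b -> G (p x) <= G N - c * (b - x)) ->
    forall x y, - b <= x -> x <= y -> y <= b -> w y - w x <= Th y - Th x.
Proof.
move=> b0 c0 a2 s10 A0.
(* p <= s1 + E (b - x)^(-ga), and Th is a primitive of the right-hand side. *)
pose ga := (alpha - 1)^-1.
have ga0 : 0 < ga by rewrite invr_gt0; lra.
have ga1 : ga < 1 by rewrite invf_lt1; lra.
pose B := A / (alpha - 1) / c.
have B0 : 0 < B by rewrite !divr_gt0//; lra.
pose E := B `^ ga.
pose Th x := s1 * x - E / (1 - ga) * (b - x) `^ (1 - ga).
have cTh : contw (- b) b Th.
  have h1 : contw (- b) b (fun x => s1 * x + 0) by exact: derw_contw (derw_affine _ _).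
  have h2 : contw (- b) b (fun x => E / (1 - ga) * (b - x) `^ (1 - ga)).
    move=> x xb e e0.
    have K0 : 0 < `|E / (1 - ga)| + 1 by rewrite ltr_wpDl.
    have e1 : 0 < e / (`|E / (1 - ga)| + 1) by rewrite divr_gt0.
    have r0 : 0 < 1 - ga by lra.
    have [|d d0 H] := @powR_contw0 _ (2 * b) r0 (b - x) _ _ e1; first lra.
    exists d => // y yb yx; rewrite -mulrBr normrM.
    apply: le_trans (_ : (`|E / (1 - ga)| + 1) * (e / (`|E / (1 - ga)| + 1)) <= _).
      apply: ler_pM => //; first by rewrite lerDl.
      apply: H; first lra.
      have -> : b - y - (b - x) = - (y - x) by ring.
      by rewrite normrN.
    by rewrite mulrC divfK// gt_eqF.
  by have := contwD h1 (contwN h2); rewrite /Th; under eq_fun do rewrite addr0.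
exists Th => // G g w p N dG g0 gA dw pN hG.
have Ginc := primitive_incr dG g0.
have pbound x : - b <= x < b -> p x <= s1 + E * (b - x) `^ (- ga).
  move=> xb; have bx : 0 < b - x by lra.
  have [ps|sp] := leP (p x) s1.
    have : 0 <= E * (b - x) `^ (- ga) by rewrite mulr_ge0 ?powR_ge0.
    lra.
  have p0 : 0 < p x by lra.
  suff : p x <= E * (b - x) `^ (- ga) by lra.
  have xb' : - b <= x <= b by lra.
  have a1 : 1 < alpha by lra.
  have := tail_bound a1 s10 g0 dG gA (ltW sp) (pN x xb').
  have := hG x xb' => h1 h2.
  have h3 : c * (b - x) <= A / (alpha - 1) * p x `^ (1 - alpha) by lra.
  have am : 0 < alpha - 1 by lra.
  have h4 : p x `^ (alpha - 1) <= B / (b - x).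
    rewrite ler_pdivlMr// /B ler_pdivlMr//.
    have pp : 0 < p x `^ (alpha - 1) by exact: powR_gt0.
    have : p x `^ (alpha - 1) * (c * (b - x)) <= p x `^ (alpha - 1) * (A / (alpha - 1) * p x `^ (1 - alpha)).
      by rewrite ler_pM2l.
    have -> : 1 - alpha = - (alpha - 1) by ring.
    rewrite powRN [X in _ <= X]mulrCA divff ?gt_eqF// mulr1; clear; lra.
  have -> : p x = (p x `^ (alpha - 1)) `^ ga.
    by rewrite -powRrM /ga divff ?gt_eqF// powRr1// ltW.
  have -> : E * (b - x) `^ (- ga) = (B / (b - x)) `^ ga.
    rewrite /E powRM ?invr_ge0; try lra.
    by congr (_ * _); rewrite -powR_inv1 ?ltW// -powRrM mulN1r.
  apply: ge0_ler_powR => //; rewrite ?nnegrE ?powR_ge0 ?divr_ge0//; clear -ga0 A0 am c0 xb'; lra.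
have mod_in x y : - b <= x -> x <= y -> y < b -> w y - w x <= Th y - Th x.
  move=> bx xy yb.
  have by0 : 0 < b - y by lra.
  have dTh : derw x y Th (fun z => s1 + E * (b - z) `^ (- ga)).
    apply: is_derive_derw => z zxy.
    have bz : 0 < b - z by lra.
    have d1 : is_derive z (1 : R) (fun x => b - x) (- 1).
      by apply: is_derive_eq; rewrite add0r mul1r.
    have d2 := is_derive1_powR (1 - ga) bz.
    have d3 := @is_derive1_comp R (fun u => u `^ (1 - ga)) (fun x => b - x) z _ _ d2 d1.
    rewrite /Th.
    apply: is_derive_eq.
    rewrite /GRing.scale/=.
    have -> : 1 - ga - 1 = - ga by ring.
    field; clear -ga1; lra.
  have dd := derwB dTh (derw_sub (c := x) (d := y) bx (ltW yb) dw).
  have := derw_incr dd (lexx x) xy (lexx y) => H.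
  suff : Th x - w x <= Th y - w y by clear; lra.
  by apply: H => z zxy; have := pbound z; lra.
move=> x y bx xy; rewrite le_eqVlt => /predU1P[yb|]; last exact: mod_in.
move: xy; rewrite le_eqVlt => /predU1P[->|xy]; first by rewrite !subrr.
have bb : - b <= y <= b by lra.
(* The derivative of Th is infinite at b: the case y = b is reached by continuity. *)
apply/ler_addgt0Pr => e e0; have e2 : 0 < e / 2 by lra.
have [d1 d10 H1] := derw_contw dw bb e2; have [d2 d20 H2] := cTh y bb _ e2.
pose z := y - Num.min (y - x) (Num.min d1 d2) / 2.
have m0 : 0 < Num.min (y - x) (Num.min d1 d2) by rewrite !lt_min d10 d20; clear -xy; lra.
have [m1 m2 m3] : [/\ Num.min (y - x) (Num.min d1 d2) <= y - x,
    Num.min (y - x) (Num.min d1 d2) <= d1 & Num.min (y - x) (Num.min d1 d2) <= d2].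
  by split; rewrite !ge_min lexx ?orbT.
have zb : - b <= z <= b by rewrite /z; clear -bx yb m0 m1; lra.
have zy : `|z - y| = y - z by rewrite ler0_norm /z; clear -m0; lra.
have := H1 z zb; have := H2 z zb; rewrite zy !ler_norml /z => /(_ ltac:(clear -d20 m3; lra)) h2 /(_ ltac:(clear -m0 m2; lra)) h1.
have := mod_in x z bx ltac:(rewrite /z; clear -m0 m1; lra) ltac:(rewrite /z; clear -yb m0; lra); rewrite /z; clear -h2 h1; lra.
Qed.
End Modulus.

(** * Implicit Euler schemes with steep ends *)

Section Scheme.
Variable R : realType.

(** Implicit Euler steps of length tau with slopes - N and N at the ends; p and m
    are the first and second space derivatives of w. The last condition bounds
    the speed at the start, and hence at all times. *)
Definition scheme (b : R) (f g : R -> R) (tau N L : R) (w p m : nat -> R -> R) : Prop :=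
  [/\ forall i, derw (- b) b (w i) (p i), forall i, derw (- b) b (p i) (m i),
      forall i, p i (- b) = - N /\ p i b = N,
      forall i x, - b <= x <= b ->
        f (g (p i.+1 x) * m i.+1 x) = (w i.+1 x - w i x) / tau &
      forall x, - b <= x <= b -> `|f (g (p 0%N x) * m 0%N x)| <= L].

(** Equal slopes at the ends make the derivative of w - z vanish at a maximum
    wherever it lies, so the second order condition holds there. *)
Lemma neumann_max (b : R) (w p m z q n : R -> R) : 0 < b ->
  derw (- b) b w p -> derw (- b) b p m -> derw (- b) b z q -> derw (- b) b q n ->
  p (- b) = q (- b) -> p b = q b ->
  exists2 x0, - b <= x0 <= b & [/\ p x0 = q x0, m x0 <= n x0 &
    forall x, - b <= x <= b -> w x - z x <= w x0 - z x0].
Proof.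
move=> b0 dw dp dz dq em ep.
have bb : - b <= b by lra.
have d1 := derwB dw dz; have d2 := derwB dp dq.
have [x0 xb H] := contw_max bb (derw_contw d1); exists x0 => //.
have pq : p x0 - q x0 = 0.
  have [->|n1] := eqVneq x0 b; first by rewrite ep subrr.
  have [->|n2] := eqVneq x0 (- b); first by rewrite em subrr.
  apply: (derw_max_eq0 d1 _ ltr01); last by move=> y yb _; exact: H.
  by rewrite !lt_neqAle n1 eq_sym n2.
have mn : m x0 - n x0 <= 0.
  apply: (derw_max_second _ d1 d2 xb pq ltr01); first lra.
  by move=> y yb _; exact: H.
by split=> //; lra.
Qed.

Lemma neumann_step (b tau L : R) (f g w p m h h' h2 : R -> R) : 0 < b -> 0 < tau ->
  {homo f : x y / x < y} -> (forall s, 0 < g s) ->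
  derw (- b) b w p -> derw (- b) b p m -> derw (- b) b h h' -> derw (- b) b h' h2 ->
  p (- b) = h' (- b) -> p b = h' b ->
  (forall x, - b <= x <= b -> f (g (p x) * m x) = (w x - h x) / tau) ->
  (forall x, - b <= x <= b -> `|f (g (h' x) * h2 x)| <= L) ->
  forall x, - b <= x <= b -> `|w x - h x| <= tau * L.
Proof.
move=> b0 t0 /homo_lt_le fi g0 dw dp dh dh' em ep E HL x xb.
have [x1 x1b [pq1 mn1 H1]] := neumann_max b0 dw dp dh dh' em ep.
have [x2 x2b [pq2 mn2 H2]] := neumann_max b0 dh dh' dw dp (esym em) (esym ep).
have le1 : (w x1 - h x1) / tau <= L.
  rewrite -E//; apply: le_trans (_ : f (g (h' x1) * h2 x1) <= _).
    by apply: fi; rewrite pq1 ler_pM2l.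
  by apply: le_trans (ler_norm _) (HL x1 x1b).
have le2 : - L <= (w x2 - h x2) / tau.
  rewrite -E//; apply: le_trans (_ : f (g (h' x2) * h2 x2) <= _).
    by have := HL x2 x2b; rewrite ler_norml => /andP[].
  by apply: fi; rewrite pq2 ler_pM2l.
move: le1 le2; rewrite ler_pdivrMr// ler_pdivlMr// => le1 le2.
have := H1 x xb; have := H2 x xb; rewrite ler_norml; lra.
Qed.

(** One step moves w by at most tau times the initial speed, by the maximum
    principle; the equation turns this into a bound on the next speed. *)
Lemma scheme_bound (b : R) (f g : R -> R) (tau N L : R) (w p m : nat -> R -> R) :
  0 < b -> 0 < tau -> {homo f : x y / x < y} -> (forall s, 0 < g s) ->
  scheme b f g tau N L w p m ->
  forall i x, - b <= x <= b -> `|f (g (p i x) * m i x)| <= L /\ `|w i.+1 x - w i x| <= tau * L.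
Proof.
move=> b0 t0 fi g0 [dw dp bc E HL].
have step i : (forall x, - b <= x <= b -> `|f (g (p i x) * m i x)| <= L) ->
    forall x, - b <= x <= b -> `|w i.+1 x - w i x| <= tau * L.
  have [e1 e2] := bc i; have [e3 e4] := bc i.+1.
  move=> Hi; apply: (neumann_step b0 t0 fi g0 (dw _) (dp _) (dw i) (dp i) _ _ (E i) Hi).
    by rewrite e1 e3.
  by rewrite e2 e4.
have all i : forall x, - b <= x <= b -> `|f (g (p i x) * m i x)| <= L.
  elim: i => [|i IH] x xb; first exact: HL.
  rewrite E// normrM (@gtr0_norm _ tau^-1) ?invr_gt0// ler_pdivrMr// mulrC.
  exact: step.
by move=> i x xb; split; [exact: all|exact: (step i (all i))].
Qed.

Lemma scheme_drift (b : R) (f g : R -> R) (tau N L : R) (w p m : nat -> R -> R) :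
  0 < b -> 0 < tau -> {homo f : x y / x < y} -> (forall s, 0 < g s) ->
  scheme b f g tau N L w p m ->
  forall i j x, - b <= x <= b -> `|w j x - w i x| <= L * `|j%:R * tau - i%:R * tau|.
Proof.
move=> b0 t0 fi g0 S.
have H i k x : - b <= x <= b -> `|w (k + i)%N x - w i x| <= L * (k%:R * tau).
  move=> xb; elim: k => [|k IH]; first by rewrite add0n subrr normr0 mul0r mulr0.
  have [_ h] := scheme_bound b0 t0 fi g0 S (k + i)%N xb.
  rewrite addSn.
  have -> : w (k + i).+1 x - w i x = (w (k + i).+1 x - w (k + i)%N x) + (w (k + i)%N x - w i x) by ring.
  apply: le_trans (ler_normD _ _) _; rewrite -natr1; lra.
move=> i j x xb; wlog ij : i j / (i <= j)%N.
  move=> K; have [/K//|/ltnW/K] := leqP i j; by rewrite distrC (distrC (i%:R * _)).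
have := H i (j - i)%N x xb; rewrite subnK// natrB// mulrBl.
by rewrite (@ger0_norm _ (j%:R * tau - i%:R * tau))// subr_ge0 ler_pM2r// ler_nat.
Qed.

(** Steklov means (1/d) * int_x^(x+d) u0. *)
Lemma smoothing (b : R) (u0 : R -> R) (e : R) : 0 < b -> contw (- b) b u0 -> 0 < e ->
  exists (P P' : R -> R) (C : R), [/\ derw (- b) b P P', contw (- b) b P', 0 <= C,
    (forall x, - b <= x <= b -> - C <= P' x <= C) &
    forall x, - b <= x <= b -> `|P x - u0 x| <= e].
Proof.
move=> bp cu e0.
have [d d0 Hd] := contw_unif cu e0; have [V V0 HV] := contw_bounded cu.
pose U x := u0 (clamp b x).
have cU : continuous U by apply: contw_clamp => //; exact: ltW.
have [Phi dPhi] := primitive cU.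
have Ubnd x : `|U x| <= V by apply: HV; exact: clampP (ltW bp).
exists (fun x => d^-1 * (Phi (x + d) - Phi x)), (fun x => d^-1 * (U (x + d) - U x)), (d^-1 * (2 * V)).
have shift : derw (- b) b (fun x => Phi (x + d)) (fun x => U (x + d)).
  move=> x xb r r0; have [|q q0 H] := dPhi (- b + d) (b + d) (x + d) _ _ r0; first lra.
  exists q => // y yb yx; have E : y + d - (x + d) = y - x by ring.
  by have := H (y + d); rewrite E; apply=> //; lra.
have di : 0 < d^-1 by rewrite invr_gt0.
split.
- by apply: derwZ; apply: derwB.
- apply: continuous_contw; apply/continuous_epsP => x r r0.
  have r1 : 0 < r * d / 2 by rewrite divr_gt0// mulr_gt0.
  move/continuous_epsP : (cU) => cU'.
  have [q1 q10 H1] := cU' x _ r1; have [q2 q20 H2] := cU' (x + d) _ r1.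
  exists (Num.min q1 q2); first by rewrite lt_min q10.
  move=> y; rewrite le_min => /andP[h1 h2].
  have -> : d^-1 * (U (y + d) - U y) - d^-1 * (U (x + d) - U x) =
    d^-1 * ((U (y + d) - U (x + d)) - (U y - U x)) by ring.
  rewrite normrM (gtr0_norm di) ler_pdivrMl//.
  apply: le_trans (ler_normB _ _) _; have := H1 y h1.
  have := H2 (y + d); have -> : y + d - (x + d) = y - x by ring.
  move=> /(_ h2); lra.
- by rewrite mulr_ge0 ?(ltW di)// mulr_ge0.
- move=> x xb; rewrite -ler_norml normrM (gtr0_norm di) ler_pM2l//.
  apply: le_trans (ler_normB _ _) _; have := Ubnd x; have := Ubnd (x + d); lra.
- move=> x xb; have xd : x < x + d by lra.
  have [c cx ->] := derw_mvt (dPhi x (x + d)) (lexx x) xd (lexx _).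
  have -> : d^-1 * (U c * (x + d - x)) = U c by field; lra.
  rewrite /U; apply: Hd => //; first exact: clampP (ltW bp).
  rewrite -[X in _ - X](clamp_id xb); apply: le_trans (clamp_lip _ _ _) _.
  rewrite ger0_norm; lra.
Qed.

Lemma derw_opp_reflect (g G : R -> R) : (forall c d, derw c d G g) ->
  forall c d, derw c d (fun s => - G (- s)) (fun s => g (- s)).
Proof.
move=> dG c d; have := derwN (derw_reflect (dG (- d) (- c))); rewrite !opprK.
by apply: derw_ext => // x _; rewrite opprK.
Qed.

Lemma total_variation (g G : R -> R) (alpha A s1 : R) : (forall s, 0 < g s) -> 2 < alpha ->
  0 < s1 -> 0 < A -> (forall s, s1 <= s -> g s <= A * s `^ (- alpha)) ->
  (forall s, s1 <= s -> g (- s) <= A * s `^ (- alpha)) -> (forall c d, derw c d G g) ->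
  exists2 Gt, 0 < Gt & forall N, s1 <= N -> G N - G (- N) <= Gt.
Proof.
move=> g_gt0 ap s1p Ap tailp tailm dG.
have a1 : 1 < alpha by lra.
pose B := A / (alpha - 1) * s1 `^ (1 - alpha).
have B0 : 0 < B by rewrite mulr_gt0 ?powR_gt0// divr_gt0//; lra.
have Ginc := primitive_incr dG g_gt0.
exists (2 * B + (G s1 - G (- s1))).
  have := Ginc (- s1) s1; lra.
move=> N sN.
have h1 := tail_bound a1 s1p g_gt0 dG tailp (lexx s1) sN.
have h2 := tail_bound a1 s1p (fun s => g_gt0 (- s)) (derw_opp_reflect dG) tailm (lexx s1) sN.
rewrite -/B in h1 h2; lra.
Qed.

End Scheme.

(** * Equicontinuous families of schemes *)

Section Family.
Variables (R : realType) (b : R) (f g k : R -> R) (alpha A s1 : R).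
Hypotheses (b_gt0 : 0 < b) (f_incr : {homo f : x y / x < y}) (kc : continuous k)
  (kf : cancel k f) (fk : cancel f k) (ki : {homo k : x y / x < y}) (k0 : k 0 = 0)
  (g_cont : continuous g) (g_gt0 : forall s, 0 < g s) (a2 : 2 < alpha) (s1_gt0 : 0 < s1)
  (A_gt0 : 0 < A)
  (tailp : forall s, s1 <= s -> g s <= A * s `^ (- alpha))
  (tailm : forall s, s1 <= s -> g (- s) <= A * s `^ (- alpha)).

(** The slope bounds that the steps preserve, anchored at the slopes - N and N of
    the two ends. *)
Definition barrier (G : R -> R) (N c : R) (q : R -> R) : Prop :=
  forall x, - b <= x <= b ->
    - N <= q x <= N /\ G (- N) + c * (b + x) <= G (q x) <= G N - c * (b - x).

(** One time level of a scheme: z.1.1 is the profile, z.1.2 and z.2 are its first and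
    second derivatives. *)
Definition slice (G : R -> R) (N c : R) (z : (R -> R) * (R -> R) * (R -> R)) : Prop :=
  [/\ derw (- b) b z.1.1 z.1.2, derw (- b) b z.1.2 z.2,
      z.1.2 (- b) = - N /\ z.1.2 b = N & barrier G N c z.1.2].

Lemma slice_resolvent (G : R -> R) (N c tau : R) (h h' : R -> R) :
  (forall c d, derw c d G g) -> 0 < tau -> 0 < N -> G (- N) <= G N - c * (2 * b) ->
  derw (- b) b h h' -> contw (- b) b h' -> barrier G N c h' ->
  exists2 z, slice G N c z & forall x, - b <= x <= b ->
    f (g (z.1.2 x) * z.2 x) = (z.1.1 x - h x) / tau.
Proof.
move=> dG t0 N0 GN dh ch' bh.
have hN x : - b <= x <= b -> - N <= h' x <= N by move=> /bh[].
have [w [p [m [dw dp [pm pp] pN E]]]] :=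
  resolvent b_gt0 t0 N0 kc kf fk ki k0 g_cont g_gt0 dh ch' hN.
exists (w, p, m) => //; split=> //= x xb; split; first exact: pN.
have up := slope_upper b_gt0 t0 f_incr dG g_gt0 dw dp dh ch' pm pp E GN.
have lo := slope_lower b_gt0 t0 f_incr dG g_gt0 dw dp dh ch' pm pp E GN.
apply/andP; split.
  by apply: lo => // y /bh[_ /andP[]].
by apply: up => // y /bh[_ /andP[]].
Qed.

(** The upper barrier controls increments of the profile from above, the
    reflected lower barrier from below; both moduli depend on c only, and not on N
    or on the step. *)
Lemma slice_modulus (c : R) : 0 < c -> exists dl : R -> R,
  (forall r, 0 < r -> 0 < dl r) /\
  forall G N z, (forall c d, derw c d G g) -> slice G N c z ->
    forall r x y, 0 < r -> - b <= x <= b -> - b <= y <= b -> `|x - y| <= dl r ->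
      `|z.1.1 x - z.1.1 y| <= r.
Proof.
move=> c0; have bp := b_gt0.
have [T1 cT1 H1] := slope_modulus b_gt0 c0 a2 s1_gt0 A_gt0.
have /choice[dl Hdl] : forall r : R, exists d : R, 0 < r -> 0 < d /\
    forall x y, - b <= x <= b -> - b <= y <= b -> `|y - x| <= d -> `|T1 y - T1 x| <= r.
  move=> r; have [r0|r0] := ltP 0 r; last by exists 1; lra.
  by have [d d0 H] := contw_unif cT1 r0; exists d.
exists dl; split; first by move=> r /Hdl[].
move=> G N [[w p] m] dG [/= dw dp _ bar].
have up x y : - b <= x -> x <= y -> y <= b -> w y - w x <= T1 y - T1 x.
  apply: (H1 G g w p N) => // z /bar[]; [by move/andP=> []|by move=> _ /andP[]].
have lo x y : - b <= x -> x <= y -> y <= b -> w x - w y <= T1 (- x) - T1 (- y).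
  move=> bx xy yb.
  have := H1 (fun s => - G (- s)) (fun s => g (- s)) (fun x => w (- x)) (fun x => - p (- x)) N
    (derw_opp_reflect dG) (fun s => g_gt0 (- s)) tailm (derw_reflect_sym dw).
  move=> H; have := H _ _ (- y) (- x); rewrite !opprK; apply; try lra.
    move=> z zb; have [] := bar (- z); first lra.
    lra.
  move=> z zb; rewrite opprK; have [] := bar (- z); first lra.
  lra.
move=> r x y r0 xb yb.
have [_ Hr] := Hdl r r0.
have key u v : - b <= u <= b -> - b <= v <= b -> u <= v -> `|u - v| <= dl r -> `|w u - w v| <= r.
  move=> ub vb uv d; have h1 := Hr u v ub vb; rewrite distrC in h1; have {}h1 := h1 d.
  have h2 := Hr (- v) (- u) ltac:(lra) ltac:(lra).
  have E : - u - - v = - (u - v) by ring.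
  rewrite E normrN in h2; have {}h2 := h2 d.
  have := up u v ltac:(lra) uv ltac:(lra); have := lo u v ltac:(lra) uv ltac:(lra).
  move: h1 h2; rewrite !ler_norml; lra.
have [xy|/ltW yx] := leP x y; first exact: key.
by rewrite distrC (distrC (w x)); exact: key.
Qed.

Lemma iterate_slices (G : R -> R) (N c tau : R) (z0 : (R -> R) * (R -> R) * (R -> R)) :
  (forall c d, derw c d G g) -> 0 < tau -> 0 < N -> G (- N) <= G N - c * (2 * b) ->
  slice G N c z0 -> exists z : nat -> (R -> R) * (R -> R) * (R -> R),
    [/\ z 0%N = z0, forall i, slice G N c (z i) & forall i x, - b <= x <= b ->
      f (g ((z i.+1).1.2 x) * (z i.+1).2 x) = ((z i.+1).1.1 x - (z i).1.1 x) / tau].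
Proof.
move=> dG t0 N0 GN z0I.
have /choice[nxt Hn] : forall z, exists z', slice G N c z -> slice G N c z' /\
    forall x, - b <= x <= b -> f (g (z'.1.2 x) * z'.2 x) = (z'.1.1 x - z.1.1 x) / tau.
  move=> z; have [[dw dp bc bar]|nz] := pselect (slice G N c z); last by exists z.
  have [z' z'I E] := slice_resolvent dG t0 N0 GN
    dw (derw_contw dp) bar.
  by exists z'.
exists (fun i => iter i nxt z0).
have zI i : slice G N c (iter i nxt z0) by elim: i => //= i /Hn[].
by split => // i; have [_] := Hn _ (zI i).
Qed.

End Family.

(** The scheme starts at one step, of a small fixed length eps, from a smooth
    approximation P of u0. This gives the first profile the slopes - N and N at the
    ends together with a finite speed. The constant c is chosen so that P
    satisfies the barrier bounds for all large N. *)
Theorem scheme_family (R : realType) (b : R) (f g k u0 : R -> R) (alpha A s1 e : R)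
    (b_gt0 : 0 < b) (f_incr : {homo f : x y / x < y}) (kc : continuous k)
    (kf : cancel k f) (fk : cancel f k) (ki : {homo k : x y / x < y}) (k0 : k 0 = 0)
    (g_cont : continuous g) (g_gt0 : forall s, 0 < g s) (a2 : 2 < alpha) (s1_gt0 : 0 < s1)
    (A_gt0 : 0 < A)
    (tailp : forall s, s1 <= s -> g s <= A * s `^ (- alpha))
    (tailm : forall s, s1 <= s -> g (- s) <= A * s `^ (- alpha)) :
  contw (- b) b u0 -> 0 < e ->
  exists (L Ns : R) (dl : R -> R), [/\ 0 <= L, 0 < Ns, (forall r, 0 < r -> 0 < dl r) &
    forall N tau, Ns <= N -> 0 < tau -> exists w p m : nat -> R -> R,
      [/\ scheme b f g tau N L w p m,
          forall x, - b <= x <= b -> `|w 0%N x - u0 x| <= e &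
          forall i r x y, 0 < r -> - b <= x <= b -> - b <= y <= b -> `|x - y| <= dl r ->
            `|w i x - w i y| <= r]].
Proof.
move=> cu e0.
have e2 : 0 < e / 2 by lra.
have [P [P' [C [dP cP' C0 PC Pu]]]] := smoothing b_gt0 cu e2.
have [G dG] := primitive g_cont.
have Ginc := primitive_incr dG g_gt0.
have Gle := homo_lt_le Ginc.
have [Gt Gt0 HGt] := total_variation g_gt0 a2 s1_gt0 A_gt0 tailp tailm dG.
pose c := Num.min (G (C + 1) - G C) (G (- C) - G (- C - 1)) / (2 * b).
have c0 : 0 < c.
  by rewrite divr_gt0 ?mulr_gt0// lt_min !subr_gt0; apply/andP; split; apply: Ginc; lra.
have [cp cm] : c * (2 * b) <= G (C + 1) - G C /\ c * (2 * b) <= G (- C) - G (- C - 1).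
  by rewrite /c divfK ?gt_eqF ?mulr_gt0// !ge_min !lexx orbT.
have [dl [dl0 Hdl]] := slice_modulus b_gt0 g_gt0 a2 s1_gt0 A_gt0 tailp tailm c0.
pose r := e / 8; have r0 : 0 < r by rewrite /r; lra.
pose d := Num.min b (Num.min (dl r) (r / (C + 1))).
have d0 : 0 < d by rewrite !lt_min b_gt0 dl0// divr_gt0//; lra.
have [db ddl dC] : [/\ d <= b, d <= dl r & d * (C + 1) <= r].
  rewrite -ler_pdivlMr; last lra.
  by rewrite /d; split; rewrite !ge_min lexx ?orbT.
pose F := `|f (Gt / d)| + `|f (- (Gt / d))|.
have F0 : 0 <= F by rewrite addr_ge0.
pose eps := e / (4 * (F + 1)).
have eps0 : 0 < eps by rewrite divr_gt0// mulr_gt0//; clear -F0; lra.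
exists (e / 2 / eps), (Num.max (C + 1) s1), dl; split => //.
- by rewrite divr_ge0// ltW.
- by rewrite lt_max s1_gt0 orbT.
move=> N tau; rewrite ge_max => /andP[CN sN] t0.
have N0 : 0 < N by clear -C0 CN; lra.
have GC1 : G (C + 1) <= G N by apply: Gle.
have GC2 : G (- N) <= G (- C - 1) by apply: Gle; clear -CN; lra.
have GCC : G (- C) <= G C by apply: Gle; clear -C0; lra.
have cb : 0 < c * (2 * b) by rewrite mulr_gt0// mulr_gt0.
have GN : G (- N) <= G N - c * (2 * b) by clear -cp cm GC1 GC2 GCC cb; lra.
have bar : barrier b G N c P'.
  move=> x xb; have /andP[h1 h2] := PC x xb; split; first (clear -CN h1 h2; lra).
  have := Gle _ _ h1; have := Gle _ _ h2 => h3 h4.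
  have h5 : c * (b + x) <= c * (2 * b) by rewrite ler_pM2l//; clear -xb; lra.
  have h6 : c * (b - x) <= c * (2 * b) by rewrite ler_pM2l//; clear -xb; lra.
  clear -cp cm GC1 GC2 h3 h4 h5 h6; lra.
have [z0 z0I z0E] := slice_resolvent b_gt0 f_incr kc kf fk ki k0 g_cont g_gt0 dG eps0 N0 GN dP cP' bar.
have [z [zE zI zS]] := iterate_slices b_gt0 f_incr kc kf fk ki k0 g_cont g_gt0 dG t0 N0 GN z0I.
(* Near every x there is a point y at which g (p) p' is the mean slope of
   G (p) over an interval of length d, hence at most Gt / d; the equation then
   makes w - P at y at most eps F. Equicontinuity leads back to x. *)
have close x : - b <= x <= b -> `|z0.1.1 x - P x| <= e / 2.
  move=> xb; have [dw dp _ bar0] := z0I.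
  have dq := derw_comp dp dG.
  have [y [yb yd H]] : exists y, [/\ - b <= y <= b, `|y - x| <= d &
      `|g (z0.1.2 y) * z0.2 y| <= Gt / d].
    have Gbnd s t : - b <= s <= b -> - b <= t <= b -> `|G (z0.1.2 t) - G (z0.1.2 s)| <= Gt.
      move=> /bar0[/andP[p1 p2] _] /bar0[/andP[p3 p4] _].
      have := HGt N sN; rewrite ler_norml.
      by have := Gle _ _ p1; have := Gle _ _ p2; have := Gle _ _ p3; have := Gle _ _ p4; clear; lra.
    have mid s : - b <= s -> s + d <= b -> exists2 y, s < y < s + d &
        `|g (z0.1.2 y) * z0.2 y| <= Gt / d.
      move=> bs sd; have [||y yy E] := derw_mvt dq bs (y := s + d); [clear -d0; lra|clear -sd; lra|].
      exists y => //; rewrite ler_pdivlMr//.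
      have := Gbnd s (s + d) ltac:(clear -bs sd yy; lra) ltac:(clear -bs sd yy; lra); rewrite E.
      by rewrite addrAC subrr add0r normrM (gtr0_norm d0).
    have [x0|x0] := leP x 0.
      have [||y yy H] := mid x; [clear -xb; lra|clear -db x0; lra|]; exists y; split => //; first (clear -db xb x0 yy; lra).
      rewrite ger0_norm; clear -yy; lra.
    have [||y yy H] := mid (x - d); [clear -db x0; lra|clear -xb; lra|]; exists y; split => //; first (clear -db xb x0 yy; lra).
    rewrite ler0_norm; clear -yy; lra.
  have h1 : `|z0.1.1 y - P y| <= eps * F.
    have : `|(z0.1.1 y - P y) / eps| <= F.
      rewrite -z0E//; move: H; rewrite ler_norml => /andP[l1 l2].
      have := homo_lt_le f_incr l1; have := homo_lt_le f_incr l2; rewrite /F ler_norml.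
      have := ler_norm (f (Gt / d)); have := ler_norm (- f (- (Gt / d))); rewrite normrN.
      by have := normr_ge0 (f (Gt / d)); have := normr_ge0 (f (- (Gt / d))); clear; lra.
    by rewrite normrM (@gtr0_norm _ eps^-1) ?invr_gt0// ler_pdivrMr// mulrC.
  have h2 : `|z0.1.1 x - z0.1.1 y| <= r.
    by apply: (Hdl G N z0 dG z0I) => //; rewrite distrC; clear -ddl yd; lra.
  have h3 : `|P y - P x| <= r.
    have H' s t : - b <= s -> s < t -> t <= b -> t - s <= d -> `|P t - P s| <= r.
      move=> bs st tb sd; have [q qq ->] := derw_mvt dP bs st tb.
      rewrite normrM (@gtr0_norm _ (t - s)); last (clear -qq; lra).
      have : `|P' q| <= C by rewrite ler_norml; apply: PC; clear -bs tb qq; lra.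
      have := normr_ge0 (P' q); nra.
    move: yd; have [yx|xy|->] := ltgtP y x.
    - by rewrite ltr0_norm ?subr_lt0// distrC => yd; apply: H'; clear -yb yx xb yd; lra.
    - by rewrite gtr0_norm ?subr_gt0// => yd; apply: H'; clear -xb xy yb yd; lra.
    - by rewrite !subrr normr0 (ltW r0).
  have epsF : eps * F <= e / 4.
    rewrite /eps mulrAC ler_pdivrMr; last (clear -F0; lra).
    clear -e0; lra.
  have -> : z0.1.1 x - P x = (z0.1.1 x - z0.1.1 y) + (z0.1.1 y - P y) + (P y - P x) by ring.
  apply: le_trans (ler_normD _ _) _.
  have := ler_normD (z0.1.1 x - z0.1.1 y) (z0.1.1 y - P y).
  rewrite /r in h2 h3; clear -h1 epsF h2 h3; lra.
exists (fun i => (z i).1.1), (fun i => (z i).1.2), (fun i => (z i).2); split.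
- split=> [i|i|i|i x xb|x xb]; try by have [] := zI i.
    exact: zS.
  rewrite zE z0E// normrM (@gtr0_norm _ eps^-1) ?invr_gt0// ler_pM2r ?invr_gt0//.
  exact: close.
- move=> x xb; rewrite zE.
  have -> : z0.1.1 x - u0 x = (z0.1.1 x - P x) + (P x - u0 x) by ring.
  by apply: le_trans (ler_normD _ _) _; have := close x xb; have := Pu x xb; clear; lra.
- by move=> i; exact: (Hdl G N (z i) dG (zI i)).
Qed.

(** * Asymptotic homogeneity of the diffusion coefficient *)

Section Ratio.
Variable R : realType.

Lemma tail_pinfty (g : R -> R) (alpha C : R) : `|s| `^ alpha * g s @[s --> +oo] --> C ->
  forall e, 0 < e -> exists2 M, 1 <= M & forall s, M <= s -> `|s `^ alpha * g s - C| <= e.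
Proof.
move=> /cvgrPdist_le H e e0; have [M [_ HM]] := H e e0.
exists (Num.max 1 (M + 1)); first by rewrite le_max lexx.
move=> s; rewrite ge_max => /andP[s1 sM]; have := HM s ltac:(lra) => /=.
by rewrite distrC (@ger0_norm _ s)//; lra.
Qed.

Lemma tail_ninfty (g : R -> R) (alpha C : R) : `|s| `^ alpha * g s @[s --> -oo] --> C ->
  forall e, 0 < e -> exists2 M, 1 <= M & forall s, M <= s -> `|s `^ alpha * g (- s) - C| <= e.
Proof.
move=> /cvgrPdist_le H e e0; have [M [_ HM]] := H e e0.
exists (Num.max 1 (- M + 1)); first by rewrite le_max lexx.
move=> s; rewrite ge_max => /andP[s1 sM]; have := HM (- s) ltac:(lra) => /=.
by rewrite distrC normrN (@ger0_norm _ s)//; lra.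
Qed.

Lemma tail_upper (g : R -> R) (alpha C s : R) : 1 <= s ->
  `|s `^ alpha * g s - C| <= 1 -> g s <= (C + 1) * s `^ (- alpha).
Proof.
move=> s1; have sp : 0 < s `^ alpha by apply: powR_gt0; lra.
by rewrite powRN ler_norml ler_pdivlMr// mulrC; lra.
Qed.

(** For large s the ratio mu^2 g (mu s) / g s is close to mu^(2 - alpha). *)
Lemma ratio_tail (g : R -> R) (alpha C : R) : 2 < alpha -> 0 < C -> (forall s, 0 < g s) ->
  (forall e, 0 < e -> exists2 M, 1 <= M & forall s, M <= s -> `|s `^ alpha * g s - C| <= e) ->
  forall rho, 0 < rho -> exists M d, [/\ 1 <= M, 0 < d & forall s mu, M <= s ->
    1 <= mu <= 1 + d -> `|mu ^+ 2 * g (mu * s) - g s| <= rho * g s].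
Proof.
move=> a2 C0 g0 H rho rho0.
pose e := Num.min (1 / 2) (Num.min (C / 2) (rho * C / (2 * (3 + C)))).
have e0 : 0 < e by rewrite !lt_min !divr_gt0 ?mulr_gt0//; lra.
have [e1 e2 e3] : [/\ e <= 1 / 2, e <= C / 2 & e * (2 * (3 + C)) <= rho * C].
  rewrite -ler_pdivlMr; last lra.
  by rewrite /e; split; rewrite !ge_min lexx ?orbT.
have [M M1 HM] := H e e0.
have h2 : 0 < 1 / 2 :> R by lra.
have [|d d0 Hd] := derw_contw (@derw_powR R (2 - alpha) (1 / 2) 2 h2) (x := 1) _ e0; first lra.
exists M, (Num.min d 1); split => //; first by rewrite lt_min d0 ltr01.
move=> s mu Ms /andP[mu1]; rewrite -lerBlDl le_min => /andP[mud mu2].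
have s0 : 0 < s by clear -M1 Ms; lra.
have mu0 : 0 < mu by clear -mu1; lra.
have mus : M <= mu * s by nra.
have a1 := HM s Ms; have a3 := HM _ mus.
set A1 := s `^ alpha * g s in a1; set A2 := (mu * s) `^ alpha * g (mu * s) in a3.
have sp : 0 < s `^ alpha by exact: powR_gt0.
set th := mu `^ (2 - alpha).
have th1 : th <= 1.
  rewrite -(powRr0 mu); apply: ler_powR => //; clear -a2; lra.
have th2 : 1 - e <= th.
  have := Hd mu ltac:(clear -mu1 mu2; lra); rewrite ger0_norm; last (clear -mu1; lra).
  by move=> /(_ mud); rewrite powR1 ler_norml -/th; clear; lra.
have E : mu ^+ 2 * g (mu * s) * s `^ alpha = th * A2.
  rewrite /th /A2 powRM; [|clear -mu0; lra|clear -s0; lra].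
  rewrite powRD; last by apply/implyP => _; rewrite gt_eqF.
  rewrite powR_mulrn; last (clear -mu0; lra).
  rewrite powRN; field; rewrite gt_eqF//; exact: powR_gt0.
rewrite -(ler_pM2r sp) -[X in _ * X <= _](gtr0_norm sp) -normrM mulrBl E -mulrA (mulrC (g s)) -/A1.
have Ap : C / 2 <= A1 by move: a1; rewrite ler_norml; clear -e2; lra.
have A2p : A2 <= C + e by move: a3; rewrite ler_norml; clear; lra.
have A2n : 0 < A2 by rewrite mulr_gt0 ?powR_gt0// mulr_gt0.
have -> : th * A2 - A1 = (A2 - A1) - (1 - th) * A2 by ring.
apply: le_trans (ler_normB _ _) _; rewrite (@ger0_norm _ ((1 - th) * A2)); last first.
  by rewrite mulr_ge0//; clear -th1 A2n; lra.
have : (1 - th) * A2 <= e * (C + 1) by apply: ler_pM; clear -th1 A2n th2 e1 A2p; lra.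
have : `|A2 - A1| <= 2 * e.
  by move: a1 a3; rewrite !ler_norml; clear; lra.
have : rho * (C / 2) <= rho * A1 by rewrite ler_pM2l.
clear -e3; lra.
Qed.

Lemma ratio_compact (g : R -> R) (M : R) : continuous g -> (forall s, 0 < g s) -> 1 <= M ->
  forall rho, 0 < rho -> exists2 d, 0 < d & forall s mu, - M <= s <= M ->
    1 <= mu <= 1 + d -> `|mu ^+ 2 * g (mu * s) - g s| <= rho * g s.
Proof.
move=> cg g0 M1 rho rho0.
have MM : - M <= M by lra.
have [x0 _ gm] := contw_max MM (contwN (continuous_contw (a := - M) (b := M) cg)).
have g1 := g0 x0.
have e0 : 0 < rho * g x0 / 8 by rewrite divr_gt0// mulr_gt0.
have [r r0 Hr] := contw_unif (continuous_contw (a := - (2 * M)) (b := 2 * M) cg) e0.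
pose d := Num.min 1 (Num.min (rho / 6) (r / M)).
have d0 : 0 < d by rewrite !lt_min ltr01 !divr_gt0//; lra.
have [d1 d2 d3] : [/\ d <= 1, d <= rho / 6 & d * M <= r].
  rewrite -ler_pdivlMr; last lra.
  by rewrite /d; split; rewrite !ge_min lexx ?orbT.
exists d => // s mu sM mud.
have hg : `|g (mu * s) - g s| <= rho * g x0 / 8.
  have sn : `|s| <= M by rewrite ler_norml.
  have hh : `|mu * s - s| <= d * M.
    have -> : mu * s - s = (mu - 1) * s by ring.
    by rewrite normrM; apply: ler_pM => //; rewrite ger0_norm; clear -mud; lra.
  have hM : d * M <= M by rewrite -{2}(mul1r M) ler_pM2r; clear -d1 M1; lra.
  apply: Hr; [clear -sM; lra| |clear -d3 hh; lra].
  by have := hh; rewrite ler_norml; lra.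
have gs : g x0 <= g s by have := gm s sM; lra.
have -> : mu ^+ 2 * g (mu * s) - g s = mu ^+ 2 * (g (mu * s) - g s) + (mu ^+ 2 - 1) * g s by ring.
apply: le_trans (ler_normD _ _) _.
have m2 : 1 <= mu ^+ 2 <= 1 + 3 * d by apply/andP; split; nra.
have gp := g0 s.
rewrite (normrM (mu ^+ 2)) (normrM (mu ^+ 2 - 1)) (@ger0_norm _ (mu ^+ 2)) ?sqr_ge0// (@ger0_norm _ (mu ^+ 2 - 1)); last (clear -m2; lra).
rewrite (gtr0_norm gp).
have : mu ^+ 2 * `|g (mu * s) - g s| <= 4 * (rho * g x0 / 8).
  by apply: ler_pM => //; [exact: sqr_ge0|clear -d1 m2; lra].
have : (mu ^+ 2 - 1) * g s <= rho / 2 * g s by rewrite ler_pM2r//; clear -d2 m2; lra.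
have : rho * g x0 <= rho * g s by rewrite ler_pM2l.
clear; lra.
Qed.

(** Dilating the space variable multiplies slopes by mu and second derivatives by
    mu^2. Asymptotic homogeneity of g makes the effect on the operator small
    uniformly in the slope s, however large. *)
Lemma operator_ratio (f g : R -> R) (alpha Cp Cm : R) : continuous f ->
  continuous g -> (forall s, 0 < g s) ->
  2 < alpha -> 0 < Cp -> 0 < Cm ->
  `|s| `^ alpha * g s @[s --> +oo] --> Cp -> `|s| `^ alpha * g s @[s --> -oo] --> Cm ->
  forall S kap, 0 <= S -> 0 < kap -> exists2 d, 0 < d & forall mu s m, 1 <= mu <= 1 + d ->
    `|g s * m| <= S -> `|f (g (mu * s) * (mu ^+ 2 * m)) - f (g s * m)| <= kap.
Proof.
move=> cf cg g0 a2 Cp0 Cm0 gp gm S kap S0 kap0.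
have [r r0 Hr] := contw_unif (continuous_contw (a := - (2 * S)) (b := 2 * S) cf) kap0.
pose rho := Num.min 1 (r / (S + 1)).
have rho0 : 0 < rho by rewrite lt_min ltr01 divr_gt0//; lra.
have [rho1 rhoS] : rho <= 1 /\ rho * (S + 1) <= r.
  rewrite -ler_pdivlMr; last lra.
  by rewrite /rho !ge_min !lexx orbT.
have [M1 [d1 [M11 d10 H1]]] := ratio_tail a2 Cp0 g0 (tail_pinfty gp) rho0.
have [M2 [d2 [M21 d20 H2]]] := ratio_tail a2 Cm0 (fun s => g0 (- s)) (tail_ninfty gm) rho0.
have M3 : 1 <= Num.max M1 M2 by rewrite le_max M11.
have [d3 d30 H3] := ratio_compact cg g0 M3 rho0.
exists (Num.min d1 (Num.min d2 d3)); first by rewrite !lt_min d10 d20.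
move=> mu s m /andP[mu1]; rewrite -lerBlDl !le_min => /and3P[md1 md2 md3] gmS.
have key : `|mu ^+ 2 * g (mu * s) - g s| <= rho * g s.
  have [s1|s1] := leP M1 s; first by apply: H1 => //; clear -mu1 md1; lra.
  have [s2|s2] := leP M2 (- s).
    by have := H2 (- s) mu s2; rewrite mulrN !opprK; apply; clear -mu1 md2; lra.
  apply: H3; last (clear -mu1 md3; lra).
  rewrite le_max.
  have : M1 <= Num.max M1 M2 by rewrite le_max lexx.
  have : M2 <= Num.max M1 M2 by rewrite le_max lexx orbT.
  move=> h1 h2; apply/andP; split; [clear -s2 h1; lra|apply/orP; left; clear -s1; lra].
have E : g (mu * s) * (mu ^+ 2 * m) = g s * m + (mu ^+ 2 * g (mu * s) - g s) * m by ring.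
have D : `|(mu ^+ 2 * g (mu * s) - g s) * m| <= rho * S.
  rewrite normrM; apply: le_trans (_ : rho * g s * `|m| <= _); first by rewrite ler_wpM2r.
  rewrite -mulrA ler_pM2l//.
  by move: gmS; rewrite normrM (gtr0_norm (g0 s)).
have D2 : rho * S <= S by rewrite -{2}(mul1r S) ler_wpM2r.
apply: Hr; rewrite ?E.
- by move: gmS; rewrite ler_norml; clear; lra.
- by move: gmS D; rewrite !ler_norml; clear -D2; lra.
- rewrite addrAC subrr add0r; nra.
Qed.

End Ratio.

(** * Test functions on the half-strip *)

Section TestFunctions.
Variable R : realType.
Implicit Types (A : set (R * R)) (h u phi : R * R -> R) (p q : R * R) (b : R).

Lemma nbhs2P p (P : set (R * R)) : nbhs p P <->
  exists2 d, 0 < d & forall q, `|q.1 - p.1| <= d -> `|q.2 - p.2| <= d -> P q.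
Proof.
split=> [/nbhs_ballP[r /= r0 H]|[d d0 H]].
  exists (r / 2); first lra.
  move=> q h1 h2; apply: H; split; rewrite /ball/= distrC; lra.
apply/nbhs_ballP; exists d => //= q [/= h1 h2].
by apply: H; rewrite distrC ltW.
Qed.

Lemma within2P A h : {within A, continuous h} <-> forall p, A p -> forall e, 0 < e ->
  exists2 d, 0 < d & forall q, A q -> `|q.1 - p.1| <= d -> `|q.2 - p.2| <= d ->
    `|h q - h p| <= e.
Proof.
split=> [/subspace_continuousP H p Ap e e0|H].
  have /cvgrPdist_le/(_ e e0) := H p Ap; rewrite near_withinE => /nbhs2P[d d0 K].
  by exists d => // q Aq h1 h2; rewrite distrC; apply: K.
apply/subspace_continuousP => p Ap; apply/cvgrPdist_le => e e0.
rewrite near_withinE; have [d d0 K] := H p Ap e e0.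
by apply/nbhs2P; exists d => // q h1 h2 Aq; rewrite distrC; apply: K.
Qed.

Lemma local_min_onP A h p : local_min_on A h p <-> exists2 d, 0 < d & forall q, A q ->
  `|q.1 - p.1| <= d -> `|q.2 - p.2| <= d -> h p <= h q.
Proof.
rewrite /local_min_on near_withinE; split=> [/nbhs2P[d d0 H]|[d d0 H]].
  by exists d => // q Aq h1 h2; apply: H.
by apply/nbhs2P; exists d => // q h1 h2 Aq; apply: H.
Qed.

Lemma local_max_onP A h p : local_max_on A h p <-> exists2 d, 0 < d & forall q, A q ->
  `|q.1 - p.1| <= d -> `|q.2 - p.2| <= d -> h q <= h p.
Proof.
rewrite /local_max_on near_withinE; split=> [/nbhs2P[d d0 H]|[d d0 H]].
  by exists d => // q Aq h1 h2; apply: H.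
by apply/nbhs2P; exists d => // q h1 h2 Aq; apply: H.
Qed.

Lemma chalfstripE b (x t : R) : chalfstrip b (x, t) <-> (- b <= x <= b) /\ 0 <= t.
Proof. by rewrite /chalfstrip /= !in_itv/= andbT. Qed.

Lemma halfstripE b (x t : R) : halfstrip b (x, t) <-> (- b < x < b) /\ 0 < t.
Proof. by rewrite /halfstrip /= !in_itv/= andbT. Qed.

Lemma chalfstrip_contw2 b v T : {within chalfstrip b, continuous v} -> contw2 (- b) b T v.
Proof.
move=> /within2P H x t xb tT e e0.
have [|d d0 K] := H (x, t) _ e e0; first by apply/chalfstripE; split => //; lra.
exists d => // y s yb sT yx st; apply: (K (y, s)) => //; apply/chalfstripE; split => //; lra.
Qed.

Lemma is_derive_quad phi p v (d c : R) :
  (forall r : R, phi (r *: v + p) = phi p + r * d + r ^+ 2 * c) -> is_derive p v phi d.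
Proof.
move=> H.
have K : r^-1 *: ((phi \o shift p) (r *: v) - phi p) @[r --> (0 : R)^'] --> d.
  apply/cvgrPdist_le => e e0; apply/nbhs_ballP.
  exists (e / (`|c| + 1)); first by rewrite /= divr_gt0// ltr_wpDl.
  move=> r; rewrite /ball/= sub0r normrN ltr_pdivlMr ?ltr_wpDl// => rc r0.
  rewrite H /GRing.scale/=.
  have -> : d - r^-1 * (phi p + r * d + r ^+ 2 * c - phi p) = - (r * c) by field.
  by rewrite normrN normrM; have := normr_ge0 r; lra.
apply: DeriveDef; first by apply/cvg_ex; exists d.
exact/cvg_lim.
Qed.

(** Quadratic polynomials suffice as test functions for comparison. *)
Definition quadratic (a1 a2 c1 c2 x0 t0 : R) (z : R * R) : R :=
  a1 * (z.1 - x0) + a2 * (z.1 - x0) ^+ 2 + c1 * (z.2 - t0) + c2 * (z.2 - t0) ^+ 2.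

Lemma quadratic_derive_x a1 a2 c1 c2 x0 t0 p : is_derive p dir_x (quadratic a1 a2 c1 c2 x0 t0)
  (a1 + 2 * a2 * (p.1 - x0)).
Proof.
apply: (@is_derive_quad _ _ _ _ a2) => r; rewrite /quadratic /= /GRing.scale/= mulr1 mulr0 add0r.
ring.
Qed.

Lemma quadratic_derive_t a1 a2 c1 c2 x0 t0 p : is_derive p dir_t (quadratic a1 a2 c1 c2 x0 t0)
  (c1 + 2 * c2 * (p.2 - t0)).
Proof.
apply: (@is_derive_quad _ _ _ _ c2) => r; rewrite /quadratic /= /GRing.scale/= mulr1 mulr0 add0r.
ring.
Qed.

Lemma quadratic_derivable a1 a2 c1 c2 x0 t0 p w : w = dir_x \/ w = dir_t ->
  derivable (quadratic a1 a2 c1 c2 x0 t0) p w.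
Proof.
case=> ->; first exact: (@ex_derive _ _ _ _ _ _ _ (quadratic_derive_x _ _ _ _ _ _ _)).
exact: (@ex_derive _ _ _ _ _ _ _ (quadratic_derive_t _ _ _ _ _ _ _)).
Qed.

Lemma quadratic_continuous a1 a2 c1 c2 x0 t0 : continuous (quadratic a1 a2 c1 c2 x0 t0).
Proof.
move=> z; rewrite /quadratic.
have c1' : z'.1 - x0 @[z' --> z] --> z.1 - x0 by apply: cvgB; [exact: cvg_fst|exact: cvg_cst].
have c2' : z'.2 - t0 @[z' --> z] --> z.2 - t0 by apply: cvgB; [exact: cvg_snd|exact: cvg_cst].
by apply: cvgD; [apply: cvgD; [apply: cvgD|]|]; apply: cvgM; try exact: cvg_cst; try exact: cvgM.
Qed.

Lemma quadratic_D a1 a2 c1 c2 x0 t0 :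
  'D_dir_x (quadratic a1 a2 c1 c2 x0 t0) = (fun z => quadratic (2 * a2) 0 0 0 x0 t0 z + a1) /\
  'D_dir_t (quadratic a1 a2 c1 c2 x0 t0) = (fun z => quadratic 0 0 (2 * c2) 0 x0 t0 z + c1).
Proof.
split; apply/funext => z.
  by rewrite (@derive_val _ _ _ _ _ _ _ (quadratic_derive_x _ _ _ _ _ _ _)) /quadratic; ring.
by rewrite (@derive_val _ _ _ _ _ _ _ (quadratic_derive_t _ _ _ _ _ _ _)) /quadratic; ring.
Qed.

Lemma continuous_extends A B h : continuous h -> extends_continuously A B h.
Proof. by move=> ch; exists h => //; exact: continuous_subspaceT. Qed.

Lemma affine_derive (k : R) a1 a2 c1 c2 x0 t0 p w (F := fun z => quadratic a1 a2 c1 c2 x0 t0 z + k) :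
  w = dir_x \/ w = dir_t -> derivable F p w /\ 'D_w F p = 'D_w (quadratic a1 a2 c1 c2 x0 t0) p.
Proof.
move=> wE; have dq : derivable (quadratic a1 a2 c1 c2 x0 t0) p w.
  exact: quadratic_derivable.
have dk : derivable (cst k : R * R -> R) p w by exact: derivable_cst.
split; first exact: (derivableD dq dk).
have -> : F = quadratic a1 a2 c1 c2 x0 t0 + cst k by [].
by rewrite deriveD// derive_cst addr0.
Qed.

Lemma quadratic_C2 a1 a2 c1 c2 x0 t0 b : C2_chalfstrip b (quadratic a1 a2 c1 c2 x0 t0).
Proof.
have cq := quadratic_continuous.
split; first by apply: continuous_subspaceT; exact: cq.
have [Dx Dt] := quadratic_D a1 a2 c1 c2 x0 t0.
have caff k a1' a2' c1' c2' : continuous (fun z => quadratic a1' a2' c1' c2' x0 t0 z + k).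
  by move=> z; apply: cvgD; [exact: cq|exact: cvg_cst].
have D2 k a1' a2' c1' c2' w : w = dir_x \/ w = dir_t ->
   continuous ('D_w (fun z => quadratic a1' a2' c1' c2' x0 t0 z + k)).
  move=> wE.
  have -> : 'D_w (fun z => quadratic a1' a2' c1' c2' x0 t0 z + k) = 'D_w (quadratic a1' a2' c1' c2' x0 t0).
    by apply/funext => z; have [_] := @affine_derive k a1' a2' c1' c2' x0 t0 z w wE.
  have [Ex Et] := quadratic_D a1' a2' c1' c2' x0 t0.
  by case: wE => ->; rewrite ?Ex ?Et; exact: caff.
move=> v [->|->]; split.
- by move=> p _; apply: quadratic_derivable; left.
- by apply: continuous_extends; rewrite Dx; exact: caff.
- move=> w wE; rewrite Dx; split; last by apply: continuous_extends; exact: D2.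
  by move=> p _; have [] := @affine_derive a1 (2 * a2) 0 0 0 x0 t0 p w wE.
- by move=> p _; apply: quadratic_derivable; right.
- by apply: continuous_extends; rewrite Dt; exact: caff.
- move=> w wE; rewrite Dt; split; last by apply: continuous_extends; exact: D2.
  by move=> p _; have [] := @affine_derive c1 0 0 (2 * c2) 0 x0 t0 p w wE.
Qed.

Lemma quadratic_pde f g a1 a2 c1 c2 x0 t0 :
  pde_operator f g (quadratic a1 a2 c1 c2 x0 t0) (x0, t0) = c1 - f (g a1 * (2 * a2)).
Proof.
rewrite /pde_operator.
have [Dx _] := quadratic_D a1 a2 c1 c2 x0 t0; rewrite Dx.
have [_ ->] := @affine_derive a1 (2 * a2) 0 0 0 x0 t0 (x0, t0) dir_x (or_introl erefl).
rewrite !(@derive_val _ _ _ _ _ _ _ (quadratic_derive_x _ _ _ _ _ _ _)).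
rewrite (@derive_val _ _ _ _ _ _ _ (quadratic_derive_t _ _ _ _ _ _ _)) /= !subrr.
by congr (_ - f (g _ * _)); ring.
Qed.

Lemma derw_slice_x phi (a c t : R) : (forall x, a <= x <= c -> derivable phi (x, t) dir_x) ->
  derw a c (fun x => phi (x, t)) (fun x => 'D_dir_x phi (x, t)).
Proof.
move=> H; apply: is_derive_derw => x xac; have := H x xac => dphi.
have E (r : R) : (phi \o shift (x, t)) (r *: dir_x) = ((fun x => phi (x, t)) \o shift x) (r *: (1 : R)).
  rewrite /=; congr phi; apply/pair_equal_spec; split; first by [].
  by rewrite /= /GRing.scale/= mulr0 add0r.
have EE : (fun r : R => r^-1 *: ((phi \o shift (x, t)) (r *: dir_x) - phi (x, t))) =
  (fun r => r^-1 *: (((fun x => phi (x, t)) \o shift x) (r *: (1 : R)) - phi (x, t))).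
  by apply/funext => r; rewrite E.
apply: DeriveDef.
  by move: dphi; rewrite /derivable EE.
by rewrite /derive EE.
Qed.

Lemma derw_slice_t phi (a c x : R) : (forall t, a <= t <= c -> derivable phi (x, t) dir_t) ->
  derw a c (fun t => phi (x, t)) (fun t => 'D_dir_t phi (x, t)).
Proof.
move=> H; apply: is_derive_derw => t tac; have := H t tac => dphi.
have E (r : R) : (phi \o shift (x, t)) (r *: dir_t) = ((fun t => phi (x, t)) \o shift t) (r *: (1 : R)).
  rewrite /=; congr phi; apply/pair_equal_spec; split; last by [].
  by rewrite /= /GRing.scale/= mulr0 add0r.
have EE : (fun r : R => r^-1 *: ((phi \o shift (x, t)) (r *: dir_t) - phi (x, t))) =
  (fun r => r^-1 *: (((fun t => phi (x, t)) \o shift t) (r *: (1 : R)) - phi (x, t))).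
  by apply/funext => r; rewrite E.
apply: DeriveDef.
  by move: dphi; rewrite /derivable EE.
by rewrite /derive EE.
Qed.

End TestFunctions.

(** * Doubling the time variable *)

Section CompactMax.
Variable R : realType.

Lemma contw3_max (b T : R) (F : R -> R -> R -> R) : 0 <= b -> 0 <= T ->
  (forall x y t, - b <= x <= b -> - b <= y <= b -> 0 <= t <= T -> forall e, 0 < e ->
    exists2 d, 0 < d & forall x' y' t', - b <= x' <= b -> - b <= y' <= b -> 0 <= t' <= T ->
      `|x' - x| <= d -> `|y' - y| <= d -> `|t' - t| <= d -> `|F x' y' t' - F x y t| <= e) ->
  exists x y t, [/\ - b <= x <= b, - b <= y <= b, 0 <= t <= T &
    forall x' y' t', - b <= x' <= b -> - b <= y' <= b -> 0 <= t' <= T -> F x' y' t' <= F x y t].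
Proof.
move=> b0 T0 cF.
pose A : set (R * R * R) := `[- b, b]%classic `*` `[- b, b]%classic `*` `[0, T]%classic.
have AE x y t : A (x, y, t) <-> [/\ - b <= x <= b, - b <= y <= b & 0 <= t <= T].
  by rewrite /A/= !in_itv/=; split=> [[[]]|[]].
have cA : compact A by do ![apply: compact_setX]; exact: segment_compact.
have A0 : A !=set0 by exists (0, 0, 0); apply/AE; split; lra.
have cG : {within A, continuous (fun z : R * R * R => F z.1.1 z.1.2 z.2)}.
  apply/subspace_continuousP => -[[x y] t] /AE[xb yb tT]; apply/cvgrPdist_le => e e0.
  rewrite near_withinE; have [d d0 H] := cF x y t xb yb tT e e0.
  apply/nbhs_ballP; exists d => // -[[x' y'] t'] [[/= h1 h2] h3] /AE[xb' yb' tT'].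
  by rewrite distrC; apply: H => //; rewrite distrC ltW.
have [[[x y] t] /[!inE]/AE[xb yb tT] H] := compact_EVT_max A0 cA cG.
exists x, y, t; split => // x' y' t' xb' yb' tT'.
by apply: (H (x', y', t')); rewrite inE; apply/AE.
Qed.

Lemma finite_argmax (n : nat) (M : nat -> R) : exists2 i, (i <= n)%N &
  forall j, (j <= n)%N -> M j <= M i.
Proof.
elim: n => [|n [i ni H]]; first by exists 0%N => // j; rewrite leqn0 => /eqP->.
have [h|h] := leP (M n.+1) (M i).
  by exists i; [exact: leqW|move=> j; rewrite leq_eqVlt => /predU1P[->//|]; rewrite ltnS; exact: H].
exists n.+1 => // j; rewrite leq_eqVlt => /predU1P[->//|]; rewrite ltnS => /H hj.
exact: le_trans hj (ltW h).
Qed.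

(** The doubled functions below depend on a time level i and on points x, y and a
    time t. *)
Lemma family_max (b T : R) (n : nat) (F : nat -> R -> R -> R -> R) : 0 <= b -> 0 <= T ->
  (forall i x y t, - b <= x <= b -> - b <= y <= b -> 0 <= t <= T -> forall e, 0 < e ->
    exists2 d, 0 < d & forall x' y' t', - b <= x' <= b -> - b <= y' <= b -> 0 <= t' <= T ->
      `|x' - x| <= d -> `|y' - y| <= d -> `|t' - t| <= d -> `|F i x' y' t' - F i x y t| <= e) ->
  exists i x y t, [/\ (i <= n)%N, - b <= x <= b, - b <= y <= b, 0 <= t <= T &
    forall j x' y' t', (j <= n)%N -> - b <= x' <= b -> - b <= y' <= b -> 0 <= t' <= T ->
      F j x' y' t' <= F i x y t].
Proof.
move=> b0 T0 cF.
have /choice[z Hz] : forall i, exists z : R * R * R, [/\ - b <= z.1.1 <= b, - b <= z.1.2 <= b,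
    0 <= z.2 <= T & forall x' y' t', - b <= x' <= b -> - b <= y' <= b -> 0 <= t' <= T ->
    F i x' y' t' <= F i z.1.1 z.1.2 z.2].
  move=> i; have [x [y [t H]]] := contw3_max b0 T0 (cF i); by exists (x, y, t).
have [i ni Hi] := finite_argmax n (fun i => F i (z i).1.1 (z i).1.2 (z i).2).
have [h1 h2 h3 _] := Hz i.
exists i, (z i).1.1, (z i).1.2, (z i).2; split => // j x' y' t' jn xb yb tT.
by apply: le_trans (Hi j jn); have [_ _ _] := Hz j; apply.
Qed.

Lemma continuous_limit_le (f : R -> R) (a c r : R) : continuous f ->
  (forall eta, 0 < eta -> f (a + eta * c) <= r) -> f a <= r.
Proof.
move=> /continuous_epsP cf H; apply/ler_addgt0Pr => e e0.
have [d d0 Hd] := cf a e e0.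
have c1 : 0 < `|c| + 1 by rewrite ltr_wpDl.
have eta0 : 0 < d / (`|c| + 1) by rewrite divr_gt0.
have := H _ eta0; have := Hd (a + d / (`|c| + 1) * c); rewrite addrAC subrr add0r.
have h : `|d / (`|c| + 1) * c| <= d.
  rewrite normrM (gtr0_norm eta0) mulrAC ler_pdivrMr// ler_pM2l// lerDl//.
by move=> /(_ h); rewrite ler_norml; lra.
Qed.

Lemma continuous_limit_ge (f : R -> R) (a c r : R) : continuous f ->
  (forall eta, 0 < eta -> r <= f (a + eta * c)) -> r <= f a.
Proof.
move=> cf H; rewrite -lerN2.
apply: (@continuous_limit_le (fun x => - f x) a c).
  by move=> x; apply: cvgN; exact: cf.
by move=> eta /H; rewrite lerN2.
Qed.

End CompactMax.

Section Doubling.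
Variable R : realType.

(** Penalty on the distance between the time t and the time level i * tau. For
    th = 0 its t-derivative 2 C (t - i tau) is its difference quotient
    (Y_(i-1) - Y_i) / tau, so that doubling costs nothing in the equation. *)
Definition gauge (e C tau th : R) (i : nat) (t : R) : R :=
  2 * e + C * ((t - i%:R * tau) ^+ 2 + i%:R * tau * tau) + th * t.

Lemma gauge_taylor e C tau th i s t : gauge e C tau th i t - gauge e C tau th i s =
  (2 * C * (s - i%:R * tau) + th) * (t - s) + C * (t - s) ^+ 2.
Proof. by rewrite /gauge; ring. Qed.

Lemma gauge_step e C tau th i t :
  gauge e C tau th i t - gauge e C tau th i.+1 t = 2 * C * (t - i.+1%:R * tau) * tau.
Proof. by rewrite /gauge -natr1; ring. Qed.

Lemma gauge_continuous e C tau th i : continuous (gauge e C tau th i).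
Proof.
apply/continuous_epsP => x r r0.
have := derw_contw (D := fun t => 2 * C * (t - i%:R * tau) + th) (F := gauge e C tau th i)
  (a := x - 1) (b := x + 1) _ (x := x).
have dg : derw (x - 1) (x + 1) (gauge e C tau th i) (fun t => 2 * C * (t - i%:R * tau) + th).
  move=> s sx q q0; exists (q / (`|C| + 1)); first by rewrite divr_gt0// ltr_wpDl.
  move=> t tx; rewrite ler_pdivlMr ?ltr_wpDl// => ts.
  rewrite gauge_taylor addrAC subrr add0r expr2 mulrA normrM ler_wpM2r// normrM.
  have := normr_ge0 (t - s); nra.
move=> /(_ dg) H; have [|d d0 Hd] := H _ r r0; first lra.
exists (Num.min d 1); first by rewrite lt_min d0 ltr01.
move=> y; rewrite le_min => /andP[yd y1]; apply: Hd => //.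
by move: y1; rewrite ler_norml; lra.
Qed.

(** At a positive maximum of w_i x - v (x, t) - Y_i t the supersolution v is
    touched from below by the Taylor polynomial of w_i minus the gauge, hence not at
    an end of the interval. The supersolution inequality and the equation of the
    step i give w_i - w_(i-1) < Y_i - Y_(i-1), which contradicts maximality
    against the level i - 1. *)
Lemma scheme_below (b : R) (f g : R -> R) (tau N L T e C th : R) (n : nat)
    (w p m : nat -> R -> R) (v : R * R -> R)
    (b0 : 0 < b) (fc : continuous f) (f_incr : {homo f : x y / x < y})
    (g0 : forall s, 0 < g s) (t0 : 0 < tau) (sch : scheme b f g tau N L w p m)
    (vc : {within chalfstrip b, continuous v}) (T_def : n%:R * tau = T)
    (e0 : 0 <= e) (C0 : 0 <= C) (th0 : 0 < th)
    (H1 : forall s, 0 <= s -> L * s <= e + C * s ^+ 2) :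
  viscosity_supersolution b f g v ->
  (forall x t, - b <= x <= b -> 0 <= t <= T + 1 -> w 0%N x - v (x, t) <= e + C * t ^+ 2) ->
  (forall i x, (i <= n)%N -> - b <= x <= b -> w i x - v (x, T + 1) <= C) ->
  forall x, - b <= x <= b -> w n x - v (x, T) <= 2 * e + C * (T * tau) + th * T.
Proof.
move=> [_ vint vbd] H0 H2.
have [dw dp bc E HL] := sch.
have T0 : 0 <= T by rewrite -T_def mulr_ge0// ltW.
have T1 : 0 <= T + 1 by lra.
have iT i : (i <= n)%N -> 0 <= i%:R * tau <= T.
  by move=> ni; rewrite mulr_ge0 ?(ltW t0)//= -T_def ler_pM2r// ler_nat.
pose Y := gauge e C tau th.
(* The second space variable is a dummy. *)
pose F i (x y t : R) := w i x - v (x, t) - Y i t.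
move=> x1 x1b; rewrite leNgt; apply/negP => bad.
have [|i [y [y' [s [ni yb yb' sT Fmax]]]]] := @family_max R b (T + 1) n F (ltW b0) T1.
  move=> i x y t xb _ tT r r0; have r3 : 0 < r / 3 by lra.
  have [d1 d10 h1] := derw_contw (dw i) xb r3.
  have [d2 d20 h2] := chalfstrip_contw2 (T := T + 1) vc xb tT r3.
  have [d3 d30 h3] := (continuous_epsP _).1 (@gauge_continuous e C tau th i) t _ r3.
  exists (Num.min d1 (Num.min d2 d3)); first by rewrite !lt_min d10 d20.
  move=> x' z t' xb' _ tT'; rewrite !le_min => /and3P[a1 a2 a3] _ /and3P[c1 c2 c3].
  have := h1 x' xb' a1; have := h2 x' t' xb' tT' a2 c2; have := h3 t' c3.
  by rewrite /F /Y !ler_norml; clear; lra.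
have Fpos : 0 < F i y y' s.
  apply: lt_le_trans (Fmax n x1 x1 T (leqnn n) x1b x1b _); last (clear -T0; lra).
  rewrite /F /Y /gauge T_def subrr expr0n/= add0r; clear -bad; lra.
have sT' : 0 <= C * (i%:R * tau * tau) by rewrite !mulr_ge0// ltW.
have sq0 : 0 <= C * (s - i%:R * tau) ^+ 2 by rewrite mulr_ge0// sqr_ge0.
have ths : 0 <= th * s by rewrite mulr_ge0//; clear -th0 sT; lra.
(* The gauge dominates at the level 0 and at the times 0 and T + 1. *)
case: i ni Fmax Fpos sT' sq0 => [|i] ni Fmax Fpos sT' sq0.
  have := H0 y s yb sT; move: Fpos sq0; rewrite /F /Y /gauge mul0r !subr0 mul0r addr0; clear -e0 ths; lra.
have s_gt0 : 0 < s.
  rewrite lt_neqAle eq_sym; apply/andP; split; last (clear -sT; lra).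
  apply/eqP => s00; move: Fpos sT'; rewrite /F /Y /gauge s00 sub0r sqrrN mulr0 addr0 mulrDr.
  have := scheme_drift b0 t0 f_incr g0 sch 0 i.+1 yb.
  have /andP[i0 _] := iT _ ni.
  rewrite mul0r subr0 (ger0_norm i0); have := H1 _ i0; have := H0 y 0 yb ltac:(clear -sT; lra).
  rewrite expr0n/= mulr0 ler_norml; clear; lra.
have s_ltT : s < T + 1.
  rewrite lt_neqAle; apply/andP; split; last (clear -sT; lra).
  apply/eqP => sE; have /andP[i0 iiT] := iT _ ni.
  have h1 : 1 <= (T + 1 - i.+1%:R * tau) ^+ 2 by rewrite expr_ge1//; clear -iiT; lra.
  have h2 : C <= C * (T + 1 - i.+1%:R * tau) ^+ 2 by rewrite ler_peMr.
  have := H2 _ y ni yb; move: Fpos sT' ths; rewrite /F /Y /gauge sE mulrDr; clear -e0 h2; lra.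
pose c1 := - (2 * C * (s - i.+1%:R * tau) + th).
(* eta makes the Taylor polynomial of w_i an exact bound. *)
have touch eta : 0 < eta -> local_min_on (chalfstrip b)
    (fun q => v q - quadratic (p i.+1 y) (m i.+1 y / 2 - eta) c1 (- C) y s q) (y, s).
  move=> eta0; have [d d0 Hd] := derw_taylor2 (dw i.+1) (dp i.+1) yb eta0.
  apply/local_min_onP; exists (Num.min d (Num.min s (T + 1 - s))).
    by rewrite !lt_min d0 s_gt0 subr_gt0 s_ltT.
  move=> [x t] /chalfstripE[xb tp'] /=; rewrite !le_min => /andP[xd _] /and3P[_ ts tT].
  have tT' : 0 <= t <= T + 1 by move: ts tT; rewrite !ler_norml; clear; lra.
  have := Fmax i.+1 x x t ni xb xb tT'; have := Hd x xb xd; rewrite /F /Y ler_norml.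
  have := gauge_taylor e C tau th i.+1 s t.
  rewrite /quadratic /c1 /= !subrr expr0n/= !mulr0; clear; lra.
have y_in : - b < y < b.
  have [yE|n1] := eqVneq y b.
    have [h _] := vbd _ s (quadratic_C2 (p i.+1 y) (m i.+1 y / 2 - 1) c1 (- C) y s b) s_gt0.
    have bs : (b, s) = (y, s) by rewrite yE.
    by exfalso; apply: h; rewrite bs; exact: touch.
  have [yE|n2] := eqVneq y (- b).
    have [_ h] := vbd _ s (quadratic_C2 (p i.+1 y) (m i.+1 y / 2 - 1) c1 (- C) y s b) s_gt0.
    have bs : (- b, s) = (y, s) by rewrite yE.
    by exfalso; apply: h; rewrite bs; exact: touch.
  by rewrite !lt_neqAle n1 eq_sym n2; clear -yb; lra.
have ys : halfstrip b (y, s) by apply/halfstripE.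
have key : f (g (p i.+1 y) * m i.+1 y) <= c1.
  apply: (continuous_limit_le (c := - (2 * g (p i.+1 y)))) => // eta eta0.
  have := vint _ _ (quadratic_C2 (p i.+1 y) (m i.+1 y / 2 - eta) c1 (- C) y s b) ys (touch eta eta0).
  have -> : g (p i.+1 y) * m i.+1 y + eta * - (2 * g (p i.+1 y)) =
    g (p i.+1 y) * (2 * (m i.+1 y / 2 - eta)) by field.
  by rewrite quadratic_pde subr_ge0.
move: key; rewrite E// ler_pdivrMr// => key.
have := Fmax i y y' s (ltnW ni) yb yb' sT; have := gauge_step e C tau th i s.
rewrite /F /Y; have := mulr_gt0 th0 t0; move: key; rewrite /c1; clear; lra.
Qed.

End Doubling.

(** A subsolution v is unconstrained at the ends, so v (x, t) is compared with
    w_i y for x near lam * y, where lam < 1. This keeps x inside, and y cannot be an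
    end, where the slope N of w_i exceeds that of the penalty. Moving y along with x
    tests v by the dilated profile w_i (x / lam), which solves the equation up to the
    error kap. *)
Lemma scheme_above (R : realType) (b : R) (f g : R -> R) (tau N L T e C th : R) (n : nat)
    (w p m : nat -> R -> R) (v : R * R -> R) (K V lam kap : R)
    (b0 : 0 < b) (fc : continuous f) (f_incr : {homo f : x y / x < y})
    (g0 : forall s, 0 < g s) (t0 : 0 < tau) (sch : scheme b f g tau N L w p m)
    (vc : {within chalfstrip b, continuous v}) (T_def : n%:R * tau = T)
    (e0 : 0 <= e) (C0 : 0 <= C) (th0 : 0 < th)
    (H1 : forall s, 0 <= s -> L * s <= e + C * s ^+ 2)
    (K0 : 0 < K) (lam0 : 0 < lam) (lam1 : lam < 1)
    (Vb : forall x t, - b <= x <= b -> 0 <= t <= T + 1 -> `|v (x, t)| <= V)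
    (HK : 2 * V < K * ((1 - lam) * b) ^+ 2) (HN : 4 * K * b < N) (kapth : kap < th)
    (Hop : forall s r, `|f (g s * r)| <= L ->
      f (g (s / lam) * (r / lam ^+ 2)) <= f (g s * r) + kap) :
  viscosity_subsolution b f g v ->
  (forall x t y, - b <= x <= b -> 0 <= t <= T + 1 -> - b <= y <= b ->
     v (x, t) - w 0%N y <= e + C * t ^+ 2 + K * (x - lam * y) ^+ 2) ->
  (forall i x y, (i <= n)%N -> - b <= x <= b -> - b <= y <= b -> v (x, T + 1) - w i y <= C) ->
  forall y, - b <= y <= b -> v (lam * y, T) - w n y <= 2 * e + C * (T * tau) + th * T.
Proof.
move=> [_ vint] H0 H2.
have [dw dp bc E HL] := sch.
have T0 : 0 <= T by rewrite -T_def mulr_ge0// ltW.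
have T1 : 0 <= T + 1 by lra.
have iT i : (i <= n)%N -> 0 <= i%:R * tau <= T.
  by move=> ni; rewrite mulr_ge0 ?(ltW t0)//= -T_def ler_pM2r// ler_nat.
have lamI y : - b <= y <= b -> - b <= lam * y <= b by move=> yb; apply/andP; split; nra.
pose Y := gauge e C tau th.
pose q x y := K * (x - lam * y) ^+ 2.
have dq x : derw (- b) b (fun y => q x y) (fun y => - (2 * K * lam * (x - lam * y))).
  move=> y yb r r0; exists (r / (K * lam ^+ 2)).
    by rewrite divr_gt0// mulr_gt0// exprn_gt0.
  move=> z zb zy.
  have -> : q x z - q x y - - (2 * K * lam * (x - lam * y)) * (z - y) =
    (K * lam ^+ 2 * (z - y)) * (z - y) by rewrite /q; ring.
  rewrite normrM ler_wpM2r// normrM gtr0_norm ?mulr_gt0 ?exprn_gt0//.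
  by rewrite mulrC -ler_pdivlMr// mulr_gt0 ?exprn_gt0.
pose F i (x y t : R) := v (x, t) - w i y - q x y - Y i t.
move=> y1 y1b; rewrite leNgt; apply/negP => bad.
have [|i [x [y [s [ni xb yb sT Fmax]]]]] := @family_max R b (T + 1) n F (ltW b0) T1.
  move=> i x y t xb yb tT r r0; have r4 : 0 < r / 4 by clear -r0; lra.
  have [d1 d10 h1] := derw_contw (dw i) yb r4.
  have [d2 d20 h2] := chalfstrip_contw2 (T := T + 1) vc xb tT r4.
  have [d3 d30 h3] := (continuous_epsP _).1 (@gauge_continuous R e C tau th i) t _ r4.
  pose M := K * (8 * b).
  have M0 : 0 < M by rewrite !mulr_gt0.
  exists (Num.min (r / 4 / M) (Num.min d1 (Num.min d2 d3))).
    by rewrite !lt_min d10 d20 !divr_gt0.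
  move=> x' z t' xb' zb tT'; rewrite !le_min => /and4P[a0 a1 a2 a3] /and4P[c0 c1 c2 c3] /and4P[_ _ k2 k3].
  have hq : `|q x' z - q x y| <= r / 4 * (2 * (1 / 2)).
    have -> : q x' z - q x y = K * (((x' - x) - lam * (z - y)) * ((x' - lam * z) + (x - lam * y))).
      by rewrite /q; ring.
    rewrite normrM (gtr0_norm K0) normrM.
    have s1 : `|(x' - x) - lam * (z - y)| <= 2 * (r / 4 / M).
      apply: le_trans (ler_normB _ _) _; rewrite normrM (gtr0_norm lam0).
      have := normr_ge0 (z - y); nra.
    have s2 : `|(x' - lam * z) + (x - lam * y)| <= 4 * b.
      by have := lamI z zb; have := lamI y yb; rewrite ler_norml; clear -xb xb'; lra.
    apply: le_trans (_ : K * (2 * (r / 4 / M) * (4 * b)) <= _).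
      by rewrite ler_pM2l//; apply: ler_pM.
    rewrite le_eqVlt; apply/orP; left; apply/eqP; rewrite /M; field; clear -b0 K0; lra.
  have := h1 z zb c1; have := h2 x' t' xb' tT' a2 k2; have := h3 t' k3.
  by move: hq; rewrite /F /Y !ler_norml; clear; lra.
have Fpos : 0 < F i x y s.
  apply: lt_le_trans (Fmax n (lam * y1) y1 T (leqnn n) (lamI _ y1b) y1b _); last (clear -T0; lra).
  rewrite /F /Y /q /gauge T_def !subrr expr0n/= mulr0 add0r; clear -bad; lra.
have q0 : 0 <= q x y by rewrite mulr_ge0 ?sqr_ge0// ltW.
have sT' : 0 <= C * (i%:R * tau * tau) by rewrite !mulr_ge0// ltW.
have sq0 : 0 <= C * (s - i%:R * tau) ^+ 2 by rewrite mulr_ge0// sqr_ge0.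
have ths : 0 <= th * s by rewrite mulr_ge0//; clear -th0 sT; lra.
(* The gauge dominates at the level 0 and at the times 0 and T + 1. *)
case: i ni Fmax Fpos sT' sq0 => [|i] ni Fmax Fpos sT' sq0.
  have := H0 x s y xb sT yb; move: Fpos sq0; rewrite /F /Y /q /gauge mul0r !subr0 mul0r addr0; clear -e0 ths; lra.
have s_gt0 : 0 < s.
  rewrite lt_neqAle eq_sym; apply/andP; split; last (clear -sT; lra).
  apply/eqP => s00; move: Fpos sT'; rewrite /F /Y /q /gauge s00 sub0r sqrrN mulr0 addr0 mulrDr.
  have := scheme_drift b0 t0 f_incr g0 sch 0 i.+1 yb.
  have /andP[i0 _] := iT _ ni.
  rewrite mul0r subr0 (ger0_norm i0); have := H1 _ i0; have := H0 x 0 y xb ltac:(clear -sT; lra) yb.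
  rewrite expr0n/= mulr0 ler_norml; clear; lra.
have s_ltT : s < T + 1.
  rewrite lt_neqAle; apply/andP; split; last (clear -sT; lra).
  apply/eqP => sE; have /andP[i0 iiT] := iT _ ni.
  have h1 : 1 <= (T + 1 - i.+1%:R * tau) ^+ 2 by rewrite expr_ge1//; clear -iiT; lra.
  have h2 : C <= C * (T + 1 - i.+1%:R * tau) ^+ 2 by rewrite ler_peMr.
  have := H2 _ x y ni xb yb; move: Fpos sT' ths q0; rewrite /F /Y /gauge sE mulrDr; clear -e0 h2; lra.
(* Comparison with the point (lam * y, y) shows that x is close to lam * y. *)
have x_in : - b < x < b.
  have := Fmax i.+1 (lam * y) y s ni (lamI _ yb) yb sT; rewrite /F /q subrr expr0n/= mulr0 => h.
  have h2 : K * (x - lam * y) ^+ 2 <= 2 * V.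
    have := Vb _ _ xb sT; have := Vb _ _ (lamI _ yb) sT; rewrite !ler_norml; clear -h; lra.
  have h3 : (x - lam * y) ^+ 2 < ((1 - lam) * b) ^+ 2.
    by rewrite -(ltr_pM2l K0); apply: le_lt_trans h2 HK.
  have bl : 0 <= (1 - lam) * b by rewrite mulr_ge0; clear -h3 lam1 yb; lra.
  have h4 : `|x - lam * y| < (1 - lam) * b.
    by rewrite -ltr_sqr ?nnegrE// real_normK// num_real.
  have : - (lam * b) <= lam * y <= lam * b by rewrite -mulrN !ler_pM2l.
  by move: h4; rewrite ltr_norml; clear; lra.
have dF := derwN (derwD (dw i.+1) (dq x)).
have Fy z : - b <= z <= b -> - (w i.+1 z + q x z) <= - (w i.+1 y + q x y).
  move=> zb; have := Fmax i.+1 x z s ni xb zb sT; rewrite /F; clear; lra.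
have [pm pp] := bc i.+1.
have slope_q : `|K * lam * (x - lam * y)| <= K * (2 * b).
  rewrite normrM gtr0_norm ?mulr_gt0//; apply: ler_pM => //; first by rewrite mulr_ge0// ltW.
    by rewrite ger_pMr// ltW.
  by have := lamI y yb; rewrite ler_norml; clear -x_in; lra.
have y_in : - b < y < b.
  have [yE|n1] := eqVneq y b.
    have : 0 <= - (p i.+1 y + - (2 * K * lam * (x - lam * y))).
      apply: (derw_max_ge0 dF _ ltr01); first (clear -x_in yE; lra).
      by move=> z zb _; apply: Fy; clear -yE zb; lra.
    by move: slope_q; rewrite ler_norml; have -> : p i.+1 y = N; [rewrite yE|clear -HN; lra].
  have [yE|n2] := eqVneq y (- b).
    have : - (p i.+1 y + - (2 * K * lam * (x - lam * y))) <= 0.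
      apply: (derw_max_le0 dF _ ltr01); first (clear -x_in yE; lra).
      by move=> z zb _; apply: Fy; clear -yE zb; lra.
    by move: slope_q; rewrite ler_norml; have -> : p i.+1 y = - N; [rewrite yE|clear -HN; lra].
  by rewrite !lt_neqAle n1 eq_sym n2; clear -yb; lra.
pose c1 := 2 * C * (s - i.+1%:R * tau) + th.
have li : 0 < lam^-1 by rewrite invr_gt0.
have touch eta : 0 < eta -> local_max_on (chalfstrip b)
    (fun q => v q - quadratic (p i.+1 y / lam) ((m i.+1 y / 2 + eta) / lam ^+ 2) c1 C x s q) (x, s).
  move=> eta0; have [d d0 Hd] := derw_taylor2 (dw i.+1) (dp i.+1) yb eta0.
  pose d' := Num.min (d * lam) (Num.min ((b - y) * lam) ((y + b) * lam)).
  have d'0 : 0 < d' by rewrite !lt_min !mulr_gt0//; clear -y_in; lra.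
  apply/local_max_onP; exists (Num.min d' (Num.min s (T + 1 - s))).
    by rewrite lt_min d'0 lt_min s_gt0 subr_gt0 s_ltT.
  move=> [x' t] /chalfstripE[xb' tp'] /=; rewrite !le_min => /andP[/and3P[xd xd1 xd2] _] /and3P[_ ts tT].
  have tT' : 0 <= t <= T + 1 by move: ts tT; rewrite !ler_norml; clear; lra.
  (* With this choice x - lam * y, and so the penalty, is constant. *)
  pose y' := y + (x' - x) / lam.
  have y'y : y' - y = (x' - x) / lam by rewrite /y' addrAC subrr add0r.
  have ay : `|y' - y| * lam = `|x' - x| by rewrite y'y normrM (gtr0_norm li) divfK// gt_eqF.
  rewrite -ay !ler_pM2r// in xd xd1 xd2.
  have yb' : - b <= y' <= b by move: xd1 xd2; rewrite !ler_norml; clear; lra.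
  have qE : q x' y' = q x y.
    by rewrite /q /y'; congr (_ * _ ^+ 2); field; clear -lam0; lra.
  have := Fmax i.+1 x' y' t ni xb' yb' tT'; have := Hd y' yb' xd; rewrite /F /Y qE ler_norml.
  have := gauge_taylor e C tau th i.+1 s t.
  have -> : p i.+1 y * (y' - y) = p i.+1 y / lam * (x' - x) by rewrite y'y; field; clear -lam0; lra.
  have -> : (y' - y) ^+ 2 = (x' - x) ^+ 2 / lam ^+ 2 by rewrite y'y expr_div_n.
  rewrite /quadratic /c1 /= !subrr expr0n/= !mulr0.
  have -> : (m i.+1 y / 2 + eta) / lam ^+ 2 * (x' - x) ^+ 2 =
    m i.+1 y / 2 * ((x' - x) ^+ 2 / lam ^+ 2) + eta * ((x' - x) ^+ 2 / lam ^+ 2) by field; clear -lam0; lra.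
  set A1 := (x' - x) ^+ 2 / lam ^+ 2; set A2 := p i.+1 y / lam * (x' - x); clear; lra.
have xs : halfstrip b (x, s) by apply/halfstripE.
have key : c1 <= f (g (p i.+1 y / lam) * (m i.+1 y / lam ^+ 2)).
  apply: (continuous_limit_ge (c := 2 * g (p i.+1 y / lam) / lam ^+ 2)) => // eta eta0.
  have := vint _ _ (quadratic_C2 (p i.+1 y / lam) ((m i.+1 y / 2 + eta) / lam ^+ 2) c1 C x s b) xs (touch eta eta0).
  have -> : g (p i.+1 y / lam) * (m i.+1 y / lam ^+ 2) + eta * (2 * g (p i.+1 y / lam) / lam ^+ 2) =
    g (p i.+1 y / lam) * (2 * ((m i.+1 y / 2 + eta) / lam ^+ 2)) by field; clear -lam0; lra.
  by rewrite quadratic_pde subr_le0.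
have [Hb _] := scheme_bound b0 t0 f_incr g0 sch i.+1 yb.
have key2 := le_trans key (Hop _ _ Hb).
have key3 : (c1 - kap) * tau <= w i.+1 y - w i y.
  by rewrite -ler_pdivlMr// -E//; clear -key2; lra.
have := Fmax i x y s (ltnW ni) xb yb sT; have := gauge_step e C tau th i s.
have kt' : 0 < (th - kap) * tau by rewrite mulr_gt0//; clear -kapth; lra.
move: key3 kt'; rewrite /F /Y /c1; clear; lra.
Qed.

(** * Comparison *)

Section Scaling.
Variables (R : realType) (b : R) (f g : R -> R) (alpha Cp Cm : R).
Hypotheses (b_gt0 : 0 < b) (f_cont : continuous f) (f_incr : {homo f : x y / x < y})
  (f0 : f 0 = 0) (f_pinfty : f s @[s --> +oo] --> +oo) (f_ninfty : f s @[s --> -oo] --> -oo)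
  (g_cont : continuous g) (g_gt0 : forall s, 0 < g s) (alpha_gt2 : 2 < alpha)
  (Cp_gt0 : 0 < Cp) (Cm_gt0 : 0 < Cm)
  (g_pinfty : `|s| `^ alpha * g s @[s --> +oo] --> Cp)
  (g_ninfty : `|s| `^ alpha * g s @[s --> -oo] --> Cm).

Lemma approximating_schemes (u0 : R -> R) (e : R) : contw (- b) b u0 -> 0 < e ->
  exists (L Ns : R) (dl : R -> R), [/\ 0 <= L, 0 < Ns, (forall r, 0 < r -> 0 < dl r) &
    forall N tau, Ns <= N -> 0 < tau -> exists w p m : nat -> R -> R,
      [/\ scheme b f g tau N L w p m,
          forall x, - b <= x <= b -> `|w 0%N x - u0 x| <= e &
          forall i r x y, 0 < r -> - b <= x <= b -> - b <= y <= b -> `|x - y| <= dl r ->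
            `|w i x - w i y| <= r]].
Proof.
move=> cu e0; have Cpp := Cp_gt0; have Cmp := Cm_gt0.
have [k [kc kf fk ki]] := increasing_inverse f_cont f_incr f_pinfty f_ninfty.
have k0 : k 0 = 0 by rewrite -{1}f0 fk.
have [M1 M11 H1] := tail_pinfty g_pinfty ltr01.
have [M2 M21 H2] := tail_ninfty g_ninfty ltr01.
have ss : 0 < Num.max M1 M2 by rewrite lt_max; apply/orP; left; lra.
have A0 : 0 < Num.max Cp Cm + 1 by apply: addr_gt0; rewrite ?lt_max ?Cpp.
have wider (C s : R) : C <= Num.max Cp Cm -> (C + 1) * s `^ (- alpha) <= (Num.max Cp Cm + 1) * s `^ (- alpha).
  by move=> h; rewrite ler_wpM2r ?powR_ge0// lerD2r.
apply: (scheme_family b_gt0 f_incr kc kf fk ki k0 g_cont g_gt0 alpha_gt2 ss A0) => // s.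
  rewrite ge_max => /andP[h1 h2]; apply: le_trans (wider Cp s _); last by rewrite le_max lexx.
  by apply: tail_upper; [lra|exact: H1].
rewrite ge_max => /andP[h1 h2]; apply: le_trans (wider Cm s _); last by rewrite le_max lexx orbT.
by apply: (@tail_upper _ (fun s => g (- s))); [lra|exact: H2].
Qed.

(** A bounded speed bounds g s * r, as f is unbounded in both directions. *)
Lemma slope_scaling (L kap : R) : 0 < kap -> exists2 d, 0 < d & forall lam s r,
  0 < lam -> lam < 1 -> 1 <= lam * (1 + d) -> `|f (g s * r)| <= L ->
  f (g (s / lam) * (r / lam ^+ 2)) <= f (g s * r) + kap.
Proof.
move=> kap0.
have [k [kc kf fk ki]] := increasing_inverse f_cont f_incr f_pinfty f_ninfty.
have S0 : 0 <= `|k L| + `|k (- L)| by rewrite addr_ge0.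
have [d d0 H] := operator_ratio f_cont g_cont g_gt0 alpha_gt2 Cp_gt0 Cm_gt0 g_pinfty g_ninfty S0 kap0.
exists d => // lam s r l0 l1 ld fL.
have gS : `|g s * r| <= `|k L| + `|k (- L)|.
  move: fL; rewrite ler_norml => /andP[/(homo_lt_le ki) + /(homo_lt_le ki)]; rewrite !fk ler_norml.
  have := ler_norm (k L); have := ler_norm (- k (- L)); rewrite normrN.
  by have := normr_ge0 (k L); have := normr_ge0 (k (- L)); lra.
have li : 0 < lam^-1 by rewrite invr_gt0.
have mu : 1 <= lam^-1 <= 1 + d.
  by rewrite invf_ge1// (ltW l1) -[lam^-1]mul1r ler_pdivrMr// mulrC.
have := H _ s r mu gS; rewrite (mulrC _ s) exprVn (mulrC _ r) ler_norml; lra.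
Qed.

End Scaling.

(** One scheme that starts near v1 (., 0) serves for both functions: it stays
    almost below v2, and v1 (lam * x, .) stays almost below it. The constants are
    chosen in the order L, C, lam, K, N, tau; the space modulus of v1 (., 0) enters
    through K, and lam tends to 1 at the end. *)
Theorem comparison (R : realType) (b : R) (f g : R -> R) (alpha Cp Cm : R)
    (b_gt0 : 0 < b) (f_cont : continuous f) (f_incr : {homo f : x y / x < y})
    (f0 : f 0 = 0) (f_pinfty : f s @[s --> +oo] --> +oo) (f_ninfty : f s @[s --> -oo] --> -oo)
    (g_cont : continuous g) (g_gt0 : forall s, 0 < g s) (alpha_gt2 : 2 < alpha)
    (Cp_gt0 : 0 < Cp) (Cm_gt0 : 0 < Cm)
    (g_pinfty : `|s| `^ alpha * g s @[s --> +oo] --> Cp)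
    (g_ninfty : `|s| `^ alpha * g s @[s --> -oo] --> Cm) (v1 v2 : R * R -> R) :
  {within chalfstrip b, continuous v1} -> {within chalfstrip b, continuous v2} ->
  viscosity_subsolution b f g v1 -> viscosity_supersolution b f g v2 ->
  (forall x, - b <= x <= b -> v1 (x, 0) <= v2 (x, 0)) ->
  forall x t, - b <= x <= b -> 0 <= t -> v1 (x, t) <= v2 (x, t).
Proof.
move=> c1 c2 sub sup ini x T xb.
rewrite le_eqVlt => /predU1P[<-|T0]; first exact: ini.
have T1 : 0 <= T + 1 by lra.
(* v1 (lam * x, T) tends to v1 (x, T). *)
suff near eps : 0 < eps -> exists2 l0, 0 < l0 < 1 & forall lam, l0 <= lam -> lam < 1 ->
    v1 (lam * x, T) <= v2 (x, T) + eps.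
  apply/ler_addgt0Pr => eps eps0; have e2 : 0 < eps / 2 by lra.
  have [l0 /andP[l00 l01] H] := near _ e2.
  have [|d d0 Hd] := chalfstrip_contw2 (T := T) c1 (x := x) (t := T) xb _ e2; first lra.
  pose lam := Num.max l0 (1 - Num.min (1 / 2) (d / b)).
  have mp : 0 < Num.min (1 / 2) (d / b) by rewrite lt_min !divr_gt0.
  have md : Num.min (1 / 2) (d / b) * b <= d by rewrite -ler_pdivlMr// ge_min lexx orbT.
  have ll : l0 <= lam by rewrite le_max lexx.
  have l1 : lam < 1 by rewrite gt_max l01; lra.
  have l2 : 1 - Num.min (1 / 2) (d / b) <= lam by rewrite le_max lexx orbT.
  have lp : 0 < lam by clear -l00 ll; lra.
  have hl := H lam ll l1.
  have lxb : - b <= lam * x <= b by apply/andP; split; nra.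
  have : `|v1 (lam * x, T) - v1 (x, T)| <= eps / 2.
    apply: Hd => //; [clear -T0; lra| |by rewrite subrr normr0 ltW].
    have -> : lam * x - x = - ((1 - lam) * x) by ring.
    rewrite normrN normrM ger0_norm; last (clear -l1; lra).
    apply: le_trans (_ : Num.min (1 / 2) (d / b) * b <= _) => //.
    by apply: ler_pM => //; [clear -l1; lra|clear -l2; lra|rewrite ler_norml].
  by rewrite ler_norml; clear -hl; lra.
move=> eps0; pose e := eps / 16; have e0 : 0 < e by rewrite /e; lra.
have cu : contw (- b) b (fun x => v1 (x, 0)).
  by apply: contw2_sections (chalfstrip_contw2 (T := T) c1) _; rewrite lexx ltW.
have [L [Ns [dl [L0 Ns0 _ fam]]]] := approximating_schemes b_gt0 f_cont f_incr f0 f_pinfty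
  f_ninfty g_cont g_gt0 alpha_gt2 Cp_gt0 Cm_gt0 g_pinfty g_ninfty cu e0.
have [V1 V10 HV1] := contw2_bounded (chalfstrip_contw2 (T := T + 1) c1).
have [V2 V20 HV2] := contw2_bounded (chalfstrip_contw2 (T := T + 1) c2).
have [Q1 Q10 HQ1] := contw2_quadratic (chalfstrip_contw2 (T := T + 1) c1) e0.
have [Q2 Q20 HQ2] := contw2_quadratic (chalfstrip_contw2 (T := T + 1) c2) e0.
pose D := V1 + V2 + e + L * T.
have D0 : 0 <= D by rewrite !addr_ge0// ?mulr_ge0// ltW.
(* C beats the time moduli of v1 and v2, the drift L of the scheme, and the
   oscillation of all functions at the time T + 1. *)
pose C := Q1 + Q2 + L ^+ 2 / e + D + V1.
have LL : 0 <= L ^+ 2 / e by rewrite divr_ge0 ?sqr_ge0// ltW.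
have C0 : 0 <= C by rewrite /C; clear -V10 Q10 Q20 D0 LL; lra.
have e3 : 0 <= 3 * e by clear -e0; lra.
have H1 s : 0 <= s -> L * s <= 3 * e + C * s ^+ 2.
  move=> s0; have s2 := sqr_ge0 s.
  have h1 : L * s <= e + L ^+ 2 / e * s ^+ 2.
    have : 0 <= (e - L * s) ^+ 2 / e by rewrite divr_ge0 ?sqr_ge0// ltW.
    have -> : (e - L * s) ^+ 2 / e = e - 2 * (L * s) + L ^+ 2 / e * s ^+ 2 by field; clear -e0; lra.
    by have := mulr_ge0 L0 s0; clear; lra.
  have h2 : L ^+ 2 / e * s ^+ 2 <= C * s ^+ 2 by rewrite ler_wpM2r// /C; clear -V10 Q10 Q20 D0; lra.
  clear -e3 h1 h2; lra.
pose th := e / T; have th0 : 0 < th by rewrite divr_gt0.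
have thT : th * T = e by rewrite divfK// gt_eqF.
have kap0 : 0 < th / 2 by clear -th0; lra.
have [d d0 Hop] := slope_scaling f_cont f_incr f_pinfty f_ninfty g_cont g_gt0 alpha_gt2
  Cp_gt0 Cm_gt0 g_pinfty g_ninfty L kap0.
(* mu bounds 1 - lam: the space modulus of v1 (., 0) over (1 - lam) * b is at
   most e, and the dilation error of the operator at most th / 2. *)
pose mu := Num.min (1 / 2) (Num.min (e / (2 * Q1 * b ^+ 2 + 1)) (d / (1 + d))).
have den0 : 0 <= 2 * Q1 * b ^+ 2 by apply: mulr_ge0; [apply: mulr_ge0|exact: sqr_ge0].
have den : 0 < 2 * Q1 * b ^+ 2 + 1 by clear -den0; lra.
have d1 : 0 < 1 + d by clear -d0; lra.
have mu0 : 0 < mu by rewrite !lt_min !divr_gt0.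
have [m1 m2 m3] : [/\ mu <= 1 / 2, mu * (2 * Q1 * b ^+ 2 + 1) <= e & mu * (1 + d) <= d].
  by rewrite -!ler_pdivlMr// /mu; split; rewrite !ge_min lexx ?orbT.
exists (1 - mu); first (clear -mu0 m1; lra).
move=> lam ll l1; have l0 : 0 < lam by clear -m1 ll; lra.
have ld : 1 <= lam * (1 + d) by nra.
have lb : 0 < (1 - lam) * b by rewrite mulr_gt0//; clear -l1; lra.
have lb2 : 0 < ((1 - lam) * b) ^+ 2 by rewrite exprn_gt0.
have lQ : 2 * Q1 * ((1 - lam) * b) ^+ 2 <= e.
  have h1 : (1 - lam) ^+ 2 <= mu.
    have : 0 <= 1 - lam by clear -l1; lra.
    have : 1 - lam <= mu by clear -ll; lra.
    nra.
  have : (1 - lam) ^+ 2 * (2 * Q1 * b ^+ 2) <= mu * (2 * Q1 * b ^+ 2).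
    by rewrite ler_wpM2r.
  rewrite exprMn; clear -mu0 m2; lra.
pose K := 2 * Q1 + (2 * V1 + 1) / ((1 - lam) * b) ^+ 2.
have KV : 0 < (2 * V1 + 1) / ((1 - lam) * b) ^+ 2 by rewrite divr_gt0//; clear -V10; lra.
have K0 : 0 < K by rewrite ltr_wpDl// mulr_ge0.
have HK : 2 * V1 < K * ((1 - lam) * b) ^+ 2.
  rewrite /K (mulrDl (2 * Q1)) divfK ?gt_eqF//.
  have : 0 <= 2 * Q1 * ((1 - lam) * b) ^+ 2 by apply: mulr_ge0; [apply: mulr_ge0|exact: ltW].
  clear; lra.
pose N := Num.max Ns (4 * K * b + 1).
have NN : Ns <= N by rewrite le_max lexx.
have HN : 4 * K * b < N by rewrite lt_max; apply/orP; right; clear; lra.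
pose n := (Num.truncn (C * T * T / e)).+1.
have n0 : 0 < n%:R :> R by rewrite ltr0n.
pose tau := T / n%:R.
have t0 : 0 < tau by rewrite divr_gt0.
have nt : n%:R * tau = T by rewrite mulrC divfK// gt_eqF.
have CT : C * (T * tau) <= e.
  rewrite /tau !mulrA ler_pdivrMr// (mulrC e) -ler_pdivrMr//.
  exact: ltW (truncnS_gt _).
have [w [p [m [S w0 _]]]] := fam N tau NN t0.
have wD i y : (i <= n)%N -> - b <= y <= b -> `|w i y - w 0%N y| <= L * T.
  move=> ni yb; apply: le_trans (scheme_drift b_gt0 t0 f_incr g_gt0 S 0 i yb) _.
  have i0 : 0 <= i%:R * tau by apply: mulr_ge0 => //; exact: ltW.
  have iT : i%:R * tau <= T by rewrite -nt ler_pM2r// ler_nat.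
  by rewrite mul0r subr0 (ger0_norm i0) ler_wpM2l.
have zT : (0 : R) <= 0 <= T + 1 by rewrite lexx.
have TT : 0 <= T + 1 <= T + 1 by rewrite T1 lexx.
have lo : w n x - v2 (x, T) <= 2 * (3 * e) + C * (T * tau) + th * T.
  apply: (scheme_below b_gt0 f_cont f_incr g_gt0 t0 S c2 nt e3 C0 th0 H1 sup) => //.
    move=> y t yb tT.
    have := w0 y yb; have := ini y yb; have := HQ2 y t y 0 yb tT yb zT.
    rewrite subrr sub0r sqrrN expr0n/= add0r !ler_norml.
    have : Q2 * t ^+ 2 <= C * t ^+ 2 by rewrite ler_wpM2r ?sqr_ge0// /C; clear -V10 Q10 D0 LL; lra.
    clear; lra.
  move=> i y ni yb; have := wD i y ni yb; have := w0 y yb.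
  have := HV2 y _ yb TT; have := HV1 y _ yb zT.
  by rewrite !ler_norml /C /D; clear -Q10 Q20 LL; lra.
have hi : v1 (lam * x, T) - w n x <= 2 * (3 * e) + C * (T * tau) + th * T.
  have kth : th / 2 < th by clear -th0; lra.
  apply: (scheme_above b_gt0 f_cont f_incr g_gt0 t0 S c1 nt e3 C0 th0 H1 K0 l0 l1 HV1 HK HN kth) => //.
  - by move=> s r; apply: Hop.
  - move=> z t y zb tT yb.
    have := w0 y yb; have := HQ1 y 0 z t yb zT zb tT; rewrite subr0 !ler_norml.
    have E : z - y = (z - lam * y) - (1 - lam) * y by ring.
    have zy : (z - y) ^+ 2 <= 2 * (z - lam * y) ^+ 2 + 2 * ((1 - lam) * b) ^+ 2.
      have y2 : ((1 - lam) * y) ^+ 2 <= ((1 - lam) * b) ^+ 2.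
        by rewrite !exprMn ler_wpM2l ?sqr_ge0//; nra.
      rewrite E; move: y2; set A1 := z - lam * y; set A2 := (1 - lam) * y.
      by move=> y2; have := sqr_ge0 (A1 + A2); clear -y2; lra.
    have q1 : Q1 * (z - y) ^+ 2 <= Q1 * (2 * (z - lam * y) ^+ 2 + 2 * ((1 - lam) * b) ^+ 2).
      by rewrite ler_wpM2l.
    have q2 : Q1 * t ^+ 2 <= C * t ^+ 2 by rewrite ler_wpM2r ?sqr_ge0// /C; clear -V10 Q20 D0 LL; lra.
    have q3 : 2 * Q1 * (z - lam * y) ^+ 2 <= K * (z - lam * y) ^+ 2.
      by rewrite ler_wpM2r ?sqr_ge0// /K; clear -KV; lra.
    clear -lQ q1 q2 q3; lra.
  - move=> i z y ni zb yb; have := wD i y ni yb; have := w0 y yb.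
    have := HV1 z _ zb TT; have := HV1 y _ yb zT.
    by rewrite !ler_norml /C /D; clear -V20 Q10 Q20 LL; lra.
rewrite thT in lo hi; move: lo hi; rewrite /e; rewrite /e in CT; clear -CT; lra.
Qed.

(** * Touching a limit of schemes in the interior *)

Section DiscreteTouching.
Variable R : realType.

(** The quadratic gap forces a minimum of W_k y - psi (y, k tau) over the space-time
    box to lie near (x0, t0) as soon as W is close to U. In particular it is not
    attained at the first level of the box, so it can be compared with the level
    below. *)
Lemma discrete_min (xl xr x0 t0 r eta rho : R) (U psi : R -> R -> R) :
  xl <= x0 <= xr -> 0 < rho -> rho <= r -> r < t0 -> 0 < eta ->
  (forall x t, xl <= x <= xr -> t0 - r <= t <= t0 + r ->
    U x0 t0 - psi x0 t0 + eta * ((x - x0) ^+ 2 + (t - t0) ^+ 2) <= U x t - psi x t) ->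
  (forall e, 0 < e -> exists2 d, 0 < d & forall t, `|t - t0| <= d ->
    `|(U x0 t - psi x0 t) - (U x0 t0 - psi x0 t0)| <= e) ->
  exists2 e0, 0 < e0 & forall e tau (W : nat -> R -> R), e <= e0 -> 0 < tau -> tau <= e ->
    (forall i, t0 - r <= i%:R * tau <= t0 + r -> contw xl xr (fun x => W i x - psi x (i%:R * tau))) ->
    (forall i x, xl <= x <= xr -> i%:R * tau <= t0 + r -> `|U x (i%:R * tau) - W i x| <= e) ->
    exists i x, [/\ xl <= x <= xr, `|x - x0| <= rho, `|i%:R * tau - t0| <= rho /\
      `|i.+1%:R * tau - t0| <= rho,
      W i.+1 x - psi x (i.+1%:R * tau) <= W i x - psi x (i%:R * tau) &
      forall y, xl <= y <= xr ->
        W i.+1 x - psi x (i.+1%:R * tau) <= W i.+1 y - psi y (i.+1%:R * tau)].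
Proof.
move=> x0X rho0 rhor rt0 eta0 sep cont.
have er : 0 < eta * (rho ^+ 2 / 16) by rewrite mulr_gt0// divr_gt0// exprn_gt0.
have [d d0 Hd] := cont _ er.
exists (Num.min (eta * (rho ^+ 2 / 16)) (Num.min d (rho / 4))); first by rewrite !lt_min er d0; lra.
move=> e tau W; rewrite !le_min => /and3P[e1 e2 e3] tau0 taue cW aW.
have ttau : tau <= rho / 4 by lra.
have t00 : 0 < t0 by clear -rho0 rhor rt0; lra.
have tr0 : 0 <= (t0 - r) / tau by rewrite divr_ge0 ?(ltW tau0)//; clear -rt0; lra.
have tp0 : 0 <= (t0 + r) / tau by rewrite divr_ge0 ?(ltW tau0)//; clear -rho0 rhor rt0; lra.
have tt0 : 0 <= t0 / tau by rewrite divr_ge0 ?(ltW tau0)//; clear -t00; lra.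
pose i1 := (Num.truncn ((t0 - r) / tau)).+1.
pose i2 := Num.truncn ((t0 + r) / tau).
pose is_ := Num.truncn (t0 / tau).
have /andP[l1 u1] := truncn_itv tr0; have /andP[l2 u2] := truncn_itv tp0.
have /andP[l3 u3] := truncn_itv tt0.
move: l1 u1 l2 u2 l3 u3; rewrite -/i1 -/i2 -/is_ !ler_pdivlMr// !ltr_pdivrMr// => l1 u1 l2 u2 l3 u3.
have i1b : i1%:R * tau <= t0 - r + tau by rewrite /i1 -natr1 mulrDl mul1r; clear -l1; lra.
have i3b : t0 < is_%:R * tau + tau by move: u3; rewrite -natr1 mulrDl mul1r.
have i2b : t0 + r < i2%:R * tau + tau by move: u2; rewrite -natr1 mulrDl mul1r.
have leN i j : (i <= j)%N = (i%:R * tau <= j%:R * tau) by rewrite ler_pM2r// ler_nat.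
have i1s : (i1 <= is_)%N.
  rewrite -ltnS -(ltr_nat R) -(ltr_pM2r tau0) -[is_.+1%:R]natr1 mulrDl mul1r; clear -rho0 rhor e3 taue u3 i1b; lra.
have is2 : (is_ <= i2)%N by rewrite -ltnS -(ltr_nat R) -(ltr_pM2r tau0) -[i2.+1%:R]natr1 mulrDl mul1r; clear -rho0 rhor u2 l3; lra.
have range j : (i1 + j <= i2)%N -> t0 - r <= (i1 + j)%:R * tau <= t0 + r.
  move=> h; have h1 : (i1 <= i1 + j)%N by exact: leq_addr.
  by move: h h1; rewrite !leN; clear -u1 l2; lra.
have xlr : xl <= xr by clear -x0X; lra.
have /choice[z Hz] : forall j, exists x, (i1 + j <= i2)%N -> xl <= x <= xr /\
   forall y, xl <= y <= xr -> - (W (i1 + j)%N y - psi y ((i1 + j)%:R * tau)) <=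
     - (W (i1 + j)%N x - psi x ((i1 + j)%:R * tau)).
  move=> j; have [h|h] := leqP (i1 + j) i2; last by exists 0.
  have [x xX H] := contw_max xlr (contwN (cW _ (range j h))).
  by exists x.
have [j jn Hj] := finite_argmax (i2 - i1) (fun j => - (W (i1 + j)%N (z j) - psi (z j) ((i1 + j)%:R * tau))).
have ji : (i1 + j <= i2)%N by rewrite -leq_subRL ?(leq_trans i1s is2).
have [zX zM] := Hz j ji.
have best k y : (i1 + k <= i2)%N -> xl <= y <= xr ->
    W (i1 + j)%N (z j) - psi (z j) ((i1 + j)%:R * tau) <= W (i1 + k)%N y - psi y ((i1 + k)%:R * tau).
  move=> kn yX; have [_ hk] := Hz k kn; have := hk y yX.
  have : (k <= i2 - i1)%N by rewrite leq_subRL ?(leq_trans i1s is2).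
  by move=> /Hj; clear; lra.
have ks : (i1 + (is_ - i1) = is_)%N by rewrite subnKC.
have hs := best (is_ - i1)%N x0; rewrite ks in hs; have {}hs := hs is2 x0X.
have a1 := aW is_ x0 x0X ltac:(clear -rho0 rhor l3; lra).
have rj := range j ji; have a2 := aW (i1 + j)%N (z j) zX ltac:(clear -rj; lra).
have s1 := sep (z j) _ zX rj.
have d1 := Hd (is_%:R * tau) ltac:(rewrite ler_norml; clear -e2 taue l3 u3; lra).
have close : (z j - x0) ^+ 2 + ((i1 + j)%:R * tau - t0) ^+ 2 <= 3 * (rho ^+ 2 / 16).
  rewrite -(ler_pM2l eta0); move: a1 a2 d1; rewrite !ler_norml; clear -e1 hs s1; lra.
have n1 : `|z j - x0| <= rho / 2.
  rewrite -ler_sqr ?nnegrE ?normr_ge0//; last (clear -tau0 ttau; lra).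
  rewrite real_normK ?num_real// expr_div_n.
  by have := sqr_ge0 ((i1 + j)%:R * tau - t0); have := sqr_ge0 rho; clear -close; lra.
have n2 : `|(i1 + j)%:R * tau - t0| <= rho / 2.
  rewrite -ler_sqr ?nnegrE ?normr_ge0//; last (clear -ttau l2 u2; lra).
  rewrite real_normK ?num_real// expr_div_n.
  by have := sqr_ge0 (z j - x0); have := sqr_ge0 rho; clear -close; lra.
case: j jn {Hj hs} ji zX zM best a2 rj s1 close n1 n2 => [|j] jn ji zX zM best a2 rj s1 close n1 n2.
  by exfalso; move: n2; rewrite addn0 ler_norml; clear -rho0 rhor e3 taue i1b; lra.
have ji' : (i1 + j <= i2)%N by apply: leq_trans ji; rewrite addnS.
have e4 : (i1 + j.+1)%:R * tau = (i1 + j)%:R * tau + tau by rewrite addnS -natr1 mulrDl mul1r.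
exists (i1 + j)%N, (z j.+1); rewrite -addnS; split => //.
- clear -ttau l2 u2 n1; lra.
- by move: n2; rewrite e4 !ler_norml; clear -ttau l2 u2; lra.
- exact: best.
- by move=> y yX; exact: best.
Qed.

(** At such a minimum first derivatives agree and second derivatives are ordered,
    so the step is at least f (g (psi_x) psi_xx); minimality against the previous
    level bounds it by psi_t at an intermediate time. *)
Lemma scheme_step_no_min (f g : R -> R) (psi psit psix psixx : R -> R -> R)
    (xl xr tl tr tau : R) (w0 w p m : R -> R) (x s : R)
    (f_incr : {homo f : x y / x < y}) (g_gt0 : forall s, 0 < g s) (tau0 : 0 < tau)
    (dx : derw xl xr (psi^~ (s + tau)) (psix^~ (s + tau)))
    (dxx : derw xl xr (psix^~ (s + tau)) (psixx^~ (s + tau)))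
    (dt : derw tl tr (psi x) (psit x))
    (dw : derw xl xr w p) (dp : derw xl xr p m)
    (eqn : f (g (p x) * m x) = (w x - w0 x) / tau)
    (xX : xl < x < xr) (s1 : tl <= s) (s2 : s + tau <= tr) :
  (forall t, tl <= t <= tr -> psit x t < f (g (psix x (s + tau)) * psixx x (s + tau))) ->
  w x - psi x (s + tau) <= w0 x - psi x s ->
  (forall y, xl <= y <= xr -> w x - psi x (s + tau) <= w y - psi y (s + tau)) -> False.
Proof.
move=> strict timemin spacemin.
have dF := derwN (derwB dw dx); have dF' := derwN (derwB dp dxx).
have Fmax y : xl <= y <= xr -> `|y - x| <= 1 -> - (w y - psi y (s + tau)) <= - (w x - psi x (s + tau)).
  by move=> yX _; have := spacemin y yX; lra.
have pE := derw_max_eq0 dF xX ltr01 Fmax.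
have xX' : xl <= x <= xr by lra.
have xlr : xl < xr by lra.
have mE := derw_max_second xlr dF dF' xX' pE ltr01 Fmax.
have pE' : p x = psix x (s + tau) by lra.
have [xi xis E] := derw_mvt dt s1 (y := s + tau) ltac:(lra) s2.
have := strict xi ltac:(lra); rewrite -pE'.
have : f (g (p x) * psixx x (s + tau)) <= f (g (p x) * m x).
  by apply: (homo_lt_le f_incr); rewrite ler_pM2l//; lra.
rewrite eqn => h1 h2.
have : psit x xi < (w x - w0 x) / tau by lra.
rewrite ltr_pdivlMr//; have -> : psit x xi * tau = psi x (s + tau) - psi x s by rewrite E; ring.
lra.
Qed.

End DiscreteTouching.

Section Regularity.
Variable R : realType.

Lemma extends_at (A B : set (R * R)) F p : extends_continuously A B F -> A `<=` B -> B p ->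
  exists l : R, (A p -> F p = l) /\ forall e, 0 < e -> exists2 d, 0 < d & forall q, A q ->
    `|q.1 - p.1| <= d -> `|q.2 - p.2| <= d -> `|F q - l| <= e.
Proof.
move=> [h /within2P ch hE] AB Bp; exists (h p); split; first by move=> Ap; rewrite hE.
move=> e e0; have [d d0 H] := ch p Bp e e0; exists d => // q Aq q1 q2.
by rewrite -hE//; apply: H => //; exact: AB.
Qed.

Lemma halfstrip_sub b : @halfstrip R b `<=` chalfstrip b.
Proof.
by move=> [x t] /halfstripE[xb t0]; apply/chalfstripE; split; lra.
Qed.

Definition phit (phi : R * R -> R) (x t : R) := 'D_dir_t phi (x, t).
Definition phix (phi : R * R -> R) (x t : R) := 'D_dir_x phi (x, t).
Definition phixx (phi : R * R -> R) (x t : R) := 'D_dir_x ('D_dir_x phi) (x, t).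

(** At the ends the derivatives of a test function exist only as limits from
    inside. *)
Lemma C2_limits b phi x0 t0 : C2_chalfstrip b phi -> - b <= x0 <= b -> 0 < t0 ->
  exists lt lx lxx : R,
    (- b < x0 < b -> [/\ phit phi x0 t0 = lt, phix phi x0 t0 = lx & phixx phi x0 t0 = lxx]) /\
    forall e, 0 < e -> exists2 d, 0 < d & forall x t, - b < x < b -> 0 < t ->
      `|x - x0| <= d -> `|t - t0| <= d ->
      [/\ `|phit phi x t - lt| <= e, `|phix phi x t - lx| <= e & `|phixx phi x t - lxx| <= e].
Proof.
move=> [_ C2] xb tp; have cp : chalfstrip b (x0, t0) by apply/chalfstripE; split => //; lra.
have [_ et _] := C2 _ (or_intror erefl).
have [_ ex H2] := C2 _ (or_introl erefl).
have [_ exx] := H2 _ (or_introl erefl).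
have [lt [Et Ht]] := extends_at et (@halfstrip_sub b) cp.
have [lx [Ex Hx]] := extends_at ex (@halfstrip_sub b) cp.
have [lxx [Exx Hxx]] := extends_at exx (@halfstrip_sub b) cp.
exists lt, lx, lxx; split.
  move=> xin; have hp : halfstrip b (x0, t0) by apply/halfstripE.
  by split; [exact: Et|exact: Ex|exact: Exx].
move=> e e0; have [d1 d10 h1] := Ht e e0; have [d2 d20 h2] := Hx e e0; have [d3 d30 h3] := Hxx e e0.
exists (Num.min d1 (Num.min d2 d3)); first by rewrite !lt_min d10 d20.
move=> x t xin t1; rewrite !le_min => /and3P[a1 a2 a3] /and3P[c1 c2 c3].
have hp : halfstrip b (x, t) by apply/halfstripE.
by split; [exact: (h1 (x, t))|exact: (h2 (x, t))|exact: (h3 (x, t))].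
Qed.

Lemma C2_slices b phi : C2_chalfstrip b phi ->
  [/\ forall a c t, - b < a -> c < b -> 0 < t -> derw a c (phi \o (pair^~ t)) (phix phi ^~ t),
      forall a c t, - b < a -> c < b -> 0 < t -> derw a c (phix phi ^~ t) (phixx phi ^~ t) &
      forall a c x, - b < x < b -> 0 < a -> derw a c (fun t => phi (x, t)) (phit phi x)].
Proof.
move=> [_ C2].
have [dt _ _] := C2 _ (or_intror erefl).
have [dx _ H2] := C2 _ (or_introl erefl).
have [dxx _] := H2 _ (or_introl erefl).
split=> [a c t ab cb tp|a c t ab cb tp|a c x xb a0].
- by apply: derw_slice_x => x xac; apply: dx; apply/halfstripE; split => //; lra.
- by apply: derw_slice_x => x xac; apply: dxx; apply/halfstripE; split => //; lra.
- by apply: derw_slice_t => t tac; apply: dt; apply/halfstripE; split => //; lra.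
Qed.

Lemma derw_square (a c k z0 : R) :
  derw a c (fun z => k * (z - z0) ^+ 2) (fun z => 2 * k * (z - z0)).
Proof.
move=> y yb r r0; exists (r / (`|k| + 1)); first by rewrite divr_gt0// ltr_wpDl.
move=> z zb zy.
have -> : k * (z - z0) ^+ 2 - k * (y - z0) ^+ 2 - 2 * k * (y - z0) * (z - y) =
    k * (z - y) * (z - y) by ring.
rewrite normrM ler_wpM2r// normrM; move: zy; rewrite ler_pdivlMr ?ltr_wpDl//.
by have := normr_ge0 (z - y); nra.
Qed.

Lemma operator_continuous (f g : R -> R) (q1 q2 e : R) : continuous f -> continuous g -> 0 < e ->
  exists2 d, 0 < d & forall p m, `|p - q1| <= d -> `|m - q2| <= d ->
    `|f (g p * m) - f (g q1 * q2)| <= e.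
Proof.
move=> cf cg e0.
have cF : continuous (fun z : R * R => f (g z.1 * z.2)).
  move=> z; apply: continuous_comp; last exact: cf.
  apply: cvgM; last exact: cvg_snd.
  by apply: continuous_comp; [exact: cvg_fst|exact: cg].
have /cvgrPdist_le/(_ e e0)/nbhs2P[d d0 H] := cF (q1, q2).
by exists d => // p m h1 h2; rewrite distrC; apply: (H (p, m)).
Qed.

End Regularity.

Definition euler_approximable (R : realType) (f g : R -> R) (xl xr : R) (u : R -> R -> R) : Prop :=
  forall e T : R, 0 < e -> exists (tau : R) (w p m : nat -> R -> R),
    [/\ 0 < tau, tau <= e,
      forall i, derw xl xr (w i) (p i) /\ derw xl xr (p i) (m i),
      forall i x, xl <= x <= xr -> f (g (p i.+1 x) * m i.+1 x) = (w i.+1 x - w i x) / tau &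
      forall i x, xl <= x <= xr -> i%:R * tau <= T -> `|u x (i%:R * tau) - w i x| <= e].

(** Subtracting eta times the squared distance makes the minimum strict and keeps
    the opposite strict inequality near (x0, t0), to be contradicted by a step of
    the scheme. *)
Lemma touching_from_below (R : realType) (f g : R -> R) (x0 t0 r1 : R)
    (u phi pt px pxx : R -> R -> R) :
  continuous f -> {homo f : x y / x < y} -> continuous g -> (forall s, 0 < g s) ->
  0 < r1 -> r1 < t0 ->
  (forall t, t0 - r1 <= t <= t0 + r1 -> derw (x0 - r1) (x0 + r1) (phi ^~ t) (px ^~ t)) ->
  (forall t, t0 - r1 <= t <= t0 + r1 -> derw (x0 - r1) (x0 + r1) (px ^~ t) (pxx ^~ t)) ->
  (forall x, x0 - r1 <= x <= x0 + r1 -> derw (t0 - r1) (t0 + r1) (phi x) (pt x)) ->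
  (forall e, 0 < e -> exists2 d, 0 < d & forall x t,
     x0 - r1 <= x <= x0 + r1 -> t0 - r1 <= t <= t0 + r1 -> `|x - x0| <= d -> `|t - t0| <= d ->
     [/\ `|pt x t - pt x0 t0| <= e, `|px x t - px x0 t0| <= e & `|pxx x t - pxx x0 t0| <= e]) ->
  contw (t0 - r1) (t0 + r1) (u x0) ->
  euler_approximable f g (x0 - r1) (x0 + r1) u ->
  (forall x t, x0 - r1 <= x <= x0 + r1 -> t0 - r1 <= t <= t0 + r1 ->
     u x0 t0 - phi x0 t0 <= u x t - phi x t) ->
  f (g (px x0 t0) * pxx x0 t0) <= pt x0 t0.
Proof.
move=> f_cont f_incr g_cont g_gt0 r10 r1t sx sxx st lim cu ap Hm; rewrite leNgt; apply/negP => op.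
set lt := pt x0 t0 in lim op; set lx := px x0 t0 in lim op; set lxx := pxx x0 t0 in lim op.
pose A := f (g lx * lxx) - lt; have A0 : 0 < A by rewrite /A; lra.
have A3 : 0 < A / 3 by lra.
have [d d0 Hd] := operator_continuous lx lxx f_cont g_cont A3.
pose eta := Num.min (d / 4) (A / 12).
have eta0 : 0 < eta by rewrite lt_min !divr_gt0.
have [eta1 eta2] : eta <= d / 4 /\ eta <= A / 12 by rewrite !ge_min !lexx orbT.
have em : 0 < Num.min (d / 2) (A / 6) by rewrite lt_min !divr_gt0.
have [r2 r20 Hr] := lim _ em.
pose r := Num.min 1 (Num.min r1 r2).
have r0 : 0 < r by rewrite !lt_min ltr01 r10.
have [h1 h2 h3] : [/\ r <= 1, r <= r1 & r <= r2].
  by rewrite /r; split; rewrite !ge_min lexx ?orbT.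
pose psi x t := phi x t - eta * (x - x0) ^+ 2 - eta * (t - t0) ^+ 2.
pose psix x t := px x t - 2 * eta * (x - x0).
pose psixx x t := pxx x t - 2 * eta.
pose psit x t := pt x t - 2 * eta * (t - t0).
have x1 x : x0 - r <= x <= x0 + r -> x0 - r1 <= x <= x0 + r1 by clear -h2; lra.
have t1 t : t0 - r <= t <= t0 + r -> t0 - r1 <= t <= t0 + r1 by clear -h2; lra.
have bound c : `|c| <= r -> `|2 * eta * c| <= d / 2 /\ `|2 * eta * c| <= A / 6.
  move=> cr; rewrite normrM gtr0_norm ?mulr_gt0//.
  by have := normr_ge0 c; clear -cr h1 eta1 eta2 eta0; split; nra.
have strict x t t' : x0 - r <= x <= x0 + r -> t0 - r <= t <= t0 + r -> t0 - r <= t' <= t0 + r ->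
    psit x t' < f (g (psix x t) * psixx x t).
  move=> xr tr tr'.
  have nx : `|x - x0| <= r by rewrite ler_norml; clear -xr; lra.
  have nt : `|t - t0| <= r by rewrite ler_norml; clear -tr; lra.
  have nt' : `|t' - t0| <= r by rewrite ler_norml; clear -tr'; lra.
  have [] := Hr x t (x1 x xr) (t1 t tr) (le_trans nx h3) (le_trans nt h3); rewrite !le_min.
  move=> _ /andP[b1 _] /andP[b2 _].
  have [] := Hr x t' (x1 x xr) (t1 t' tr') (le_trans nx h3) (le_trans nt' h3); rewrite !le_min.
  move=> /andP[_ b3] _ _.
  have [b4 _] := bound _ nx; have [_ b5] := bound _ nt'.
  have := Hd (psix x t) (psixx x t).
  have -> : `|psix x t - lx| <= d.
    have -> : psix x t - lx = (px x t - lx) - 2 * eta * (x - x0) by rewrite /psix; ring.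
    by apply: le_trans (ler_normB _ _) _; clear -b1 b4; lra.
  have -> : `|psixx x t - lxx| <= d.
    have -> : psixx x t - lxx = (pxx x t - lxx) - 2 * eta by rewrite /psixx; ring.
    by apply: le_trans (ler_normB _ _) _; rewrite (@ger0_norm _ (2 * eta)); clear -b2 eta1 eta0; lra.
  move=> /(_ isT isT); move: b3 b5 A0; rewrite /psit /A !ler_norml; clear; lra.
have sep x t : x0 - r <= x <= x0 + r -> t0 - r <= t <= t0 + r ->
    u x0 t0 - psi x0 t0 + eta * ((x - x0) ^+ 2 + (t - t0) ^+ 2) <= u x t - psi x t.
  move=> /x1 xr /t1 tr; have := Hm x t xr tr; rewrite /psi !subrr expr0n/= mulr0 !subr0.
  clear; lra.
have cont e : 0 < e -> exists2 d, 0 < d & forall t, `|t - t0| <= d ->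
    `|(u x0 t - psi x0 t) - (u x0 t0 - psi x0 t0)| <= e.
  move=> e0.
  have x0x : x0 - r1 <= x0 <= x0 + r1 by clear -r10; lra.
  have t0t : t0 - r1 <= t0 <= t0 + r1 by clear -r10; lra.
  have c1 := contwN (derw_contw (st x0 x0x)).
  have c2 := derw_contw (@derw_square R (t0 - r1) (t0 + r1) eta t0).
  have [q q0 Hq] := contwD cu (contwD c1 c2) t0t e0.
  exists (Num.min r1 q); first by rewrite lt_min r10.
  move=> t; rewrite le_min ler_norml => /andP[k1 k2].
  have := Hq t ltac:(clear -k1; lra) k2; rewrite /psi subrr expr0n/= mulr0.
  by congr (`|_| <= _); ring.
have x0X : x0 - r <= x0 <= x0 + r by clear -r0; lra.
have rho0 : 0 < r / 2 by clear -r0; lra.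
have rhor : r / 2 <= r by clear -r0; lra.
have rt0 : r < t0 by clear -h2 r1t; lra.
have [e0 e00 He] := discrete_min x0X rho0 rhor rt0 eta0 sep cont.
have [tau [w [p [m [tau0 taue dwp E aW]]]]] := ap e0 (t0 + r) e00.
have sub1 : x0 - r1 <= x0 - r by clear -h2; lra.
have sub2 : x0 + r <= x0 + r1 by clear -h2; lra.
have sub3 : t0 - r1 <= t0 - r by clear -h2; lra.
have sub4 : t0 + r <= t0 + r1 by clear -h2; lra.
have dx t : t0 - r <= t <= t0 + r -> derw (x0 - r) (x0 + r) (psi ^~ t) (psix ^~ t).
  move=> tr; have := derwB (derwB (derw_sub sub1 sub2 (sx t (t1 t tr)))
    (@derw_square R (x0 - r) (x0 + r) eta x0)) (@derw_affine R (x0 - r) (x0 + r) 0 (eta * (t - t0) ^+ 2)).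
  by apply: derw_ext => x _; rewrite /psi /psix /=; clear; ring.
have [||i [x [xX nx [n1 n2] tmin smin]]] := He e0 tau w (lexx e0) tau0 taue.
- by move=> i it; apply: derw_contw (derwB (derw_sub sub1 sub2 (dwp i).1) (dx _ it)).
- by move=> i x /x1 xX it; apply: aW.
have e4 : i.+1%:R * tau = i%:R * tau + tau by rewrite -natr1 mulrDl mul1r.
move: n1 n2 nx; rewrite !ler_norml e4 => n1 n2 nx; rewrite e4 in tmin smin.
have tr : t0 - r <= i%:R * tau + tau <= t0 + r by clear -n2 r0; lra.
have dxx : derw (x0 - r) (x0 + r) (psix ^~ (i%:R * tau + tau)) (psixx ^~ (i%:R * tau + tau)).
  have := derwB (derw_sub sub1 sub2 (sxx _ (t1 _ tr))) (@derw_affine R (x0 - r) (x0 + r) (2 * eta) (- (2 * eta * x0))).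
  by apply: derw_ext => y _; rewrite /psix /psixx /=; clear; ring.
have dt : derw (t0 - r) (t0 + r) (psi x) (psit x).
  have := derwB (derwB (derw_sub sub3 sub4 (st x (x1 x xX)))
    (@derw_affine R (t0 - r) (t0 + r) 0 (eta * (x - x0) ^+ 2))) (@derw_square R (t0 - r) (t0 + r) eta t0).
  by apply: derw_ext => t _; rewrite /psi /psit /=; clear; ring.
have xin : x0 - r < x < x0 + r by clear -nx r0; lra.
have s1 : t0 - r <= i%:R * tau by clear -n1 r0; lra.
have s2 : i%:R * tau + tau <= t0 + r by clear -tr; lra.
apply: (scheme_step_no_min f_incr g_gt0 tau0 (dx _ tr) dxx dt (derw_sub sub1 sub2 (dwp i.+1).1)
  (derw_sub sub1 sub2 (dwp i.+1).2) (E i x (x1 x xX)) xin s1 s2 _ tmin smin).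
by move=> t tt; apply: strict.
Qed.

(** * Touching a limit of schemes at a steep end *)

Section BoundaryTouching.

(** The mean value inequality up to an end at which only F is known to be
    continuous. *)
Lemma increment_to_end (R : realType) (a b K : R) (F D : R -> R) : a < b -> contw a b F ->
  (forall c, c < b -> derw a c F D) -> (forall x, a <= x < b -> D x <= K) ->
  F b - F a <= K * (b - a).
Proof.
move=> ab cF dF DK.
have K1 : 0 < 1 + `|K| by rewrite ltr_pwDl.
apply: (le_addgt0 K1) => e e0.
have bb : a <= b <= b by rewrite lexx ltW.
have [d d0 Hd] := cF b bb e e0.
pose h := Num.min (b - a) (Num.min d e) / 2.
have m0 : 0 < Num.min (b - a) (Num.min d e) by rewrite !lt_min subr_gt0 ab d0.
have [h1 h2 h3 h4] : [/\ 0 < h, h < b - a, h <= d & h <= e].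
  have m1 : Num.min (b - a) (Num.min d e) <= b - a by rewrite ge_min lexx.
  have m2 : Num.min (b - a) (Num.min d e) <= d by rewrite !ge_min lexx orbT.
  have m3 : Num.min (b - a) (Num.min d e) <= e by rewrite !ge_min lexx !orbT.
  by clear -m0 m1 m2 m3; rewrite /h; split; lra.
have c1 : a < b - h by clear -h2; lra.
have c2 : b - h < b by clear -h1; lra.
have [x xin E] := derw_mvt (dF _ c2) (lexx a) c1 (lexx _).
have Dx : D x <= K by apply: DK; clear -xin c2; lra.
have hb : `|F (b - h) - F b| <= e.
  apply: Hd; first by clear -c1 c2; lra.
  by rewrite addrAC subrr add0r normrN gtr0_norm.
have s1 : D x * (b - h - a) <= K * (b - h - a) by rewrite ler_wpM2r//; clear -c1; lra.
have s2 : - (K * h) <= `|K| * e.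
  have := ler_norm (- K); rewrite normrN; have := normr_ge0 K; clear -h1 h4; nra.
by move: hb; rewrite ler_norml; clear -E s1 s2; lra.
Qed.

(** Replace phi by psi = phi - (b - x) + B (b - x)^2 - (t - t0)^2. The linear term
    keeps the minimum of u - psi at (b, t0) and makes it strict, while B makes the
    second derivative so large that psi is a strict subsolution near the end. A
    discrete minimum of w_i - psi is then excluded inside by the equation, and at b
    by the slope N of w_i. *)
Lemma no_min_at_steep_end (R : realType) (f g : R -> R) (b t0 r0 Phi : R)
    (u phi pt px pxx : R -> R -> R) :
  {homo f : x y / x < y} -> f s @[s --> +oo] --> +oo ->
  continuous g -> (forall s, 0 < g s) -> 0 < r0 -> r0 < t0 -> 0 <= Phi ->
  (forall t, t0 - r0 <= t <= t0 + r0 -> contw (b - r0) b (phi ^~ t)) ->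
  (forall c t, t0 - r0 <= t <= t0 + r0 -> c < b -> derw (b - r0) c (phi ^~ t) (px ^~ t)) ->
  (forall c t, t0 - r0 <= t <= t0 + r0 -> c < b -> derw (b - r0) c (px ^~ t) (pxx ^~ t)) ->
  (forall x, b - r0 <= x < b -> derw (t0 - r0) (t0 + r0) (phi x) (pt x)) ->
  (forall x t, b - r0 <= x < b -> t0 - r0 <= t <= t0 + r0 ->
     [/\ `|pt x t| <= Phi, `|px x t| <= Phi & `|pxx x t| <= Phi]) ->
  contw (t0 - r0) (t0 + r0) (u b) -> contw (t0 - r0) (t0 + r0) (phi b) ->
  (forall e T, 0 < e -> exists tau N (w p m : nat -> R -> R),
    [/\ 0 < tau, tau <= e, e^-1 <= N,
      forall i, [/\ derw (b - r0) b (w i) (p i), derw (b - r0) b (p i) (m i) & p i b = N] &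
      (forall i x, b - r0 <= x <= b -> f (g (p i.+1 x) * m i.+1 x) = (w i.+1 x - w i x) / tau) /\
      forall i x, b - r0 <= x <= b -> i%:R * tau <= T -> `|u x (i%:R * tau) - w i x| <= e]) ->
  (forall x t, b - r0 <= x <= b -> t0 - r0 <= t <= t0 + r0 ->
     u b t0 - phi b t0 <= u x t - phi x t) -> False.
Proof.
move=> fi fp cg g0 r00 r0t Phi0 cphi sx sxx st bnd cu cpb ap Hm.
have PP : - (Phi + 1) <= Phi + 1 by clear -Phi0; lra.
have [z _ gm] := contw_max PP (contwN (continuous_contw (a := - (Phi + 1)) (b := Phi + 1) cg)).
have gz := g0 z.
have [s1 s10 fs1] : exists2 s, 0 < s & Phi + 3 <= f s.
  have [M [_ HM]] : \forall s \near +oo, Phi + 3 <= f s by move/cvgryPge : fp => /(_ (Phi + 3)).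
  exists (Num.max 1 (M + 1)); first by rewrite lt_max ltr01.
  by apply: HM; rewrite lt_max ltrDl ltr01 orbT.
(* g z is the least value of g at the slopes of psi, and 2 B - Phi is a lower
   bound for psi_xx: this B gives f (g (psi_x) psi_xx) >= f s1. *)
pose B := (s1 / g z + Phi) / 2.
have sg : 0 < s1 / g z by rewrite divr_gt0.
have B0 : 0 < B by rewrite /B; clear -sg Phi0; lra.
have BE : g z * (2 * B - Phi) = s1 by rewrite /B; field; rewrite gt_eqF.
pose r := Num.min r0 (Num.min 1 (2 * (B + 1))^-1).
have B2 : 0 < 2 * (B + 1) by clear -B0; lra.
have r_gt0 : 0 < r by rewrite !lt_min r00 ltr01 invr_gt0.
have [h1 h2 h3] : [/\ r <= r0, r <= 1 & r * (2 * (B + 1)) <= 1].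
  by rewrite -ler_pdivlMr// div1r /r; split; rewrite !ge_min lexx ?orbT.
pose psi x t := phi x t - (b - x) + B * (b - x) ^+ 2 - (t - t0) ^+ 2.
pose psix x t := px x t + 1 - 2 * B * (b - x).
pose psixx x t := pxx x t + 2 * B.
pose psit x t := pt x t - 2 * (t - t0).
have x1 x : b - r <= x <= b -> b - r0 <= x <= b by clear -h1; lra.
have x1' x : b - r <= x < b -> b - r0 <= x < b by clear -h1; lra.
have t1 t : t0 - r <= t <= t0 + r -> t0 - r0 <= t <= t0 + r0 by clear -h1; lra.
have Bb x : b - r <= x <= b -> 0 <= 2 * B * (b - x) <= 1.
  by clear -B0 h3 r_gt0 => xb; apply/andP; split; nra.
have slope x t : b - r <= x < b -> t0 - r <= t <= t0 + r -> `|psix x t| <= Phi + 1.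
  move=> xr tr; have [_ + _] := bnd x t (x1' x xr) (t1 t tr).
  have := Bb x ltac:(clear -xr; lra); rewrite /psix !ler_norml; clear; lra.
have strict x t t' : b - r <= x < b -> t0 - r <= t <= t0 + r -> t0 - r <= t' <= t0 + r ->
    psit x t' < f (g (psix x t) * psixx x t).
  move=> xr tr tr'.
  have [_ _ b2] := bnd x t (x1' x xr) (t1 t tr).
  have [b3 _ _] := bnd x t' (x1' x xr) (t1 t' tr').
  have gg : g z <= g (psix x t).
    by have := gm (psix x t); rewrite lerN2; apply; rewrite -ler_norml; exact: slope.
  have fs : f s1 <= f (g (psix x t) * psixx x t).
    apply: (homo_lt_le fi); rewrite -BE; apply: ler_pM => //; first exact: ltW.
      have : 0 < g z * (2 * B - Phi) by rewrite BE.
      by rewrite pmulr_rgt0// => /ltW.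
    by move: b2; rewrite /psixx ler_norml; clear; lra.
  by move: b3 fs fs1 tr'; rewrite /psit ler_norml; clear -h2; lra.
have sep x t : b - r <= x <= b -> t0 - r <= t <= t0 + r ->
    u b t0 - psi b t0 + 1 * ((x - b) ^+ 2 + (t - t0) ^+ 2) <= u x t - psi x t.
  move=> xr tr; have := Hm x t (x1 x xr) (t1 t tr).
  have : (B + 1) * (b - x) ^+ 2 <= b - x.
    have [y0 yr] : 0 <= b - x /\ b - x <= r by clear -xr; split; lra.
    rewrite expr2 mulrA ler_piMl//; apply: le_trans (_ : (B + 1) * r <= 1).
      by rewrite ler_pM2l//; clear -B0; lra.
    by clear -h3 r_gt0 B0; lra.
  rewrite /psi !subrr expr0n/= mulr0 subr0 mul1r -(sqrrN (x - b)) opprB.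
  clear; lra.
have cont e : 0 < e -> exists2 d, 0 < d & forall t, `|t - t0| <= d ->
    `|(u b t - psi b t) - (u b t0 - psi b t0)| <= e.
  move=> e0.
  have t0t : t0 - r0 <= t0 <= t0 + r0 by clear -r00; lra.
  have c2 := derw_contw (@derw_square R (t0 - r0) (t0 + r0) 1 t0).
  have [q q0 Hq] := contwD cu (contwD (contwN cpb) c2) t0t e0.
  exists (Num.min r0 q); first by rewrite lt_min r00.
  move=> t; rewrite le_min ler_norml => /andP[k1 k2].
  have := Hq t ltac:(clear -k1; lra) k2; rewrite /psi !subrr expr0n/= !mulr0.
  by congr (`|_| <= _); ring.
have x0X : b - r <= b <= b by clear -r_gt0; lra.
have rho0 : 0 < r / 2 by clear -r_gt0; lra.
have rhor : r / 2 <= r by clear -r_gt0; lra.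
have rt0 : r < t0 by clear -h1 r0t; lra.
have [e0 e00 He] := discrete_min x0X rho0 rhor rt0 ltr01 sep cont.
have P4 : 0 < Phi + 4 by clear -Phi0; lra.
pose e := Num.min e0 (Phi + 4)^-1.
have e_gt0 : 0 < e by rewrite lt_min e00 invr_gt0.
have [tau [N [w [p [m [tau0 taue eN dwp [E aW]]]]]]] := ap e (t0 + r) e_gt0.
have NP : Phi + 4 <= N.
  by apply: le_trans eN; rewrite -[Phi + 4]invrK lef_pV2 ?posrE ?invr_gt0// ge_min lexx orbT.
have sub1 : b - r0 <= b - r by clear -h1; lra.
have dq : derw (b - r) b (fun x => - (b - x) + B * (b - x) ^+ 2) (fun x => 1 - 2 * B * (b - x)).
  have := derwD (@derw_affine R (b - r) b 1 (- b)) (@derw_square R (b - r) b B b).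
  by apply: derw_ext => x _; clear; ring.
have cpsi t : t0 - r <= t <= t0 + r -> contw (b - r) b (psi ^~ t).
  move=> tr; have := contwD (contwD (contw_sub sub1 (lexx b) (cphi t (t1 t tr))) (derw_contw dq))
    (derw_contw (@derw_affine R (b - r) b 0 (- (t - t0) ^+ 2))).
  move=> H x xb q q0; have [d d0 K] := H x xb q q0; exists d => // y yb yx.
  by have := K y yb yx; rewrite /psi; congr (`|_| <= _); ring.
have dx c t : t0 - r <= t <= t0 + r -> c < b -> derw (b - r) c (psi ^~ t) (psix ^~ t).
  move=> tr cb; have := derwD (derwD (derw_sub sub1 (lexx c) (sx c t (t1 t tr) cb)) (derw_sub (lexx _) (ltW cb) dq))
    (@derw_affine R (b - r) c 0 (- (t - t0) ^+ 2)).
  by apply: derw_ext => x _; rewrite /psi /psix /=; clear; ring.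
have ee0 : e <= e0 by rewrite ge_min lexx.
have [||i [x [xX nx [n1 n2] tmin smin]]] := He e tau w ee0 tau0 taue.
- move=> i it; have [dwi _ _] := dwp i.
  exact: contwD (contw_sub sub1 (lexx b) (derw_contw dwi)) (contwN (cpsi _ it)).
- by move=> i x /x1 xX it; apply: aW.
have e4 : i.+1%:R * tau = i%:R * tau + tau by rewrite -natr1 mulrDl mul1r.
move: n1 n2 nx; rewrite !ler_norml e4 => n1 n2 nx; rewrite e4 in tmin smin.
have tr : t0 - r <= i%:R * tau + tau <= t0 + r by clear -n2 r_gt0; lra.
have [dwi dpi pN] := dwp i.+1.
have xltb : x < b.
  rewrite lt_neqAle; case/andP: (xX) => _ ->; rewrite andbT; apply/eqP => xE.
  have half : 0 < 1 / 2 :> R by clear; lra.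
  have bb : b - r0 <= b <= b by clear -r00; lra.
  have [d d0 Hd] := dwi b bb _ half.
  pose h := Num.min d r.
  have hp : 0 < h by rewrite lt_min d0.
  have hd : h <= d by rewrite /h ge_min lexx.
  have hr : h <= r by rewrite /h ge_min lexx orbT.
  have yX : b - r <= b - h <= b by clear -hp hr; lra.
  have := Hd (b - h) (x1 _ yX); rewrite addrAC subrr add0r normrN (gtr0_norm hp) pN => /(_ hd).
  have yb : b - h < b by clear -hp; lra.
  have inc : psi b (i%:R * tau + tau) - psi (b - h) (i%:R * tau + tau) <= (Phi + 1) * (b - (b - h)).
    have sub2 : b - r <= b - h by clear -yX; lra.
    apply: (increment_to_end yb (contw_sub sub2 (lexx b) (cpsi _ tr)) (D := psix ^~ (i%:R * tau + tau))).
      by move=> c cb; apply: derw_sub sub2 (lexx c) (dx c _ tr cb).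
    move=> y yy; apply: le_trans (ler_norm _) _; apply: slope => //; clear -yy yX; lra.
  have := smin (b - h) yX; rewrite xE ler_norml; clear -inc hp NP; nra.
have xin : b - r < x < (x + b) / 2 by clear -nx xltb r_gt0; lra.
have cb : (x + b) / 2 < b by clear -xltb; lra.
have sub3 : (x + b) / 2 <= b by clear -cb; lra.
have dxx : derw (b - r) ((x + b) / 2) (psix ^~ (i%:R * tau + tau)) (psixx ^~ (i%:R * tau + tau)).
  have := derwD (derw_sub sub1 (lexx _) (sxx _ _ (t1 _ tr) cb))
    (@derw_affine R (b - r) ((x + b) / 2) (2 * B) (1 - 2 * B * b)).
  by apply: derw_ext => y _; rewrite /psix /psixx /=; clear; ring.
have xr : b - r <= x < b by clear -xin xltb; lra.
have sub4 : t0 - r0 <= t0 - r by clear -h1; lra.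
have sub5 : t0 + r <= t0 + r0 by clear -h1; lra.
have dt : derw (t0 - r) (t0 + r) (psi x) (psit x).
  have := derwB (derwD (derw_sub sub4 sub5 (st x (x1' x xr)))
    (@derw_affine R (t0 - r) (t0 + r) 0 (- (b - x) + B * (b - x) ^+ 2)))
    (@derw_square R (t0 - r) (t0 + r) 1 t0).
  by apply: derw_ext => t _; rewrite /psi /psit /=; clear; ring.
have s2 : t0 - r <= i%:R * tau by clear -n1 r_gt0; lra.
have s3 : i%:R * tau + tau <= t0 + r by clear -tr; lra.
apply: (scheme_step_no_min fi g0 tau0 (dx _ _ tr cb) dxx dt (derw_sub sub1 sub3 dwi)
  (derw_sub sub1 sub3 dpi) (E i x (x1 x xX)) xin s2 s3 _ tmin).
  by move=> t tt; apply: strict.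
by move=> y yy; apply: smin; clear -yy cb; lra.
Qed.

End BoundaryTouching.

(** * Limits of schemes are viscosity solutions *)

Section SchemeLimits.
Variable R : realType.
Implicit Types (b x t a c : R) (f g F D : R -> R) (u phi : R * R -> R).

(** The condition e^-1 <= N makes the slopes at the ends infinite in the limit. *)
Definition approximable (b : R) (f g : R -> R) (u : R * R -> R) : Prop :=
  forall e T : R, 0 < e -> exists tau N L (w p m : nat -> R -> R),
    [/\ 0 < tau, tau <= e, e^-1 <= N, scheme b f g tau N L w p m &
      forall i x, - b <= x <= b -> i%:R * tau <= T -> `|u (x, i%:R * tau) - w i x| <= e].

Lemma continuous_lsc (A : set (R * R)) (u : R * R -> R) :
  {within A, continuous u} -> lsc_on A u.
Proof.
move=> cu x a; rewrite lte_fin => ax.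
exists [set y | a < u y]; last by move=> y; rewrite lte_fin.
exact: (cvgr_gt (u x) (cu x) a ax).
Qed.

Lemma euler_approximable_sub b f g u xl xr : - b <= xl -> xr <= b -> approximable b f g u ->
  euler_approximable f g xl xr (fun x t => u (x, t)).
Proof.
move=> bl br ap e T e0; have [tau [N [L [w [p [m [t0 te _ [dw dp _ E _] H]]]]]]] := ap e T e0.
have I x : xl <= x <= xr -> - b <= x <= b by clear -bl br; lra.
exists tau, w, p, m; split => //.
- by move=> i; split; apply: derw_sub bl br _.
- by move=> i x /I; exact: E.
- by move=> i x /I; exact: H.
Qed.

(** Changing signs exchanges subsolutions and supersolutions. *)
Lemma euler_approximable_opp b f g u xl xr : - b <= xl -> xr <= b -> approximable b f g u ->
  euler_approximable (fun s => - f (- s)) (fun s => g (- s)) xl xr (fun x t => - u (x, t)).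
Proof.
move=> bl br ap e T e0; have [tau [N [L [w [p [m [t0 te _ [dw dp _ E _] H]]]]]]] := ap e T e0.
have I x : xl <= x <= xr -> - b <= x <= b by clear -bl br; lra.
exists tau, (fun i x => - w i x), (fun i x => - p i x), (fun i x => - m i x); split => //.
- by move=> i; split; apply: derwN; apply: derw_sub bl br _.
- move=> i x /I xb; rewrite opprK mulrN opprK E//; ring.
- by move=> i x /I xb it; rewrite -opprD normrN; exact: H.
Qed.

Lemma interior_box b (phi : R * R -> R) x0 t0 dm : C2_chalfstrip b phi -> - b < x0 < b ->
  0 < t0 -> 0 < dm -> exists r : R, [/\ 0 < r, r < t0, r <= dm, - b < x0 - r /\ x0 + r < b &
   [/\ forall t, t0 - r <= t <= t0 + r ->
         derw (x0 - r) (x0 + r) (fun x => phi (x, t)) (phix phi ^~ t),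
       forall t, t0 - r <= t <= t0 + r -> derw (x0 - r) (x0 + r) (phix phi ^~ t) (phixx phi ^~ t),
       forall x, x0 - r <= x <= x0 + r ->
         derw (t0 - r) (t0 + r) (fun t => phi (x, t)) (phit phi x) &
       forall e, 0 < e -> exists2 d, 0 < d & forall x t,
         x0 - r <= x <= x0 + r -> t0 - r <= t <= t0 + r -> `|x - x0| <= d -> `|t - t0| <= d ->
         [/\ `|phit phi x t - phit phi x0 t0| <= e, `|phix phi x t - phix phi x0 t0| <= e &
             `|phixx phi x t - phixx phi x0 t0| <= e]]].
Proof.
move=> C2 xb tp dm0.
have [sx sxx st] := C2_slices C2.
have xb' : - b <= x0 <= b by clear -xb; lra.
have [lt [lx [lxx [/(_ xb)[-> -> ->] lim]]]] := C2_limits C2 xb' tp.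
pose r := Num.min dm (Num.min (t0 / 2) (Num.min ((b - x0) / 2) ((b + x0) / 2))).
have r0 : 0 < r by rewrite !lt_min dm0 /=; clear -tp xb; lra.
have [h1 h2 h3 h4] : [/\ r <= dm, r <= t0 / 2, r <= (b - x0) / 2 & r <= (b + x0) / 2].
  by rewrite /r; split; rewrite !ge_min lexx ?orbT.
have a1 : - b < x0 - r by clear -h4 xb; lra.
have a2 : x0 + r < b by clear -h3 xb; lra.
have tpos t : t0 - r <= t <= t0 + r -> 0 < t by clear -h2 tp; lra.
have xin x : x0 - r <= x <= x0 + r -> - b < x < b by clear -a1 a2; lra.
exists r; split => //; first by clear -h2 tp; lra.
split.
- by move=> t /tpos; apply: sx.
- by move=> t /tpos; apply: sxx.
- by move=> x /xin xx; apply: st => //; clear -h2 tp; lra.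
- move=> e e0; have [d d0 H] := lim e e0; exists d => // x t /xin xx /tpos tt; exact: H.
Qed.

Lemma stable_supersolution b f g u phi p : continuous f -> {homo f : x y / x < y} ->
  continuous g -> (forall s, 0 < g s) -> {within chalfstrip b, continuous u} ->
  approximable b f g u -> C2_chalfstrip b phi -> halfstrip b p ->
  local_min_on (chalfstrip b) (fun q => u q - phi q) p -> 0 <= pde_operator f g phi p.
Proof.
case: p => x0 t0 cf fi cg g0 cu ap C2 /halfstripE[xb tp] /local_min_onP[dm dm0 Hm].
have [r [r0 rt rd [a1 a2] [sx sxx st lim]]] := interior_box C2 xb tp dm0.
have xb' : - b <= x0 <= b by clear -xb; lra.
have cut : contw (t0 - r) (t0 + r) (fun t => u (x0, t)).
  have cs := chalfstrip_contw2 (T := t0 + r) cu.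
  move=> t tr e e0; have [|d d0 H] := cs x0 t xb' _ e e0; first by clear -tr rt; lra.
  exists d => // s sr sd; apply: H => //; first by clear -sr rt; lra.
  by rewrite subrr normr0 ltW.
have eu := euler_approximable_sub (ltW a1) (ltW a2) ap.
have := touching_from_below (phi := fun x t => phi (x, t)) (u := fun x t => u (x, t))
  cf fi cg g0 r0 rt sx sxx st lim cut eu.
rewrite /pde_operator subr_ge0; apply => x t xr tr.
have cq : chalfstrip b (x, t) by apply/chalfstripE; clear -xr tr rt a1 a2; split; lra.
by apply: (Hm (x, t) cq); rewrite ler_norml /=; [clear -xr rd|clear -tr rd]; lra.
Qed.

Lemma stable_subsolution b f g u phi p : continuous f -> {homo f : x y / x < y} ->
  continuous g -> (forall s, 0 < g s) -> {within chalfstrip b, continuous u} ->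
  approximable b f g u -> C2_chalfstrip b phi -> halfstrip b p ->
  local_max_on (chalfstrip b) (fun q => u q - phi q) p -> pde_operator f g phi p <= 0.
Proof.
case: p => x0 t0 cf fi cg g0 cu ap C2 /halfstripE[xb tp] /local_max_onP[dm dm0 Hm].
have [r [r0 rt rd [a1 a2] [sx sxx st lim]]] := interior_box C2 xb tp dm0.
have xb' : - b <= x0 <= b by clear -xb; lra.
have cut : contw (t0 - r) (t0 + r) (fun t => - u (x0, t)).
  have cs := chalfstrip_contw2 (T := t0 + r) cu.
  apply: contwN => t tr e e0; have [|d d0 H] := cs x0 t xb' _ e e0; first by clear -tr rt; lra.
  exists d => // s sr sd; apply: H => //; first by clear -sr rt; lra.
  by rewrite subrr normr0 ltW.
have eu := euler_approximable_opp (ltW a1) (ltW a2) ap.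
have cN (F : R -> R) : continuous F -> continuous (fun s => F (- s)).
  by move=> cF s; apply: continuous_comp; [apply: cvgN; exact: cvg_id|exact: cF].
have cf' : continuous (fun s => - f (- s)) by move=> s; apply: cvgN; exact: cN.
have fi' : {homo (fun s => - f (- s)) : x y / x < y}.
  by move=> x y xy; rewrite ltrN2; apply: fi; rewrite ltrN2.
have key : - f (- (g (- - phix phi x0 t0) * - phixx phi x0 t0)) <= - phit phi x0 t0.
  apply: (touching_from_below (phi := fun x t => - phi (x, t)) (u := fun x t => - u (x, t))
    (px := fun x t => - phix phi x t) (pxx := fun x t => - phixx phi x t)
    (pt := fun x t => - phit phi x t)
    cf' fi' (cN g cg) (fun s => g0 (- s)) r0 rt (fun t tr => derwN (sx t tr))
    (fun t tr => derwN (sxx t tr)) (fun x xr => derwN (st x xr)) _ cut eu).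
    move=> e e0; have [d d0 H] := lim e e0; exists d => // x t xr tr xd td.
    have EN (c d1 : R) : `|- c - - d1| = `|c - d1| by rewrite -opprD normrN.
    have [i1 i2 i3] := H x t xr tr xd td.
    by split; rewrite EN; [exact: i1|exact: i2|exact: i3].
  move=> x t xr tr.
  have cq : chalfstrip b (x, t) by apply/chalfstripE; clear -xr tr rt a1 a2; split; lra.
  suff : u (x, t) - phi (x, t) <= u (x0, t0) - phi (x0, t0) by clear; lra.
  by apply: (Hm (x, t) cq); rewrite ler_norml /=; [clear -xr rd|clear -tr rd]; lra.
by move: key; rewrite opprK mulrN opprK lerN2 /pde_operator subr_le0.
Qed.

Lemma time_slice b (u : R * R -> R) x0 t0 r : {within chalfstrip b, continuous u} ->
  - b <= x0 <= b -> r < t0 -> contw (t0 - r) (t0 + r) (fun t => u (x0, t)).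
Proof.
move=> cu xb rt; have cs := chalfstrip_contw2 (T := t0 + r) cu.
move=> t tr e e0; have [|d d0 H] := cs x0 t xb _ e e0; first by clear -tr rt; lra.
exists d => // s sr sd; apply: H => //; first by clear -sr rt; lra.
by rewrite subrr normr0 ltW.
Qed.

Lemma stable_right b f g u phi t0 : 0 < b -> {homo f : x y / x < y} ->
  f s @[s --> +oo] --> +oo -> continuous g -> (forall s, 0 < g s) ->
  {within chalfstrip b, continuous u} -> approximable b f g u -> C2_chalfstrip b phi -> 0 < t0 ->
  ~ local_min_on (chalfstrip b) (fun q => u q - phi q) (b, t0).
Proof.
move=> b0 fi fp cg g0 cu ap C2 tp /local_min_onP[dm dm0 Hm].
have [sx sxx st] := C2_slices C2.
have bb : - b <= b <= b by clear -b0; lra.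
have [lt [lx [lxx [_ lim]]]] := C2_limits C2 bb tp.
have [d d0 Hd] := lim 1 ltr01.
pose r := Num.min b (Num.min dm (Num.min (t0 / 2) d)).
have r0 : 0 < r by rewrite !lt_min b0 dm0 d0 divr_gt0.
have [h1 h2 h3 h4] : [/\ r <= b, r <= dm, r <= t0 / 2 & r <= d].
  by rewrite /r; split; rewrite !ge_min lexx ?orbT.
have rt : r < t0 by clear -h3 tp; lra.
have tpos t : t0 - r <= t <= t0 + r -> 0 < t by clear -h3 tp; lra.
have lb : - b < b - r by clear -h1 b0; lra.
apply: (@no_min_at_steep_end R f g b t0 r (1 + `|lt| + `|lx| + `|lxx|)
  (fun x t => u (x, t)) (fun x t => phi (x, t)) (phit phi) (phix phi) (phixx phi)) => //.
- move=> t /tpos t1; have c2 := chalfstrip_contw2 (T := t) C2.1.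
  apply: (contw_sub (ltW lb) (lexx b)); apply: (contw2_sections c2); clear -t1; lra.
- by move=> c t /tpos t1 cb; apply: sx.
- by move=> c t /tpos t1 cb; apply: sxx.
- move=> x xr; apply: st; last by clear -rt; lra.
  by clear -xr lb; lra.
- move=> x t xr tr.
  have xin : - b < x < b by clear -xr lb; lra.
  have [] := Hd x t xin (tpos t tr); rewrite ?ler_norml; [clear -xr h4; clear -h4 xr; lra|clear -tr h4; clear -h4 tr; lra|].
  have nb (z : R) : - z <= `|z| /\ z <= `|z|.
    by have := lexx `|z|; rewrite {1}ler_norml => /andP[h _]; split; [rewrite lerNl|exact: ler_norm].
  have [[n1 n2] [n3 n4] [n5 n6]] := And3 (nb lt) (nb lx) (nb lxx).
  move=> q1 q2 q3; split; rewrite ?ler_norml.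
  + by clear -q1 n1 n2 n3 n4 n5 n6; lra.
  + by clear -q2 n1 n2 n3 n4 n5 n6; lra.
  + by clear -q3 n1 n2 n3 n4 n5 n6; lra.
- exact: time_slice cu bb rt.
- exact: time_slice C2.1 bb rt.
- move=> e T e0; have [tau [N [L [w [p [m [t1 te eN [dw dp bc E _] H]]]]]]] := ap e T e0.
  have I x : b - r <= x <= b -> - b <= x <= b by clear -lb; lra.
  exists tau, N, w, p, m; split => //.
    by move=> i; split; [exact: derw_sub (ltW lb) (lexx b) (dw i)|
      exact: derw_sub (ltW lb) (lexx b) (dp i)|have [] := bc i].
  by split=> i x /I xb; [exact: E|exact: H].
- move=> x t xr tr.
  have cq : chalfstrip b (x, t) by apply/chalfstripE; clear -xr tr rt lb; split; lra.
  by apply: (Hm (x, t) cq); rewrite ler_norml /=; [clear -xr h2 r0|clear -tr h2]; lra.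
Qed.

(** Reflection of the space variable exchanges the ends. *)
Lemma stable_left b f g u phi t0 : 0 < b -> {homo f : x y / x < y} ->
  f s @[s --> +oo] --> +oo -> continuous g -> (forall s, 0 < g s) ->
  {within chalfstrip b, continuous u} -> approximable b f g u -> C2_chalfstrip b phi -> 0 < t0 ->
  ~ local_min_on (chalfstrip b) (fun q => u q - phi q) (- b, t0).
Proof.
move=> b0 fi fp cg g0 cu ap C2 tp /local_min_onP[dm dm0 Hm].
have [sx sxx st] := C2_slices C2.
have bb : - b <= - b <= b by clear -b0; lra.
have [lt [lx [lxx [_ lim]]]] := C2_limits C2 bb tp.
have [d d0 Hd] := lim 1 ltr01.
pose r := Num.min b (Num.min dm (Num.min (t0 / 2) d)).
have r0 : 0 < r by rewrite !lt_min b0 dm0 d0 divr_gt0.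
have [h1 h2 h3 h4] : [/\ r <= b, r <= dm, r <= t0 / 2 & r <= d].
  by rewrite /r; split; rewrite !ge_min lexx ?orbT.
have rt : r < t0 by clear -h3 tp; lra.
have tpos t : t0 - r <= t <= t0 + r -> 0 < t by clear -h3 tp; lra.
have lb : - b < b - r by clear -h1 b0; lra.
have cg' : continuous (fun s => g (- s)).
  by move=> s; apply: continuous_comp; [apply: cvgN; exact: cvg_id|exact: cg].
apply: (@no_min_at_steep_end R f (fun s => g (- s)) b t0 r (1 + `|lt| + `|lx| + `|lxx|)
  (fun x t => u (- x, t)) (fun x t => phi (- x, t)) (fun x => phit phi (- x))
  (fun x t => - phix phi (- x) t) (fun x => phixx phi (- x))) => //.
- move=> t /tpos t1; have c2 := chalfstrip_contw2 (T := t) C2.1.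
  have tt : 0 <= t <= t by clear -t1; lra.
  move=> x xb e e0; have [|q q0 H] := contw2_sections c2 tt (x := - x) _ e0; first by clear -xb lb; lra.
  exists q => // y yb yx; apply: H; first by clear -yb lb; lra.
  by rewrite -opprD normrN.
- move=> c t /tpos t1 cb; have := derw_reflect (sx (- c) (- (b - r)) t _ _ t1).
  rewrite !opprK; apply; [clear -cb|clear -lb]; lra.
- move=> c t /tpos t1 cb; have := derwN (derw_reflect (sxx (- c) (- (b - r)) t _ _ t1)).
  rewrite !opprK => H; have {}H := H ltac:(clear -cb; lra) ltac:(clear -lb; lra).
  by apply: derw_ext H => // x _; rewrite opprK.
- move=> x xr; apply: st; last by clear -rt; lra.
  by clear -xr lb; lra.
- move=> x t xr tr.
  have xin : - b < - x < b by clear -xr lb; lra.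
  have [] := Hd (- x) t xin (tpos t tr); rewrite ?ler_norml; [clear -xr h4; lra|clear -tr h4; lra|].
  have nb (z : R) : - z <= `|z| /\ z <= `|z|.
    by have := lexx `|z|; rewrite {1}ler_norml => /andP[h _]; split; [rewrite lerNl|exact: ler_norm].
  have [[n1 n2] [n3 n4] [n5 n6]] := And3 (nb lt) (nb lx) (nb lxx).
  move=> q1 q2 q3; split; rewrite ?ler_norml.
  + by clear -q1 n1 n2 n3 n4 n5 n6; lra.
  + by clear -q2 n1 n2 n3 n4 n5 n6; lra.
  + by clear -q3 n1 n2 n3 n4 n5 n6; lra.
- exact: time_slice cu bb rt.
- exact: time_slice C2.1 bb rt.
- move=> e T e0; have [tau [N [L [w [p [m [t1 te eN [dw dp bc E _] H]]]]]]] := ap e T e0.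
  have I x : b - r <= x <= b -> - b <= - x <= b by clear -lb; lra.
  exists tau, N, (fun i x => w i (- x)), (fun i x => - p i (- x)), (fun i x => m i (- x)); split => //.
    move=> i; split.
    + exact: derw_sub (ltW lb) (lexx b) (derw_reflect_sym (dw i)).
    + have := derwN (derw_reflect_sym (dp i)) => D2; apply: (derw_sub (ltW lb) (lexx b)).
      by move: D2; apply: derw_ext => // x _; rewrite opprK.
    + by have [-> _] := bc i; rewrite opprK.
  split=> i x /I xb; last exact: H.
  by rewrite opprK E.
- move=> x t xr tr.
  have cq : chalfstrip b (- x, t) by apply/chalfstripE; clear -xr tr rt lb; split; lra.
  by apply: (Hm (- x, t) cq); rewrite ler_norml /=; [clear -xr h2 r0|clear -tr h2]; lra.
Qed.

Theorem approximable_solution b f g u : 0 < b -> continuous f -> {homo f : x y / x < y} ->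
  f s @[s --> +oo] --> +oo -> continuous g -> (forall s, 0 < g s) ->
  {within chalfstrip b, continuous u} -> approximable b f g u -> viscosity_solution b f g u.
Proof.
move=> b0 cf fi fp cg g0 cu ap; split => //.
  split; last by move=> phi p C2 hp; exact: stable_subsolution.
  by apply: continuous_lsc => x; apply: continuousN; exact: cu.
split; first exact: continuous_lsc.
  by move=> phi p C2 hp; exact: stable_supersolution.
by move=> phi t C2 t0; split; [exact: (stable_right b0 fi fp cg g0 cu ap C2 t0)|exact: (stable_left b0 fi fp cg g0 cu ap C2 t0)].
Qed.

End SchemeLimits.

(** * Existence and uniqueness *)

Section Existence.

Lemma filter_bounded_forall (U : set_system nat) (P : nat -> set nat) (K : nat) : Filter U ->
  (forall k, U (P k)) -> U [set n | forall k, (k < K)%N -> P k n].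
Proof.
move=> FU UP; elim: K => [|K IH]; first by apply: filterS filterT => n _ k.
apply: filterS (filterI IH (UP K)) => n [/= H1 H2] k.
by rewrite ltnS leq_eqVlt => /predU1P[->//|]; exact: H1.
Qed.

Lemma grid_point (R : realType) (h x : R) : 0 < h -> 0 <= x ->
  (Num.truncn (x / h))%:R * h <= x /\ `|x - (Num.truncn (x / h))%:R * h| <= h.
Proof.
move=> h0 x0; have /truncn_itv : 0 <= x / h by rewrite divr_ge0// ltW.
rewrite ler_pdivlMr// ltr_pdivrMr// -natr1 mulrDl mul1r => /andP[h1 h2].
by split => //; rewrite ger0_norm; clear -h1 h2; lra.
Qed.

(** The schemes are equicontinuous in space through dl and equi-Lipschitz in time
    through L, up to the time step. Ultralimits thus exist and are continuous, and
    the convergence at the points of a finite grid is uniform up to any time. *)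
Lemma scheme_limit (R : realType) (b : R) (f g u0 : R -> R) (e L Ns : R) (dl : R -> R) :
  0 < b -> {homo f : x y / x < y} -> (forall s, 0 < g s) -> contw (- b) b u0 -> 0 < e ->
  0 <= L -> (forall r, 0 < r -> 0 < dl r) ->
  (forall N tau, Ns <= N -> 0 < tau -> exists w p m : nat -> R -> R,
      [/\ scheme b f g tau N L w p m,
          forall x, - b <= x <= b -> `|w 0%N x - u0 x| <= e &
          forall i r x y, 0 < r -> - b <= x <= b -> - b <= y <= b -> `|x - y| <= dl r ->
            `|w i x - w i y| <= r]) ->
  exists u : R * R -> R, [/\ {within chalfstrip b, continuous u}, approximable b f g u &
    forall x, - b <= x <= b -> `|u (x, 0) - u0 x| <= e].
Proof.
move=> b0 fi g0 cu e0 L0 dl0 fam.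
pose tau n : R := n.+1%:R^-1.
have tau0 n : 0 < tau n by rewrite invr_gt0.
pose NN n : R := `|Ns| + n.+1%:R.
have NsN n : Ns <= NN n by rewrite /NN; apply: le_trans (ler_norm _) _; rewrite lerDl.
have /choice[z Hz] : forall n, exists z : (nat -> R -> R) * (nat -> R -> R) * (nat -> R -> R),
    [/\ scheme b f g (tau n) (NN n) L z.1.1 z.1.2 z.2,
      forall x, - b <= x <= b -> `|z.1.1 0%N x - u0 x| <= e &
      forall i r x y, 0 < r -> - b <= x <= b -> - b <= y <= b -> `|x - y| <= dl r ->
        `|z.1.1 i x - z.1.1 i y| <= r].
  by move=> n; have [w [p [m H]]] := fam _ _ (NsN n) (tau0 n); exists (w, p, m).
pose j n t := Num.truncn (t / tau n).
pose W n x t := (z n).1.1 (j n t) x.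
have drift n i k x : - b <= x <= b ->
    `|(z n).1.1 k x - (z n).1.1 i x| <= L * `|k%:R * tau n - i%:R * tau n|.
  by move=> xb; have [S _ _] := Hz n; exact: (scheme_drift b0 (tau0 n) fi g0 S).
have jt n t : 0 <= t -> (j n t)%:R * tau n <= t /\ `|t - (j n t)%:R * tau n| <= tau n.
  exact: grid_point.
have ji n i : j n (i%:R * tau n) = i by rewrite /j mulfK ?gt_eqF// natrK.
have equi n r x y t s : 0 < r -> - b <= x <= b -> - b <= y <= b -> 0 <= t -> 0 <= s ->
    `|x - y| <= dl r -> `|W n x t - W n y s| <= r + L * (`|t - s| + 2 * tau n).
  move=> r0 xb yb tp sp xy; have [_ _ H] := Hz n.
  have -> : W n x t - W n y s = ((z n).1.1 (j n t) x - (z n).1.1 (j n t) y) +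
     ((z n).1.1 (j n t) y - (z n).1.1 (j n s) y) by rewrite /W; ring.
  apply: le_trans (ler_normD _ _) _; apply: lerD; first exact: H.
  apply: le_trans (drift n (j n s) (j n t) y yb) _; rewrite ler_wpM2l//.
  have [_ a1] := jt n t tp; have [_ a2] := jt n s sp.
  have -> : (j n t)%:R * tau n - (j n s)%:R * tau n =
    (t - s) + ((s - (j n s)%:R * tau n) - (t - (j n t)%:R * tau n)) by ring.
  apply: le_trans (ler_normD _ _) _; rewrite lerD2l.
  by apply: le_trans (ler_normB _ _) _; clear -a1 a2; lra.
have [V V0 HV] := contw_bounded cu.
have Wb n (q : R * R) : `|W n (clamp b q.1) (Num.max q.2 0)| <= V + e + L * Num.max q.2 0.
  have cb := clampP q.1 (ltW b0); have m0 : 0 <= Num.max q.2 0 by rewrite le_max lexx orbT.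
  have [_ H _] := Hz n; have h1 := H _ cb; have h2 := HV _ cb.
  have h3 := drift n 0%N (j n (Num.max q.2 0)) _ cb.
  have [h4 _] := jt n _ m0.
  have j0 : 0 <= (j n (Num.max q.2 0))%:R * tau n by rewrite mulr_ge0// ltW.
  rewrite mul0r subr0 (ger0_norm j0) in h3.
  have h5 : L * ((j n (Num.max q.2 0))%:R * tau n) <= L * Num.max q.2 0 by rewrite ler_wpM2l.
  have := ler_normD ((z n).1.1 (j n (Num.max q.2 0)) (clamp b q.1) - (z n).1.1 0%N (clamp b q.1)) ((z n).1.1 0%N (clamp b q.1)).
  have := ler_normD ((z n).1.1 0%N (clamp b q.1) - u0 (clamp b q.1)) (u0 (clamp b q.1)).
  rewrite !subrK /W => h6 h7; clear -h1 h2 h3 h5 h6 h7; lra.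
have [U PU [Uinfty Ulim]] := ultralimit R.
pose u (q : R * R) := sval (cid (Ulim _ _ (Wb ^~ q))).
have uP x t : - b <= x <= b -> 0 <= t -> forall r, 0 < r -> U [set n | `|W n x t - u (x, t)| <= r].
  move=> xb tp r r0; rewrite /u; case: cid => l /= /(_ r r0).
  by rewrite clamp_id// max_l.
have Utau r : 0 < r -> U [set n | tau n <= r].
  move=> r0; apply: filterS (Uinfty (Num.truncn r^-1)) => n /= h.
  rewrite /tau -[r]invrK lef_pV2 ?posrE ?invr_gt0//.
  by apply: le_trans (ltW (truncnS_gt _)) _; rewrite ler_nat ltnS.
have uequi r x y t s : 0 < r -> - b <= x <= b -> - b <= y <= b -> 0 <= t -> 0 <= s ->
    `|x - y| <= dl r -> `|u (x, t) - u (y, s)| <= r + L * `|t - s|.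
  move=> r0 xb yb tp sp xy.
  have K0 : 0 < 2 + 2 * L by clear -L0; lra.
  apply: (le_addgt0 K0) => q q0.
  have [n /= [h1 [h2 h3]]] := filter_ex (filterI (uP x t xb tp q q0)
    (filterI (uP y s yb sp q q0) (Utau q q0))).
  have h4 := equi n r x y t s r0 xb yb tp sp xy.
  have h5 : L * (`|t - s| + 2 * tau n) <= L * (`|t - s| + 2 * q).
    by rewrite ler_wpM2l//; clear -h3; lra.
  by move: h1 h2 h4; rewrite !ler_norml; clear -h5; lra.
exists u; split.
- apply/within2P => -[x t] /chalfstripE[xb tp] r r0.
  have r2 : 0 < r / 2 by clear -r0; lra.
  have L1 : 0 < L + 1 by clear -L0; lra.
  exists (Num.min (dl (r / 2)) (r / 2 / (L + 1))); first by rewrite lt_min dl0//= divr_gt0.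
  move=> [y s] /chalfstripE[yb sp] /=; rewrite !le_min => /andP[yx _] /andP[_ st].
  apply: le_trans (uequi _ y x s t r2 yb xb sp tp yx) _.
  have : (L + 1) * `|s - t| <= r / 2 by rewrite mulrC -ler_pdivlMr.
  by have := normr_ge0 (s - t); clear; lra.
- move=> r T r0.
  have L1 : 0 < L + 1 by clear -L0; lra.
  have r8 : 0 < r / 8 by clear -r0; lra.
  pose hx := dl (r / 8); have hx0 : 0 < hx by exact: dl0.
  pose ht := r / 8 / (L + 1); have ht0 : 0 < ht by rewrite divr_gt0.
  have Lht : L * ht <= r / 8.
    have : (L + 1) * ht = r / 8 by rewrite /ht mulrCA divff ?mulr1// gt_eqF.
    by clear -ht0; lra.
  pose tq := Num.min ht (r / 16 / (L + 1)).
  have tq0 : 0 < tq by rewrite lt_min ht0 !divr_gt0.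
  have Ltq q : q <= tq -> 2 * (L * q) <= r / 8.
    rewrite /tq le_min => /andP[_ ]; rewrite ler_pdivlMr// => hq.
    have [qp|qn] := leP 0 q; first by clear -qp hq; lra.
    have : L * q <= 0 by rewrite mulr_ge0_le0// ltW.
    by clear -r0; lra.
  have tr0 : 0 < Num.min tq r by rewrite lt_min tq0.
  pose ax k := Num.min (- b + k%:R * hx) b.
  have axb k : - b <= ax k <= b.
    rewrite /ax ge_min lexx orbT andbT le_min lerDl; apply/andP; split.
      by rewrite mulr_ge0// ltW.
    by clear -b0; lra.
  have grid : U [set n | forall k, (k < (Num.truncn (2 * b / hx)).+1)%N ->
      forall l, (l < (Num.truncn (T / ht)).+1)%N ->
        `|W n (ax k) (l%:R * ht) - u (ax k, l%:R * ht)| <= r / 8].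
    apply: (@filter_bounded_forall U (fun k n => forall l, (l < _)%N ->
      `|W n (ax k) (l%:R * ht) - u (ax k, l%:R * ht)| <= r / 8)) => k.
    apply: (@filter_bounded_forall U (fun l n =>
      `|W n (ax k) (l%:R * ht) - u (ax k, l%:R * ht)| <= r / 8)) => l.
    by apply: uP => //; rewrite mulr_ge0// ltW.
  have [n /= [h1 [h2 h3]]] := filter_ex (filterI grid (filterI (Utau _ tr0)
     (Uinfty (Num.truncn r^-1)))).
  move: h2; rewrite le_min => /andP[h2 h2'].
  exists (tau n), (NN n), L, (z n).1.1, (z n).1.2, (z n).2; split => //.
  + rewrite /NN; apply: le_trans (_ : n.+1%:R <= _); last by rewrite lerDr.
    by apply: le_trans (ltW (truncnS_gt _)) _; rewrite ler_nat ltnS.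
  + by have [] := Hz n.
  move=> i x xb; have it0 : 0 <= i%:R * tau n by rewrite mulr_ge0// ltW.
  have -> : (z n).1.1 i x = W n x (i%:R * tau n) by rewrite /W ji.
  move: (i%:R * tau n) it0 => t t0 tT.
  have xb0 : 0 <= x + b by clear -xb; lra.
  have [k1 k2] := grid_point hx0 xb0; set k := Num.truncn _ in k1 k2.
  have [l1 l2] := grid_point ht0 t0; set l := Num.truncn _ in l1 l2.
  have kK : (k < (Num.truncn (2 * b / hx)).+1)%N.
    rewrite ltnS; apply: le_truncn; rewrite ler_pM2r ?invr_gt0//; clear -xb; lra.
  have lK : (l < (Num.truncn (T / ht)).+1)%N.
    by rewrite ltnS; apply: le_truncn; rewrite ler_pM2r ?invr_gt0.
  have axE : ax k = - b + k%:R * hx by rewrite /ax min_l//; clear -k1 xb; lra.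
  have h4 := h1 k kK l lK.
  have lt0 : 0 <= l%:R * ht by rewrite mulr_ge0// ltW.
  have xa : `|x - ax k| <= dl (r / 8).
    by rewrite axE (_ : x - _ = x + b - k%:R * hx)//; ring.
  have h5 := uequi _ x (ax k) t (l%:R * ht) r8 xb (axb k) t0 lt0 xa.
  have h6 := equi n _ x (ax k) t (l%:R * ht) r8 xb (axb k) t0 lt0 xa.
  have h7 : L * `|t - l%:R * ht| <= L * ht by rewrite ler_wpM2l.
  have h8 := Ltq _ h2.
  by move: h4 h5 h6; rewrite mulrDr !ler_norml; clear -h7 h8 Lht r0; lra.
- move=> x xb; apply/ler_addgt0Pr => q q0.
  have [n /= h1] := filter_ex (uP x 0 xb (lexx 0) q q0).
  have [_ H _] := Hz n; have := H x xb; have -> : (z n).1.1 0%N x = W n x 0.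
    by rewrite /W; have := ji n 0%N; rewrite mul0r => ->.
  by move: h1; rewrite !ler_norml; clear; lra.
Qed.

Lemma supersolution_shift (R : realType) (b : R) (f g : R -> R) (v : R * R -> R) (c : R) :
  {within chalfstrip b, continuous v} -> viscosity_supersolution b f g v ->
  {within chalfstrip b, continuous (fun q => v q + c)} /\
  viscosity_supersolution b f g (fun q => v q + c).
Proof.
move=> cv [_ H1 H2].
have cv' : {within chalfstrip b, continuous (fun q => v q + c)}.
  by move=> q; apply: cvgD; [exact: cv|exact: cvg_cst].
have shift phi p : local_min_on (chalfstrip b) (fun q => v q + c - phi q) p ->
    local_min_on (chalfstrip b) (fun q => v q - phi q) p.
  move=> /local_min_onP[d d0 H]; apply/local_min_onP; exists d => // q Aq q1 q2.
  by have := H q Aq q1 q2; clear; lra.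
split=> //; split; first exact: continuous_lsc.
  by move=> phi p C2 hp /shift; exact: H1.
move=> phi t C2 t0; have [h1 h2] := H2 phi t C2 t0.
by split=> /shift.
Qed.

End Existence.

(** Schemes that are close to some un n are close to u as well. *)
Lemma approximable_uniform_limit (R : realType) (b : R) (f g : R -> R)
    (un : nat -> R * R -> R) (u : R * R -> R) :
  (forall n, {within chalfstrip b, continuous un n}) -> (forall n, approximable b f g (un n)) ->
  (forall e, 0 < e -> exists n, forall q, chalfstrip b q -> `|un n q - u q| <= e) ->
  {within chalfstrip b, continuous u} /\ approximable b f g u.
Proof.
move=> cun aun lim; split.
  apply/within2P => q Aq r r0; have r3 : 0 < r / 3 by clear -r0; lra.
  have [n Hn] := lim _ r3; have /within2P/(_ q Aq _ r3)[d d0 Hd] := cun n.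
  exists d => // y Ay h1 h2; move: (Hd y Ay h1 h2) (Hn q Aq) (Hn y Ay).
  by rewrite !ler_norml; clear; lra.
move=> e T e0; have e2 : 0 < e / 2 by clear -e0; lra.
have [n Hn] := lim _ e2; have [tau [N [L [w [p [m [t0 te eN S H]]]]]]] := aun n _ T e2.
exists tau, N, L, w, p, m; split => //; first by clear -te e0; lra.
  by apply: le_trans eN; rewrite lef_pV2 ?posrE//; clear -e0; lra.
move=> i x xb iT; have Aq : chalfstrip b (x, i%:R * tau).
  by apply/chalfstripE; split => //; rewrite mulr_ge0// ltW.
by move: (Hn _ Aq) (H i x xb iT); rewrite !ler_norml; clear; lra.
Qed.

Lemma uniformly_cauchy_limit (R : realType) (T : Type) (A : set T) (un : nat -> T -> R) :
  (forall n k q, A q -> `|un n q - un k q| <= n.+1%:R^-1 + k.+1%:R^-1) ->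
  exists u, forall e, 0 < e -> exists n0, forall n, (n0 <= n)%N ->
    forall q, A q -> `|un n q - u q| <= e.
Proof.
move=> cau; have lim q : exists l, A q -> forall n, `|un n q - l| <= n.+1%:R^-1.
  have [Aq|nAq] := pselect (A q); last by exists 0.
  have bd n : `|un n q| <= `|un 0%N q| + 2.
    have h := cau n 0%N q Aq; have h1 : (n.+1%:R^-1 : R) <= 1 by rewrite invf_le1// ler1n.
    have h2 := ler_normD (un n q - un 0%N q) (un 0%N q); rewrite subrK in h2.
    rewrite [1%:R^-1]invr1 in h; apply: le_trans h2 _; rewrite addrC lerD2l.
    by apply: le_trans h _; rewrite lerD2r.
  have [U PU [Uinfty Ulim]] := ultralimit R.
  have [l Hl] := Ulim _ _ bd; exists l => _ n; apply/ler_addgt0Pr => e e0.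
  have e2 : 0 < e / 2 by clear -e0; lra.
  have [k /= [h1 h2]] := filter_ex (filterI (Hl _ e2) (Uinfty (Num.truncn (e / 2)^-1))).
  have h3 : (k.+1%:R^-1 : R) <= e / 2.
    rewrite -[X in _ <= X]invrK lef_pV2 ?posrE ?invr_gt0//.
    by apply: le_trans (ltW (truncnS_gt _)) _; rewrite ler_nat ltnS.
  move: (cau n k q Aq) h1 h3; rewrite !ler_norml.
  by move: n.+1%:R^-1 k.+1%:R^-1 => r s; clear; lra.
have [u Hu] := choice lim; exists u => e e0; exists (Num.truncn e^-1) => n hn q Aq.
apply: le_trans (Hu q Aq n) _; rewrite -[X in _ <= X]invrK lef_pV2 ?posrE ?invr_gt0//.
by apply: le_trans (ltW (truncnS_gt _)) _; rewrite ler_nat ltnS.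
Qed.

Theorem theorem1p1 (R : realType) (b : R) (f g u0 : R -> R)
    (alpha Cp Cm : R)
    (b_gt0 : 0 < b)
    (f_cont : continuous f)
    (f_incr : {homo f : x y / x < y})
    (f0 : f 0 = 0)
    (f_pinfty : f s @[s --> +oo] --> +oo)
    (f_ninfty : f s @[s --> -oo] --> -oo)
    (g_cont : continuous g)
    (g_gt0 : forall s, 0 < g s)
    (alpha_gt2 : 2 < alpha)
    (Cp_gt0 : 0 < Cp)
    (Cm_gt0 : 0 < Cm)
    (g_pinfty : `|s| `^ alpha * g s @[s --> +oo] --> Cp)
    (g_ninfty : `|s| `^ alpha * g s @[s --> -oo] --> Cm)
    (u0_cont : {within `[- b, b], continuous u0}) :
  exists2 u : R * R -> R, ibvp_solution b f g u0 u &
    forall v : R * R -> R, ibvp_solution b f g u0 v ->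
      forall p, chalfstrip b p -> v p = u p.
Proof.
have cmp : forall v1 v2 : R * R -> R, {within chalfstrip b, continuous v1} ->
  {within chalfstrip b, continuous v2} ->
  viscosity_subsolution b f g v1 -> viscosity_supersolution b f g v2 ->
  (forall x, - b <= x <= b -> v1 (x, 0) <= v2 (x, 0)) ->
  forall x t, - b <= x <= b -> 0 <= t -> v1 (x, t) <= v2 (x, t).
  exact: (comparison b_gt0 f_cont f_incr f0 f_pinfty f_ninfty g_cont g_gt0 alpha_gt2
    Cp_gt0 Cm_gt0 g_pinfty g_ninfty).
have cu : contw (- b) b u0 by exact/contw_within.
have solve (n : nat) : exists u : R * R -> R, [/\ {within chalfstrip b, continuous u},
    approximable b f g u & forall x, - b <= x <= b -> `|u (x, 0) - u0 x| <= n.+1%:R^-1].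
  have n0 : 0 < n.+1%:R^-1 :> R by rewrite invr_gt0.
  have [L [Ns [dl [L0 _ dl0 fam]]]] := approximating_schemes b_gt0 f_cont f_incr f0 f_pinfty
    f_ninfty g_cont g_gt0 alpha_gt2 Cp_gt0 Cm_gt0 g_pinfty g_ninfty cu n0.
  exact: (scheme_limit b_gt0 f_incr g_gt0 cu n0 L0 dl0 fam).
have [un Hun] := choice solve.
have vis u : {within chalfstrip b, continuous u} -> approximable b f g u ->
  viscosity_solution b f g u by exact: approximable_solution.
(* By comparison with a shifted supersolution, initial errors are never exceeded. *)
have half n k q : chalfstrip b q -> un n q - un k q <= n.+1%:R^-1 + k.+1%:R^-1.
  case: q => x t /chalfstripE[xb t0].
  have [cn an i_n] := Hun n; have [ck ak ik] := Hun k.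
  have [_ sub _] := vis _ cn an; have [_ _ sup] := vis _ ck ak.
  have [cs ss] := supersolution_shift (n.+1%:R^-1 + k.+1%:R^-1) ck sup.
  have := cmp _ _ cn cs sub ss _ x t xb t0; rewrite /= lerBlDl; apply => y yb.
  move: (i_n y yb) (ik y yb); rewrite !ler_norml.
  by move: n.+1%:R^-1 k.+1%:R^-1 => r s; clear; lra.
have cau n k q : chalfstrip b q -> `|un n q - un k q| <= n.+1%:R^-1 + k.+1%:R^-1.
  move=> Aq; have := half n k q Aq; have := half k n q Aq; rewrite ler_norml.
  by move: n.+1%:R^-1 k.+1%:R^-1 => r s; clear; lra.
have [u lim] := uniformly_cauchy_limit cau.
have [cu' au] : {within chalfstrip b, continuous u} /\ approximable b f g u.
  apply: (@approximable_uniform_limit _ _ _ _ un) => [n|n|e e0]; try by have [] := Hun n.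
  by have [n0 H] := lim e e0; exists n0; exact: H.
have uini x : - b <= x <= b -> u (x, 0) = u0 x.
  move=> xb; apply/eqP; rewrite -subr_eq0 -normr_le0; apply/ler_addgt0Pr => e e0.
  rewrite add0r; have e2 : 0 < e / 2 by clear -e0; lra.
  have [n0 H] := lim _ e2; pose n := maxn n0 (Num.truncn (e / 2)^-1).
  have Aq : chalfstrip b (x, 0) by apply/chalfstripE.
  have [_ _ i_n] := Hun n; have h3 : (n.+1%:R^-1 : R) <= e / 2.
    rewrite -[X in _ <= X]invrK lef_pV2 ?posrE ?invr_gt0//.
    by apply: le_trans (ltW (truncnS_gt _)) _; rewrite ler_nat ltnS leq_maxr.
  move: (H n (leq_maxl _ _) _ Aq) (i_n x xb) h3; rewrite !ler_norml.
  by move: n.+1%:R^-1 => r; clear; lra.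
have vu := vis u cu' au; exists u.
  by split=> // x; rewrite in_itv /= => xb; exact: uini.
move=> v [[cv subv supv] vini] [x t] /chalfstripE[xb t0].
have [_ subu supu] := vu.
have ini y : - b <= y <= b -> v (y, 0) = u (y, 0).
  by move=> yb; rewrite uini//; apply: vini; rewrite in_itv.
by apply/eqP; rewrite eq_le; apply/andP; split; apply: cmp => // y yb; rewrite ini.
Qed.
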